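(* Let $(g,A)$ be a Weyl geometry on a 4-dimensional real oriented manifold $\mathcal M$ and let $\Lambda,F,F',E$ be the canonical 1-forms on the associated twistor bundle $\mathcal{PP}'$. 1) The equation $dE\wedge\Lambda\wedge F\wedge E=0$ is satisfied everywhere on $\mathcal{PP}'$ if and only if the Weyl geometry $(g,A)$ on $\mathcal M$ is anti-self-dual. 2) The equation $dE\wedge\Lambda\wedge F'\wedge E=0$ is satisfied everywhere on $\mathcal{PP}'$ if and only if the Weyl geometry $(g,A)$ satisfies the Einstein-Weyl equations on $\mathcal M$.
   Context: Weyl geometry. A metric on $\mathcal M$ is a nondegenerate symmetric bilinear complex-valued form. A Weyl geometry $(g,A)$ consists of a metric $g$ and a complex-valued 1-form $A$. In a coframe $(\theta^i)$ of complex-valued 1-forms, $g=g_{ij}\theta^i\theta^j$, the Weyl connection 1-forms $\Gamma^i_{\ j}$ are uniquely determined by $dg_{ij}-g_{ik}\Gamma^k_{\ j}-g_{jk}\Gamma^k_{\ i}=-A\,g_{ij}$ and $d\theta^i=-\Gamma^i_{\ j}\wedge\theta^j$. Curvature: $\frac12R_{ijkl}\theta^k\wedge\theta^l=g_{ih}(d\Gamma^h_{\ j}+\Gamma^h_{\ k}\wedge\Gamma^k_{\ j})$, $R_{jl}=g^{ik}R_{ijkl}$, $R=g^{ij}R_{ij}$, $S_{ij}=R_{(ij)}-\frac14Rg_{ij}$. The Einstein-Weyl equations are $S_{ij}=0$. Let $w_{ijkl}$ be the Weyl tensor of the Levi-Civita connection of $g$ and $w_{ij}=\frac12w_{ijkl}\theta^k\wedge\theta^l$.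 A null cotetrad is a coframe $(\theta^1,\dots,\theta^4)=(M,P,N,K)$ with $g=MP-NK$, where $\alpha\beta=\frac12(\alpha\otimes\beta+\beta\otimes\alpha)$, and compatible with the orientation in the sense that the volume form is $\eta=M\wedge P\wedge N\wedge K$. The dual frame is $(m,p,n,k)$. Self-dual 2-forms are spanned by $P\wedge K,\ N\wedge K-M\wedge P,\ N\wedge M$; anti-self-dual ones by $M\wedge K,\ N\wedge K+M\wedge P,\ N\wedge P$. $(g,A)$ is anti-self-dual (self-dual) if all 2-forms $w_{ij}$ are anti-self-dual (self-dual) on $\mathcal M$. Twistor bundle. Totally null 2-planes of $T_x\mathcal M^{\mathbb C}$ form two disjoint 2-spheres: self-dual ones $s=\mathrm{Span}\{zm-k,zn-p\}$ and anti-self-dual ones $s'=\mathrm{Span}\{z'p-k,z'n-m\}$, with $z,z'\in\mathbb C\cup\{\infty\}$. $\mathcal P$ (resp. $\mathcal P'$) is the $S^2$-bundle over $\mathcal M$ of all self-dual (resp. anti-self-dual) such planes, and $\mathcal{PP}'$ is their fibre product (real dimension 8), with local coordinates $(x,z,\bar z,z',\bar z')$. On $\mathcal{PP}'$ (pullbacks not written) $$E=dz-\Gamma^3_{\ 2}+z(\Gamma^1_{\ 1}-\Gamma^4_{\ 4})+z^2\Gamma^2_{\ 3},\quad \Lambda=-N-zz'K-zP-z'M,\quad F=M+zK,\quad F'=P+z'K.$$ Intrinsically $E$ and $\Lambda$ are defined up to multiplication by nonvanishing functions, $F$ up to $F\to\alpha F+\beta\Lambda$ and $F'$ up to $F'\to\alpha^{-1}F'+\gamma\Lambda$,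 $\alpha\neq0$; the equations do not depend on these choices. Standing assumption: $\mathcal M$ is such that $E$ can be chosen globally (e.g. an open subset of $\mathbb R^4$). *)

(* Defs.v *)
From HB Require Import structures.
From mathcomp Require Import all_boot all_order all_algebra all_fingroup.
From mathcomp Require Import complex.
From mathcomp Require Import all_classical all_reals all_analysis.

Set Implicit Arguments.
Unset Strict Implicit.
Unset Printing Implicit Defensive.

Import Order.TTheory GRing.Theory Num.Theory numFieldNormedType.Exports.
Local Open Scope classical_set_scope.
Local Open Scope ring_scope.

Section Smooth.
Variables (R : realType) (n : nat).
Implicit Types (U : set 'rV[R]_n) (f : 'rV[R]_n -> R) (h : 'rV[R]_n -> R[i]).

(* The i-th coordinate vector. *)
Definition evec (i : 'I_n) : 'rV[R]_n := delta_mx 0 i.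

Fixpoint class_C (m : nat) U f : Prop :=
  (forall x, U x -> {for x, continuous f}) /\
  (if m is m'.+1 then
     forall i, (forall x, U x -> derivable f x (evec i)) /\
               class_C m' U ('D_(evec i) f)
   else True).

(* C^oo on the open set U; nothing is required outside U. *)
Definition smooth U f := forall m, class_C m U f.

Definition csmooth U h :=
  smooth U (fun x => complex.Re (h x)) /\ smooth U (fun x => complex.Im (h x)).

(* The partial derivative of a complex-valued function along a real
   coordinate. *)
Definition pderive (i : 'I_n) h (x : 'rV[R]_n) : R[i] :=
  Complex ('D_(evec i) (fun y => complex.Re (h y)) x)
          ('D_(evec i) (fun y => complex.Im (h y)) x).

End Smooth.

(* Complex-valued differential k-forms on (open subsets of) R^n, given by their
   components: w x v is the value of w at x on the coordinate vectors
   d/dx^{v 0}, ..., d/dx^{v (k-1)}.  Alternation is not imposed: every form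
   below is built from functions and 1-forms by wedge and d, which produce
   alternating components. *)
Definition dform (R : realType) (n k : nat) : Type :=
  'rV[R]_n -> ('I_k -> 'I_n) -> R[i].

Section Forms.
Variable R : realType.

Definition smooth_form n k (U : set 'rV[R]_n) (w : dform R n k) :=
  forall v, csmooth U (w ^~ v).

Definition scale_form n k (f : 'rV[R]_n -> R[i]) (w : dform R n k) :
  dform R n k := fun x v => f x * w x v.

(* Normalised so that (a /\ b)(u, v) = a(u) b(v) - a(v) b(u) on 1-forms. *)
Definition wedge n k l (a : dform R n k) (b : dform R n l) : dform R n (k + l) :=
  fun x v => ((k`! * l`!)%N%:R)^-1 *
    \sum_(s : 'S_(k + l)) (-1) ^+ s *
      (a x (fun i => v (s (lshift l i))) * b x (fun j => v (s (rshift k j)))).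

Definition ext_d n k (w : dform R n k) : dform R n k.+1 :=
  fun x v => \sum_(i < k.+1) (-1) ^+ i *
    pderive (v i) (w ^~ (fun j => v (lift i j))) x.

(* The differential of a function, seen as a 0-form. *)
Definition dfun n (f : 'rV[R]_n -> R[i]) : dform R n 1 :=
  ext_d ((fun x _ => f x) : dform R n 0).

Definition cjacobian m n (phi : 'rV[R]_m -> 'rV[R]_n) x : 'M[R[i]]_(m, n) :=
  map_mx (real_complex R) ('J phi x).

(* ('J phi x) i j is the i-th partial derivative of the j-th component. *)
Definition pullback m n k (phi : 'rV[R]_m -> 'rV[R]_n) (w : dform R n k) :
  dform R m k :=
  fun x v => \sum_(u : {ffun 'I_k -> 'I_n})
    (\prod_(i < k) cjacobian phi x (v i) (u i)) * w (phi x) u.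

End Forms.

Declare Scope dform_scope.
Delimit Scope dform_scope with DF.
Notation "a \wedge b" := (wedge a b) (at level 40, left associativity)
  : dform_scope.
Notation "f \scale w" := (scale_form f w) (at level 38, right associativity)
  : dform_scope.
Local Open Scope dform_scope.

(* Smooth oriented n-manifolds, presented by an oriented smooth atlas. *)
Record oriented_manifold (R : realType) (n : nat) := OrientedManifold {
  carrier :> topologicalType;
  manifold_hausdorff : hausdorff_space carrier;
  manifold_second_countable : @second_countable carrier;
  chart : Type;
  dom : chart -> set carrier;
  coord : chart -> carrier -> 'rV[R]_n;
  param : chart -> 'rV[R]_n -> carrier;
  dom_cover : \bigcup_c dom c = setT;
  dom_open : forall c, open (dom c);
  image_open : forall c, open (coord c @` dom c);
  coordK : forall c p, dom c p -> param c (coord c p) = p;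
  coord_continuous : forall c, {within dom c, continuous (coord c)};
  param_continuous : forall c, {within coord c @` dom c, continuous (param c)};
  transition_smooth : forall (a b : chart) (j : 'I_n),
    smooth (coord a @` (dom a `&` dom b))
      (fun x => coord b (param a x) 0 j);
  transition_oriented : forall (a b : chart) (x : 'rV[R]_n),
    (coord a @` (dom a `&` dom b)) x ->
    0 < \det ('J (coord b \o param a) x)
}.

Section Geometry.
Variable R : realType.

Definition chart_image n (M : oriented_manifold R n) (c : chart M) :
  set 'rV[R]_n := coord c @` dom c.

Definition overlap n (M : oriented_manifold R n) (a b : chart M) :
  set 'rV[R]_n := coord a @` (dom a `&` dom b).

Definition transition n (M : oriented_manifold R n) (a b : chart M) :
  'rV[R]_n -> 'rV[R]_n := coord b \o param a.

(* A pair (g, A), given by the components of g and A in every chart. *)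
Record weyl_geometry (M : oriented_manifold R 4) := WeylGeometry {
  metric : chart M -> 'rV[R]_4 -> 'M[R[i]]_4;
  weyl_form : chart M -> dform R 4 1;
  metric_smooth : forall c i j,
    csmooth (chart_image c) (fun x => metric c x i j);
  metric_sym : forall c x, chart_image c x -> (metric c x)^T = metric c x;
  metric_nondeg : forall c x, chart_image c x -> metric c x \in unitmx;
  metric_transition : forall (a b : chart M) x, overlap a b x ->
    let J := cjacobian (transition a b) x in
    metric a x = J *m metric b (transition a b x) *m J^T;
  weyl_form_smooth : forall c, smooth_form (chart_image c) (weyl_form c);
  weyl_form_transition : forall (a b : chart M) x, overlap a b x ->
    weyl_form a x = pullback (transition a b) (weyl_form b) x
}.

(* The volume form eta = vol dx^1 /\ dx^2 /\ dx^3 /\ dx^4 that orients g.  For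
   a complex metric the orientation of the manifold does not select one of the
   square roots, so eta is part of the data.  The factor 16 comes from
   eta = M /\ P /\ N /\ K and g = M P - N K, the Gram determinant of
   (m, p, n, k) being 1/16. *)
Record volume_form (M : oriented_manifold R 4) (G : weyl_geometry M) :=
  VolumeForm {
  vol : chart M -> 'rV[R]_4 -> R[i];
  vol_smooth : forall c, csmooth (chart_image c) (vol c);
  vol_sqr : forall c x, chart_image c x ->
    vol c x ^+ 2 = 16%:R * \det (metric G c x);
  vol_transition : forall (a b : chart M) x, overlap a b x ->
    vol a x = \det (cjacobian (transition a b) x) * vol b (transition a b x)
}.

(* The indices 1, 2, 3, 4 of the text. *)
Definition o1 : 'I_4 := @Ordinal 4 0 isT.
Definition o2 : 'I_4 := @Ordinal 4 1 isT.
Definition o3 : 'I_4 := @Ordinal 4 2 isT.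
Definition o4 : 'I_4 := @Ordinal 4 3 isT.

Implicit Types (U : set 'rV[R]_4) (g : 'rV[R]_4 -> 'M[R[i]]_4)
  (A : dform R 4 1) (theta : 'I_4 -> dform R 4 1)
  (Gamma : 'I_4 -> 'I_4 -> dform R 4 1) (x : 'rV[R]_4).

(* Row i holds the components of theta^i; column k of the inverse holds the
   components of the k-th vector of the dual frame. *)
Definition coframe_mx theta x : 'M[R[i]]_4 :=
  \matrix_(i, a) theta i x (fun=> a).

Definition dual_frame theta x : 'M[R[i]]_4 := invmx (coframe_mx theta x).

Definition coframe U theta :=
  (forall i, smooth_form U (theta i)) /\
  (forall x, U x -> coframe_mx theta x \in unitmx).

(* The matrix (g_ij) with g = g_ij theta^i theta^j, and its inverse (g^ij). *)
Definition frame_metric g theta x : 'M[R[i]]_4 :=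
  (dual_frame theta x)^T *m g x *m dual_frame theta x.

Definition frame_cometric g theta x : 'M[R[i]]_4 :=
  invmx (frame_metric g theta x).

(* Gamma i j is the 1-form Gamma^i_j. *)
Definition weyl_connection U g A theta Gamma :=
  [/\ forall i j, smooth_form U (Gamma i j),
      forall i j x v, U x ->
        dfun (fun y => frame_metric g theta y i j) x v
        - \sum_k frame_metric g theta x i k * Gamma k j x v
        - \sum_k frame_metric g theta x j k * Gamma k i x v
        = - A x v * frame_metric g theta x i j
    & forall i x, U x ->
        ext_d (theta i) x = (- \sum_j (Gamma i j \wedge theta j)) x].

Definition levi_civita_connection U g theta Gamma :=
  weyl_connection U g 0 theta Gamma.

(* g_ih (d Gamma^h_j + Gamma^h_k /\ Gamma^k_j) *)
Definition curvature_form g theta Gamma (i j : 'I_4) : dform R 4 2 :=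
  \sum_h (fun y => frame_metric g theta y i h) \scale
    (ext_d (Gamma h j) + \sum_k (Gamma h k \wedge Gamma k j)).

(* R_ijkl, the value of the curvature form on the k-th and l-th vectors of the
   dual frame. *)
Definition riemann g theta Gamma (i j k l : 'I_4) x : R[i] :=
  \sum_a \sum_b curvature_form g theta Gamma i j x
                  (fun r : 'I_2 => if r == ord0 then a else b) *
    dual_frame theta x a k * dual_frame theta x b l.

Definition ricci g theta Gamma (j l : 'I_4) x : R[i] :=
  \sum_i \sum_k frame_cometric g theta x i k * riemann g theta Gamma i j k l x.

Definition scalar_curvature g theta Gamma x : R[i] :=
  \sum_i \sum_j frame_cometric g theta x i j * ricci g theta Gamma i j x.

(* S_ij = R_(ij) - R g_ij / 4 *)
Definition sym_ricci0 g theta Gamma (i j : 'I_4) x : R[i] :=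
  (ricci g theta Gamma i j x + ricci g theta Gamma j i x) / 2%:R
  - scalar_curvature g theta Gamma x * frame_metric g theta x i j / 4%:R.

(* w_ijkl in dimension 4, for Gamma the Levi-Civita connection forms. *)
Definition weyl_tensor g theta Gamma (i j k l : 'I_4) x : R[i] :=
  let h := frame_metric g theta x in
  let Ric a b := ricci g theta Gamma a b x in
  riemann g theta Gamma i j k l x
  - (h i k * Ric j l - h i l * Ric j k - h j k * Ric i l + h j l * Ric i k)
      / 2%:R
  + scalar_curvature g theta Gamma x * (h i k * h j l - h i l * h j k) / 6%:R.

(* w_ij = w_ijkl theta^k /\ theta^l / 2 *)
Definition weyl_2form g theta Gamma (i j : 'I_4) : dform R 4 2 :=
  \sum_k \sum_l (fun y => weyl_tensor g theta Gamma i j k l y / 2%:R) \scale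
    (theta k \wedge theta l).

(* Components of the symmetric product of two 1-forms. *)
Definition sym_prod (al be : dform R 4 1) x (a b : 'I_4) : R[i] :=
  (al x (fun=> a) * be x (fun=> b) + be x (fun=> a) * al x (fun=> b)) / 2%:R.

(* A null cotetrad (theta^1, ..., theta^4) = (M, P, N, K) on the open subset U
   of the image of the chart c; the last condition says eta = M /\ P /\ N /\ K. *)
Definition null_cotetrad (M : oriented_manifold R 4) (G : weyl_geometry M)
    (eta : volume_form G) (c : chart M) U theta :=
  [/\ open U, U `<=` chart_image c, coframe U theta,
      forall x a b, U x ->
        metric G c x a b = sym_prod (theta o1) (theta o2) x a b
                           - sym_prod (theta o3) (theta o4) x a b
    & forall x, U x ->
        vol eta c x =
        (theta o1 \wedge theta o2 \wedge theta o3 \wedge theta o4) x id].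

(* The 2-form w is anti-self-dual at x, for theta = (M, P, N, K):
   it is a combination of M /\ K, N /\ K + M /\ P and N /\ P. *)
Definition asd_2form theta (w : dform R 4 2) x :=
  exists r s t : R[i], forall v,
    w x v = r * (theta o1 \wedge theta o4) x v
          + s * (theta o3 \wedge theta o4 + theta o1 \wedge theta o2) x v
          + t * (theta o3 \wedge theta o2) x v.

Definition anti_self_dual (M : oriented_manifold R 4) (G : weyl_geometry M)
    (eta : volume_form G) :=
  forall (c : chart M) U theta Gamma,
    null_cotetrad eta c U theta ->
    levi_civita_connection U (metric G c) theta Gamma ->
    forall x (i j : 'I_4), U x ->
      asd_2form theta (weyl_2form (metric G c) theta Gamma i j) x.

Definition einstein_weyl (M : oriented_manifold R 4) (G : weyl_geometry M) :=
  forall (c : chart M) U theta Gamma,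
    open U -> U `<=` chart_image c -> coframe U theta ->
    weyl_connection U (metric G c) (weyl_form G c) theta Gamma ->
    forall x (i j : 'I_4), U x ->
      sym_ricci0 (metric G c) theta Gamma i j x = 0.

(* A null cotetrad on U identifies U x R^4 with the open part z, z' <> oo of the
   bundle PP' over U: the coordinates on 'rV[R]_(4 + 4) are x and then
   (Re z, Im z, Re z', Im z'). *)
Definition base (u : 'rV[R]_(4 + 4)) : 'rV[R]_4 := lsubmx u.

Definition zcoord (u : 'rV[R]_(4 + 4)) : R[i] :=
  Complex (rsubmx u 0 o1) (rsubmx u 0 o2).

Definition zcoord' (u : 'rV[R]_(4 + 4)) : R[i] :=
  Complex (rsubmx u 0 o3) (rsubmx u 0 o4).

Definition lift_form (w : dform R 4 1) : dform R (4 + 4) 1 := pullback base w.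

Definition Eform Gamma : dform R (4 + 4) 1 :=
  dfun zcoord - lift_form (Gamma o3 o2)
  + zcoord \scale (lift_form (Gamma o1 o1) - lift_form (Gamma o4 o4))
  + (fun u => zcoord u ^+ 2) \scale lift_form (Gamma o2 o3).

Definition Lambdaform theta : dform R (4 + 4) 1 :=
  - lift_form (theta o3)
  - (fun u => zcoord u * zcoord' u) \scale lift_form (theta o4)
  - zcoord \scale lift_form (theta o2)
  - zcoord' \scale lift_form (theta o1).

Definition Fform theta : dform R (4 + 4) 1 :=
  lift_form (theta o1) + zcoord \scale lift_form (theta o4).

Definition Fform' theta : dform R (4 + 4) 1 :=
  lift_form (theta o2) + zcoord' \scale lift_form (theta o4).

(* The equation Phi = 0 holds at every point of PP', where Phi is a form built
   from a null cotetrad and its Weyl connection forms.  The points z = oo and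
   z' = oo are covered as well: (-K, N, P, -M) and (N, -K, M, -P) are null
   cotetrads too, and replacing (M, P, N, K) by them changes (z, z') into
   (1/z, -z') and (-z, 1/z') respectively. *)
Definition vanishes_on_PP' (M : oriented_manifold R 4) (G : weyl_geometry M)
    (eta : volume_form G) k
    (Phi : ('I_4 -> dform R 4 1) -> ('I_4 -> 'I_4 -> dform R 4 1) ->
           dform R (4 + 4) k) :=
  forall (c : chart M) U theta Gamma,
    null_cotetrad eta c U theta ->
    weyl_connection U (metric G c) (weyl_form G c) theta Gamma ->
    forall u v, U (base u) -> Phi theta Gamma u v = 0.

End Geometry.

(* Main.v *)
(* Over a null cotetrad, [frame_metric] is constant, so the Weyl connection is
   skew up to a trace and [E = dz + eps] where [eps] is quadratic in [z].  Modulo [E],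
   [dE] is a 2-form on the base whose coefficients are the components
   [R_(ij) k l] of the curvature on the self-dual spinors; both equations then say
   that this 2-form vanishes on the plane annihilated by [Lambda] and [F], resp.
   [Lambda] and [F'].  The first one is a quartic in [z] with the components of the
   self-dual Weyl tensor as coefficients, provided that [dA = 0]; replacing [A] by
   another form changes [eps] by a combination of the 1-forms vanishing on that
   plane, which leaves the quartic unchanged, so one may take [A = 0].  The second
   one has bidegree (2, 2) in [z, z'] and its nine coefficients are those of the
   trace-free symmetric Ricci tensor.  In the direction from the twistor equation to
   the Einstein-Weyl equations in an arbitrary coframe one needs a null cotetrad near
   every point: it comes from a smooth Cholesky factorization of the metric. *)
Require Import Defs.
From mathcomp Require Import all_boot all_order all_algebra all_fingroup.
From mathcomp Require Import complex ring.
From mathcomp Require Import all_classical all_reals all_analysis.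

Set Implicit Arguments.
Unset Strict Implicit.
Unset Printing Implicit Defensive.

Import Order.TTheory GRing.Theory Num.Theory numFieldNormedType.Exports.
Local Open Scope classical_set_scope.
Local Open Scope ring_scope.

(** * Smooth functions *)

Section RealSmooth.
Variables (R : realType) (n : nat).
Implicit Types (U V : set 'rV[R]_n) (f g : 'rV[R]_n -> R).

(** Anti-self-duality, the Einstein-Weyl equations and the twistor equations all quantify over the
    connection forms that satisfy the structure equations in a given coframe. To pass from one to
    another, a connection has to be exhibited in the new setting, and this is done by explicit
    formulas: [shift_conn] adds to the connection of [A] an algebraic expression in [B - A], which
    links the Levi-Civita and the Weyl connection, and [gauge] carries a connection to another
    coframe. The structure equations involve first derivatives only, but the Bianchi identity and
    the transformation law of the curvature need second partial derivatives to commute. As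
    smoothness means iterated partial derivatives along coordinate vectors, this symmetry is derived
    from the mean value theorem. The metric is complex, so a diagonal entry may vanish and square
    roots exist only locally: the factorization of the metric is local and each of its steps starts
    with a constant change of basis. *)

Lemma open_near_eq (T : Type) U (f g : 'rV[R]_n -> T) x :
  open U -> U x -> (forall y, U y -> f y = g y) ->
  \forall y \near x, f y = g y.
Proof.
move=> oU Ux e; have : nbhs x U by exact: open_nbhs_nbhs.
exact: filterS.
Qed.

Lemma class_C_ext m U f g : open U -> (forall x, U x -> f x = g x) ->
  class_C m U f -> class_C m U g.
Proof.
have ext_cont U' f' g' : open U' -> (forall x, U' x -> f' x = g' x) ->
    (forall x : 'rV[R]_n, U' x -> {for x, continuous (f' : _ -> R)}) ->
    (forall x, U' x -> {for x, continuous g'}).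
  move=> oU e cf x Ux; rewrite /prop_for /continuous_at -(e x Ux).
  have fg : {near x, f' =1 g'} by apply: open_near_eq oU Ux _ => y /e.
  exact: cvg_trans (near_eq_cvg fg) (cf x Ux).
elim: m f g => [|m IH] f g oU e /= [cf df]; split=> //; try exact: ext_cont cf.
move=> i; have [d1 d2] := df i; split=> [x Ux|].
  have fg : {near x, f =1 g} by apply: open_near_eq oU Ux _ => y /e.
  exact: near_eq_derivable fg (d1 _ Ux).
apply: IH d2 => // x Ux; apply: near_eq_derive.
by apply: open_near_eq oU Ux _ => y /e.
Qed.

Lemma class_C_sub m U V f : V `<=` U -> class_C m U f -> class_C m V f.
Proof.
elim: m f => [|m IH] f sVU /= [cf df]; split=> //; try by move=> x /sVU /cf.
by move=> i; have [d1 d2] := df i; split=> [x /sVU /d1 //|]; exact: IH.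
Qed.

Lemma class_CW m U f : class_C m.+1 U f -> class_C m U f.
Proof.
elim: m f => [|m IH] f [cf df]; split=> // i.
by have [d1 d2] := df i; split=> //; apply: IH.
Qed.

Lemma class_C_cst m U (c : R) : class_C m U (fun=> c).
Proof.
have cc (d : R) (x : 'rV[R]_n) : U x -> {for x, continuous (fun=> d)}.
  by move=> _; exact: cst_continuous.
elim: m c => [|m IH] c; split=> //; try exact: cc.
move=> i; split=> [x _|]; first exact: derivable_cst.
have -> : 'D_(evec R i) (fun _ : 'rV[R]_n => c) = fun=> 0.
  by apply/funext => x; exact: derive_cst.
exact: IH.
Qed.

Lemma class_C_add m U f g : open U -> class_C m U f -> class_C m U g ->
  class_C m U (fun x => f x + g x).
Proof.
move=> oU; elim: m f g => [|m IH] f g /= [cf df] [cg dg]; split=> //;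
  try by move=> x Ux; apply: continuousD; [exact: cf|exact: cg].
move=> i; have [f1 f2] := df i; have [g1 g2] := dg i; split=> [x Ux|].
  by apply: derivableD; [exact: f1|exact: g1].
apply: class_C_ext (IH _ _ f2 g2) => // x Ux; rewrite -deriveD //.
- exact: f1.
- exact: g1.
Qed.

Lemma class_C_mul m U f g : open U -> class_C m U f -> class_C m U g ->
  class_C m U (fun x => f x * g x).
Proof.
move=> oU; elim: m f g => [|m IH] f g Hf Hg; have /= [cf df] := Hf;
  have /= [cg dg] := Hg; split=> //;
  try by move=> x Ux; apply: continuousM; [exact: cf|exact: cg].
move=> i; have [f1 f2] := df i; have [g1 g2] := dg i; split=> [x Ux|].
  by apply: derivableM; [exact: f1|exact: g1].
have H1 := IH _ _ (class_CW Hf) g2; have H2 := IH _ _ (class_CW Hg) f2.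
apply: class_C_ext (class_C_add oU H1 H2) => // x Ux.
by rewrite -[RHS]/('D_(evec R i) (f * g) x) deriveM //; [exact: f1|exact: g1].
Qed.

Lemma class_C_opp m U f : open U -> class_C m U f ->
  class_C m U (fun x => - f x).
Proof.
move=> oU Hf; apply: class_C_ext (class_C_mul oU (class_C_cst _ _ (-1)) Hf) => //.
by move=> x _; rewrite mulN1r.
Qed.

(** The induction closes because (1/f)' = - (1/f)^2 f' involves only [f'] and [1/f] itself at the
    lower order. *)
Lemma class_C_inv m U f : open U -> (forall x, U x -> f x != 0) ->
  class_C m U f -> class_C m U (fun x => (f x)^-1).
Proof.
move=> oU f0; elim: m => [|m IH] Hf; have /= [cf df] := Hf; split=> //;
  try by move=> x Ux; apply: continuousV; [exact: f0|exact: cf].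
move=> i; have [f1 f2] := df i; split=> [x Ux|].
  by apply: (derivableV (f0 x Ux)); exact: f1.
have H := IH (class_CW Hf).
have H1 := class_C_opp oU (class_C_mul oU (class_C_mul oU H H) f2).
apply: class_C_ext H1 => // x Ux.
rewrite -[RHS]/('D_(evec R i) (fun x => (f x)^-1) x) deriveV ?f0 //; last exact: f1.
by rewrite -exprVn expr2 scaleNr.
Qed.

(** Restriction to a line turns a directional derivative into a derivative in one real variable,
    where the chain rule for the square root applies. *)
Lemma derive_line (k : 'rV[R]_n -> R) x v :
  'D_v k x = 'D_1 (fun t : R => k (t *: v + x)) 0.
Proof.
rewrite /derive; set F := (X in X @ _); set F' := (X in _ = lim (X @ _)).
suff -> : F = F' by [].
by apply/funext => t; rewrite /F /F' /= scale0r add0r addr0 scaler1.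
Qed.

Lemma derive_sqrt_comp1 (h : R -> R) t : 0 < h t -> derivable h t 1 ->
  derivable (Num.sqrt \o h) t 1 /\
  'D_1 (Num.sqrt \o h) t = (2 * Num.sqrt (h t))^-1 * 'D_1 h t.
Proof.
move=> h0 dh; have ds : derivable (@Num.sqrt R) (h t) 1.
  by have [] := is_derive1_sqrt h0.
split; last by rewrite -derive1E (derive1_comp dh ds) !derive1E derive_sqrt.
have d1 := (derivable1_diffP h t).1 dh.
have d2 := (derivable1_diffP _ _).1 ds.
exact: (derivable1_diffP _ _).2 (differentiable_comp d1 d2).
Qed.

Lemma derive_sqrt_comp f (x v : 'rV[R]_n) : 0 < f x -> derivable f x v ->
  derivable (fun y => Num.sqrt (f y)) x v /\
  'D_v (fun y => Num.sqrt (f y)) x = (2 * Num.sqrt (f x))^-1 * 'D_v f x.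
Proof.
move=> f0 /derivable1P d; rewrite !derive_line.
have h0 : 0 < f (0 *: v + x) by rewrite scale0r add0r.
have [d1 d2] := @derive_sqrt_comp1 (fun t => f (t *: v + x)) 0 h0 d.
by split; [apply/derivable1P; exact: d1 | rewrite d2 scale0r add0r].
Qed.

Lemma class_C_sqrt m U f : open U -> (forall x, U x -> 0 < f x) ->
  class_C m U f -> class_C m U (fun x => Num.sqrt (f x)).
Proof.
move=> oU f0; elim: m => [|m IH] Hf; have /= [cf df] := Hf; split=> //;
  try by move=> x Ux; apply: continuous_comp; [exact: cf|exact: sqrt_continuous].
move=> i; have [f1 f2] := df i; split=> [x Ux|].
  by have [] := derive_sqrt_comp (f0 x Ux) (f1 x Ux).
(* [IH] gives the square root at order [m], which suffices for its derivative f' / (2 sqrt f). *)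
have H2 := class_C_inv oU _ (class_C_mul oU (class_C_cst _ _ 2) (IH (class_CW Hf))).
apply: class_C_ext (class_C_mul oU (H2 _) f2) => // x Ux.
  by have [_ ->] := derive_sqrt_comp (f0 x Ux) (f1 x Ux).
by rewrite mulf_neq0 ?pnatr_eq0 // gt_eqF // sqrtr_gt0 f0.
Qed.

Lemma smooth_derivable U f x i : smooth U f -> U x -> derivable f x (evec R i).
Proof. by move=> /(_ 1%N) [_ /(_ i) [d _]]; exact: d. Qed.

Lemma smooth_continuous U f x : smooth U f -> U x -> {for x, continuous f}.
Proof. by move=> /(_ 0%N) [c _]; exact: c. Qed.

Lemma smooth_derive U f i : smooth U f -> smooth U ('D_(evec R i) f).
Proof. by move=> sf m; have [_ /(_ i) []] := sf m.+1. Qed.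

End RealSmooth.

(** * Symmetry of second derivatives *)

Section Schwarz.
Variables (R : realType) (V : normedModType R).
Implicit Types (f : V -> R) (x u v : V).

Lemma is_derive_line f y u (s : R) : derivable f (s *: u + y) u ->
  is_derive s 1 (fun t : R => f (t *: u + y)) ('D_u f (s *: u + y)).
Proof.
move=> df.
have e : (fun h : R => h^-1 *: ((f \o shift (s *: u + y)) (h *: u) - f (s *: u + y)))
  = (fun h : R => h^-1 *: (((fun t : R => f (t *: u + y)) \o shift s) (h *: 1)
      - f (s *: u + y))).
  by apply/funext => t; rewrite /= scaler1 scalerDl addrA.
by split; [move: df|]; rewrite /derivable /derive e.
Qed.

(** The mean value theorem is applied twice: along [u] to the difference of [f] across the side
    [h *: v], then along [v] to the derivative of [f] in the direction [u]. *)
Lemma second_difference f x u v (h : R) : 0 < h ->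
  (forall a b : R, 0 <= a <= h -> 0 <= b <= h ->
     derivable f (a *: u + (b *: v + x)) u /\
     derivable ('D_u f) (a *: u + (b *: v + x)) v) ->
  exists a b : R, [/\ 0 <= a <= h, 0 <= b <= h &
    f (h *: u + (h *: v + x)) - f (h *: u + x) - f (h *: v + x) + f x =
    'D_v ('D_u f) (a *: u + (b *: v + x)) * h * h].
Proof.
move=> h0 df.
have hh : 0 <= h <= h by rewrite lexx ltW.
have h00 : 0 <= (0 : R) <= h by rewrite lexx ltW.
have du a b : 0 <= a <= h -> 0 <= b <= h -> is_derive a 1
    (fun t : R => f (t *: u + (b *: v + x))) ('D_u f (a *: u + (b *: v + x))).
  by move=> ha hb; have [d _] := df a b ha hb; exact: (is_derive_line d).
have dv a b : 0 <= a <= h -> 0 <= b <= h -> is_derive b 1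
    (fun t : R => 'D_u f (t *: v + (a *: u + x)))
    ('D_v ('D_u f) (b *: v + (a *: u + x))).
  by move=> ha hb; apply: is_derive_line; rewrite addrCA; have [] := df a b ha hb.
(* The term [0 *: v] is kept so that [du] applies to both summands, with [b = h] and [b = 0]. *)
pose phi t := f (t *: u + (h *: v + x)) - f (t *: u + (0 *: v + x)).
have dphi a : 0 <= a <= h -> is_derive a 1 phi
    ('D_u f (a *: u + (h *: v + x)) - 'D_u f (a *: u + (0 *: v + x))).
  by move=> ha; apply: is_deriveB; apply: du.
have sub (a : R) : a \in `]0, h[ -> 0 <= a <= h.
  by rewrite in_itv /= => /andP[/ltW -> /ltW ->].
have cphi : {within `[0, h], continuous phi}.
  apply: derivable_within_continuous => a; rewrite in_itv /= => /dphi [].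
  by [].
have [a ain ea] := MVT h0 (fun a ha => dphi a (sub a ha)) cphi.
have ha := sub a ain.
pose psi t := 'D_u f (t *: v + (a *: u + x)).
have cpsi : {within `[0, h], continuous psi}.
  apply: derivable_within_continuous => b; rewrite in_itv /= => hb.
  by have [] := dv a b ha hb.
have [b bin eb] := MVT h0 (fun b hb => dv a b ha (sub b hb)) cpsi.
exists a, b; split=> //; first exact: sub.
move: ea; rewrite /phi !scale0r !add0r subr0 opprB => ea.
rewrite -[LHS]addrA -[LHS]addrA [- f (h *: u + x) + _]addrCA.
have -> : f (h *: u + (h *: v + x)) + (- f (h *: v + x) +
  (- f (h *: u + x) + f x)) = f (h *: u + (h *: v + x)) - f (h *: u + x) +
   (f x - f (h *: v + x)) by ring.
rewrite ea; congr (_ * _).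
move: eb; rewrite /psi scale0r add0r subr0 => eb.
by rewrite [in RHS]addrCA -eb addrCA.
Qed.

Lemma close_triangle (a b z e : R) :
  `|a - z| < e -> `|b - z| < e -> `|a - b| < e + e.
Proof.
move=> l1 l2; apply: le_lt_trans (ltrD l1 l2).
by rewrite (distrC b); exact: ler_distD.
Qed.

(** The second difference over a parallelogram is symmetric in [u] and [v], so it equals [h * h]
    times each mixed derivative at some point of the parallelogram. By continuity both values are
    close to those at [x], closer than half their distance if they differ. *)
Lemma derive_comm (U : set V) f x u v : open U -> U x ->
  (forall y, U y -> [/\ derivable f y u, derivable f y v,
     derivable ('D_u f) y v & derivable ('D_v f) y u]) ->
  {for x, continuous ('D_v ('D_u f))} -> {for x, continuous ('D_u ('D_v f))} ->
  'D_v ('D_u f) x = 'D_u ('D_v f) x.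
Proof.
move=> oU Ux df c1 c2; apply/eqP/negPn/negP => ne.
pose a : R := 'D_v ('D_u f) x; pose b : R := 'D_u ('D_v f) x.
have ab : a != b by [].
pose e := `|a - b| / 2.
have e0 : 0 < e by rewrite divr_gt0 ?normr_gt0 ?subr_eq0 ?ab.
have n1 : \forall y \near x, `|a - 'D_v ('D_u f) y| < e.
  by move/cvgrPdist_lt: c1; apply.
have n2 : \forall y \near x, `|b - 'D_u ('D_v f) y| < e.
  by move/cvgrPdist_lt: c2; apply.
have n3 : \forall y \near x, U y by exact: open_nbhs_nbhs.
have := (nbhs_normP x _).1 (filterI n1 (filterI n2 n3)).
move=> [r /= r0 Hr].
(* The summand 1 makes [w] positive even when both vectors vanish, and makes h (|u| + |v|) strictly
   less than [r], so that the whole parallelogram lies in the ball. *)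
pose w := `|u| + `|v| + 1.
have w0 : 0 < w by rewrite ltr_wpDl // addr_ge0.
pose h := r / w.
have h0 : 0 < h by rewrite divr_gt0.
have inb (s t : R) : 0 <= s <= h -> 0 <= t <= h -> ball_ Num.norm x r (s *: u + (t *: v + x)).
  move=> /andP[s0 sh] /andP[t0 th] /=.
  rewrite addrA [_ + x]addrC opprD addNKr normrN.
  apply: (le_lt_trans (ler_normD _ _)); rewrite !normrZ !ger0_norm //.
  apply: (@le_lt_trans _ _ (h * (`|u| + `|v|))).
    by rewrite mulrDr lerD // ler_wpM2r.
  by rewrite /h mulrAC ltr_pdivrMr // ltr_pM2l // ltrDl.
have D1 (s t : R) : 0 <= s <= h -> 0 <= t <= h ->
    derivable f (s *: u + (t *: v + x)) u /\
    derivable ('D_u f) (s *: u + (t *: v + x)) v.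
  by move=> hs ht; have [_ [_ /df[]]] := Hr _ (inb s t hs ht).
have D2 (t s : R) : 0 <= t <= h -> 0 <= s <= h ->
    derivable f (t *: v + (s *: u + x)) v /\
    derivable ('D_v f) (t *: v + (s *: u + x)) u.
  have -> : t *: v + (s *: u + x) = s *: u + (t *: v + x) by exact: addrCA.
  by move=> ht hs; have [_ [_ /df[]]] := Hr _ (inb s t hs ht).
have [s [t [hs ht E1]]] := @second_difference f x u v h h0 D1.
have [t' [s' [ht' hs' E2]]] := @second_difference f x v u h h0 D2.
have [l1 _] := Hr _ (inb s t hs ht).
have [_ [l2 _]] := Hr _ (inb s' t' hs' ht').
move: E2; rewrite (addrCA (h *: v)) [_ - f (h *: v + x) - _]addrAC E1.
have hn0 : h != 0 by rewrite gt_eqF.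
move=> /(mulIf hn0) /(mulIf hn0) E; move: l1 l2; rewrite E (addrCA (t' *: v)).
move: ('D_u _ _) => z l1 l2; have := close_triangle l1 l2.
by rewrite /e -splitr ltxx.
Qed.
End Schwarz.

(** * Complex-valued smooth functions and local square roots *)

Section ComplexSmooth.
Variables (R : realType) (n : nat).
Implicit Types (U V : set 'rV[R]_n) (f g : 'rV[R]_n -> R)
  (h k : 'rV[R]_n -> R[i]) (x : 'rV[R]_n).
Local Notation Re := (@complex.Re R).
Local Notation Im := (@complex.Im R).

Lemma ReD (a b : R[i]) : Re (a + b) = Re a + Re b. Proof. by case: a b => ? ? []. Qed.
Lemma ImD (a b : R[i]) : Im (a + b) = Im a + Im b. Proof. by case: a b => ? ? []. Qed.
Lemma ReN (a : R[i]) : Re (- a) = - Re a. Proof. by case: a. Qed.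
Lemma ImN (a : R[i]) : Im (- a) = - Im a. Proof. by case: a. Qed.
Lemma ReM (a b : R[i]) : Re (a * b) = Re a * Re b - Im a * Im b.
Proof. by case: a b => ? ? []. Qed.
Lemma ImM (a b : R[i]) : Im (a * b) = Re a * Im b + Im a * Re b.
Proof. by case: a b => ? ? []. Qed.
Lemma complex_eqP (a b : R[i]) : Re a = Re b -> Im a = Im b -> a = b.
Proof. by case: a b => ? ? [] ? ? /= -> ->. Qed.

Lemma smooth_ext U f g : open U -> (forall x, U x -> f x = g x) ->
  smooth U f -> smooth U g.
Proof. by move=> oU e s m; apply: class_C_ext (s m). Qed.

Lemma smooth_sub U V f : V `<=` U -> smooth U f -> smooth V f.
Proof. by move=> sVU s m; apply: class_C_sub (s m). Qed.

Lemma smooth_cst U (c : R) : smooth U (fun=> c).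
Proof. by move=> m; apply: class_C_cst. Qed.

Lemma smooth_add U f g : open U -> smooth U f -> smooth U g ->
  smooth U (fun x => f x + g x).
Proof. by move=> oU sf sg m; apply: class_C_add. Qed.

Lemma smooth_opp U f : open U -> smooth U f -> smooth U (fun x => - f x).
Proof. by move=> oU sf m; apply: class_C_opp. Qed.

Lemma smooth_mul U f g : open U -> smooth U f -> smooth U g ->
  smooth U (fun x => f x * g x).
Proof. by move=> oU sf sg m; apply: class_C_mul. Qed.

Lemma smooth_inv U f : open U -> (forall x, U x -> f x != 0) ->
  smooth U f -> smooth U (fun x => (f x)^-1).
Proof. by move=> oU f0 sf m; apply: class_C_inv. Qed.

Lemma smooth_sqrt U f : open U -> (forall x, U x -> 0 < f x) ->
  smooth U f -> smooth U (fun x => Num.sqrt (f x)).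
Proof. by move=> oU f0 sf m; apply: class_C_sqrt. Qed.

Lemma csmooth_ext U h k : open U -> (forall x, U x -> h x = k x) ->
  csmooth U h -> csmooth U k.
Proof.
by move=> oU e [s1 s2]; split; [apply: smooth_ext s1|apply: smooth_ext s2] => //
  x Ux; rewrite e.
Qed.

Lemma csmooth_sub U V h : V `<=` U -> csmooth U h -> csmooth V h.
Proof. by move=> sVU [s1 s2]; split; apply: smooth_sub sVU _. Qed.

Lemma csmooth_cst U (c : R[i]) : csmooth U (fun=> c).
Proof. by split; apply: smooth_cst. Qed.

Lemma csmooth_add U h k : open U -> csmooth U h -> csmooth U k ->
  csmooth U (fun x => h x + k x).
Proof.
move=> oU [s1 s2] [t1 t2]; split.
  by apply: smooth_ext (smooth_add oU s1 t1) => // x _; rewrite ReD.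
by apply: smooth_ext (smooth_add oU s2 t2) => // x _; rewrite ImD.
Qed.

Lemma csmooth_opp U h : open U -> csmooth U h -> csmooth U (fun x => - h x).
Proof.
move=> oU [s1 s2]; split.
  by apply: smooth_ext (smooth_opp oU s1) => // x _; rewrite ReN.
by apply: smooth_ext (smooth_opp oU s2) => // x _; rewrite ImN.
Qed.

Lemma csmooth_mul U h k : open U -> csmooth U h -> csmooth U k ->
  csmooth U (fun x => h x * k x).
Proof.
move=> oU [s1 s2] [t1 t2]; split.
  have H := smooth_add oU (smooth_mul oU s1 t1)
    (smooth_opp oU (smooth_mul oU s2 t2)).
  by apply: smooth_ext H => // x _; rewrite ReM.
have H := smooth_add oU (smooth_mul oU s1 t2) (smooth_mul oU s2 t1).
by apply: smooth_ext H => // x _; rewrite ImM.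
Qed.

Lemma csmooth_inv U h : open U -> (forall x, U x -> h x != 0) ->
  csmooth U h -> csmooth U (fun x => (h x)^-1).
Proof.
move=> oU h0 [s1 s2].
pose d x := Re (h x) * Re (h x) + Im (h x) * Im (h x).
have sd : smooth U d := smooth_add oU (smooth_mul oU s1 s1) (smooth_mul oU s2 s2).
have d0 x : U x -> d x != 0.
  move=> Ux; apply: contraNneq (h0 x Ux) => /eqP.
  rewrite /d -!expr2 paddr_eq0 ?sqr_ge0 // !sqrf_eq0 => /andP[/eqP a /eqP b].
  by apply/eqP; apply: complex_eqP; rewrite ?a ?b.
have si := smooth_inv oU d0 sd.
split.
  apply: smooth_ext (smooth_mul oU s1 si) => // x _; rewrite /d.
  by case: (h x) => a b /=; rewrite -!expr2.
apply: smooth_ext (smooth_opp oU (smooth_mul oU s2 si)) => // x _; rewrite /d.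
by case: (h x) => a b /=; rewrite -!expr2 ?mulNr.
Qed.

Lemma csmooth_sum (I : Type) (r : seq I) (P : pred I) U (F : I -> 'rV[R]_n -> R[i]) :
  open U -> (forall i, csmooth U (F i)) ->
  csmooth U (fun x => \sum_(i <- r | P i) F i x).
Proof.
move=> oU sF; elim: r => [|a r IH].
  by apply: csmooth_ext (csmooth_cst U 0) => // x _; rewrite big_nil.
case Pa: (P a); last by apply: csmooth_ext IH => // x _; rewrite big_cons Pa.
apply: csmooth_ext (csmooth_add oU (sF a) IH) => // x _.
by rewrite big_cons Pa.
Qed.

Lemma csmooth_prod (I : Type) (r : seq I) (P : pred I) U (F : I -> 'rV[R]_n -> R[i]) :
  open U -> (forall i, csmooth U (F i)) ->
  csmooth U (fun x => \prod_(i <- r | P i) F i x).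
Proof.
move=> oU sF; elim: r => [|a r IH].
  by apply: csmooth_ext (csmooth_cst U 1) => // x _; rewrite big_nil.
case Pa: (P a); last by apply: csmooth_ext IH => // x _; rewrite big_cons Pa.
apply: csmooth_ext (csmooth_mul oU (sF a) IH) => // x _.
by rewrite big_cons Pa.
Qed.

Definition msmooth p q U (A : 'rV[R]_n -> 'M[R[i]]_(p, q)) :=
  forall i j, csmooth U (fun x => A x i j).

Lemma msmooth_sub p q U V (A : 'rV[R]_n -> 'M[R[i]]_(p, q)) :
  V `<=` U -> msmooth U A -> msmooth V A.
Proof. by move=> sVU s a b; apply: csmooth_sub (s a b). Qed.

Lemma msmooth_cst p q U (A : 'M[R[i]]_(p, q)) : msmooth U (fun=> A).
Proof. by move=> a b; apply: csmooth_cst. Qed.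

Lemma msmooth_mul p q r U (A : 'rV[R]_n -> 'M[R[i]]_(p, q))
    (B : 'rV[R]_n -> 'M[R[i]]_(q, r)) :
  open U -> msmooth U A -> msmooth U B -> msmooth U (fun x => A x *m B x).
Proof.
move=> oU sA sB a b.
have H : csmooth U (fun x => \sum_j A x a j * B x j b).
  by apply: csmooth_sum => // j; apply: csmooth_mul.
by apply: csmooth_ext H => // x _; rewrite mxE.
Qed.

Lemma csmooth_det p U (A : 'rV[R]_n -> 'M[R[i]]_p) :
  open U -> msmooth U A -> csmooth U (fun x => \det (A x)).
Proof.
move=> oU sA; apply: csmooth_sum => // s; apply: csmooth_mul => //.
  exact: csmooth_cst.
by apply: csmooth_prod.
Qed.

Lemma msmooth_invmx p U (A : 'rV[R]_n -> 'M[R[i]]_p) :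
  open U -> (forall x, U x -> A x \in unitmx) -> msmooth U A ->
  msmooth U (fun x => invmx (A x)).
Proof.
move=> oU uA sA a b.
have s1 : csmooth U (fun x => (\det (A x))^-1).
  apply: (csmooth_inv oU _ (csmooth_det oU sA)) => x /uA.
  by rewrite unitmxE unitfE.
have s2 : csmooth U (fun x => cofactor (A x) b a).
  apply: csmooth_mul => //; first exact: csmooth_cst.
  apply: csmooth_det => // c d; apply: csmooth_ext (sA (lift b c) (lift a d)) => //.
  by move=> x _; rewrite !mxE.
apply: csmooth_ext (csmooth_mul oU s1 s2) => // x Ux.
by rewrite /invmx uA // !mxE.
Qed.

Lemma open_preimage U f (A : set R) : open U -> smooth U f -> open A ->
  open [set x | U x /\ A (f x)].
Proof.
move=> oU sf oA; rewrite openE => x [Ux Ax].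
have n1 : \forall y \near x, U y by exact: open_nbhs_nbhs.
have n2 : \forall y \near x, A (f y).
  by apply: (smooth_continuous sf Ux); exact: open_nbhs_nbhs.
exact: filterI n1 n2.
Qed.

Lemma open_neq0 U h : open U -> csmooth U h -> open [set x | U x /\ h x != 0].
Proof.
move=> oU [s1 s2].
have s : smooth U (fun x => Re (h x) * Re (h x) + Im (h x) * Im (h x)).
  by apply: smooth_add => //; apply: smooth_mul.
have := open_preimage oU s (@open_gt R 0); congr (open _).
apply/seteqP; split=> x [Ux H]; split=> //; move: H; rewrite /= -!expr2.
  by apply: contraTneq => ->; rewrite /= !expr0n /= addr0 ltxx.
move=> h0; rewrite lt_def addr_ge0 ?sqr_ge0 // andbT; apply: contraNneq h0.
move/eqP; rewrite paddr_eq0 ?sqr_ge0 // !sqrf_eq0 => /andP[/eqP a /eqP b].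
by apply/eqP; apply: complex_eqP; rewrite ?a ?b.
Qed.

(** This is the half-angle formula: [r] is the modulus of a + ib, and the root has real part [p]
    with p^2 = (r + a) / 2. *)
Lemma complex_sqrtE (a b p r : R) : p != 0 -> p ^+ 2 = (r + a) * 2^-1 ->
  r ^+ 2 = a * a + b * b -> Complex p (b * (2 * p)^-1) ^+ 2 = Complex a b.
Proof.
move=> p0 pp rr; rewrite expr2; apply: complex_eqP; rewrite ?ReM ?ImM /=; last first.
  by field.
have -> : p * p - b * (2 * p)^-1 * (b * (2 * p)^-1) =
  p ^+ 2 - b ^+ 2 / (4 * p ^+ 2) by field.
have -> : b ^+ 2 = (r - a) * (r + a) by rewrite -subr_sqr rr; ring.
have : p ^+ 2 != 0 by rewrite expf_neq0.
by rewrite pp mulf_eq0 => /norP[ra _]; field.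
Qed.

(** Dividing by [h x] moves the value at [x] to 1, hence the values near [x] into the right
    half-plane. There r + a > 0 and the half-angle formula is smooth; the constant [sqrtc (h x)]
    restores the scale. *)
Lemma csmooth_sqrt U h x : open U -> U x -> csmooth U h -> h x != 0 ->
  exists V s, [/\ open V, V x, V `<=` U, csmooth V s
    & forall y, V y -> s y ^+ 2 = h y].
Proof.
move=> oU Ux sh h0.
have sk : csmooth U (fun y => h y * (h x)^-1).
  by apply: csmooth_mul => //; apply: csmooth_cst.
pose a y := Re (h y * (h x)^-1); pose b y := Im (h y * (h x)^-1).
pose V := [set y | U y /\ 0 < a y].
have [sa sb] := sk.
have oV : open V by apply: open_preimage sa (@open_gt R 0).
have sVU : V `<=` U by move=> y [].
have {}sa := smooth_sub sVU sa; have {}sb := smooth_sub sVU sb.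
have Vx : V x by split=> //; rewrite /a divff //= ltr01.
pose r y := Num.sqrt (a y * a y + b y * b y).
have ab0 y : V y -> 0 < a y * a y + b y * b y.
  by move=> [_ ay]; rewrite ltr_pwDl ?mulr_gt0 // -expr2 sqr_ge0.
have sr : smooth V r.
  apply: smooth_sqrt => //.
  by apply: smooth_add => //; apply: smooth_mul.
pose p y := Num.sqrt ((r y + a y) * 2^-1).
have ra0 y : V y -> 0 < (r y + a y) * 2^-1.
  by move=> [_ ay]; rewrite mulr_gt0 ?invr_gt0 // ltr_wpDl // sqrtr_ge0.
have sp : smooth V p.
  apply: smooth_sqrt => //; apply: smooth_mul => //; last exact: smooth_cst.
  exact: smooth_add.
have p0 y : V y -> p y != 0 by move=> /ra0 H; rewrite gt_eqF // sqrtr_gt0.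
pose q y := b y * (2 * p y)^-1.
have sq : smooth V q.
  apply: smooth_mul => //; apply: smooth_inv => //.
    by move=> y /p0 H; rewrite mulf_neq0 ?pnatr_eq0.
  by apply: smooth_mul => //; exact: smooth_cst.
exists V, (fun y => sqrtc (h x) * Complex (p y) (q y)); split=> //.
  by apply: csmooth_mul => //; exact: csmooth_cst.
move=> y Vy; rewrite exprMn sqr_sqrtc.
have -> : Complex (p y) (q y) ^+ 2 = h y * (h x)^-1; last by rewrite mulrC divfK.
have pp : p y ^+ 2 = (r y + a y) * 2^-1 by rewrite sqr_sqrtr // ltW // ra0.
have rr : r y ^+ 2 = a y * a y + b y * b y by rewrite sqr_sqrtr // ltW // ab0.
have -> : h y * (h x)^-1 = Complex (a y) (b y) by apply: complex_eqP.
by apply: (complex_sqrtE (p0 y Vy) pp rr).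
Qed.

End ComplexSmooth.

Section PointwiseDerivative.
Variables (R : realType) (V : normedModType R).
Implicit Types (f g : V -> R) (x v : V).

Lemma derivable_addf f g x v : derivable f x v -> derivable g x v ->
  derivable (fun y => f y + g y) x v.
Proof. exact: derivableD. Qed.

Lemma derive_addf f g x v : derivable f x v -> derivable g x v ->
  'D_v (fun y => f y + g y) x = 'D_v f x + 'D_v g x.
Proof. exact: deriveD. Qed.

Lemma derivable_oppf f x v : derivable f x v -> derivable (fun y => - f y) x v.
Proof. exact: derivableN. Qed.

Lemma derive_oppf f x v : derivable f x v ->
  'D_v (fun y => - f y) x = - 'D_v f x.
Proof. exact: deriveN. Qed.

Lemma derivable_mulf f g x v : derivable f x v -> derivable g x v ->
  derivable (fun y => f y * g y) x v.
Proof. exact: derivableM. Qed.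

Lemma derive_mulf f g x v : derivable f x v -> derivable g x v ->
  'D_v (fun y => f y * g y) x = f x * 'D_v g x + g x * 'D_v f x.
Proof. exact: deriveM. Qed.

End PointwiseDerivative.

Section ComplexDerivative.
Variables (R : realType) (n : nat).
Implicit Types (U V : set 'rV[R]_n) (h k : 'rV[R]_n -> R[i]) (x : 'rV[R]_n)
  (i j : 'I_n).
Local Notation Re := (@complex.Re R).
Local Notation Im := (@complex.Im R).

Definition cderivable i h x :=
  derivable (fun y => Re (h y)) x (evec R i) /\
  derivable (fun y => Im (h y)) x (evec R i).

Lemma csmooth_cderivable U h x i : csmooth U h -> U x -> cderivable i h x.
Proof. by move=> [s1 s2] Ux; split; apply: smooth_derivable Ux. Qed.

Lemma cderivable_cst i (c : R[i]) x : cderivable i (fun=> c) x.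
Proof. by split; apply: derivable_cst. Qed.

Lemma eq_pderive i h k x : h =1 k -> pderive i h x = pderive i k x.
Proof. by move=> /funext ->. Qed.

Lemma pderive_cst i (c : R[i]) x : pderive i (fun=> c) x = 0.
Proof. by rewrite /pderive !derive_cst. Qed.

Lemma pderive_ext U i h k x : open U -> U x -> (forall y, U y -> h y = k y) ->
  pderive i h x = pderive i k x.
Proof.
move=> oU Ux e; rewrite /pderive; congr Complex; apply: near_eq_derive;
  by apply: (open_near_eq oU Ux) => y /e ->.
Qed.

Lemma cderivableD i h k x : cderivable i h x -> cderivable i k x ->
  cderivable i (fun y => h y + k y) x.
Proof.
move=> [a b] [c d]; split.
  by rewrite (funext (fun y => ReD (h y) (k y))); exact: (derivable_addf a c).
by rewrite (funext (fun y => ImD (h y) (k y))); exact: (derivable_addf b d).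
Qed.

Lemma pderiveD i h k x : cderivable i h x -> cderivable i k x ->
  pderive i (fun y => h y + k y) x = pderive i h x + pderive i k x.
Proof.
move=> [a b] [c d]; rewrite /pderive (funext (fun y => ReD (h y) (k y))).
rewrite (funext (fun y => ImD (h y) (k y))).
exact: (f_equal2 (@Complex R) (derive_addf a c) (derive_addf b d)).
Qed.

Lemma cderivableM i h k x : cderivable i h x -> cderivable i k x ->
  cderivable i (fun y => h y * k y) x.
Proof.
move=> [a b] [c d]; split.
  rewrite (funext (fun y => ReM (h y) (k y))).
  exact: (derivable_addf (derivable_mulf a c) (derivable_oppf (derivable_mulf b d))).
rewrite (funext (fun y => ImM (h y) (k y))).
exact: (derivable_addf (derivable_mulf a d) (derivable_mulf b c)).
Qed.

Lemma pderiveM i h k x : cderivable i h x -> cderivable i k x ->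
  pderive i (fun y => h y * k y) x = pderive i h x * k x + h x * pderive i k x.
Proof.
move=> [a b] [c d]; rewrite /pderive (funext (fun y => ReM (h y) (k y))).
rewrite (funext (fun y => ImM (h y) (k y))).
have e1 := derive_addf (derivable_mulf a c) (derivable_oppf (derivable_mulf b d)).
have e2 := derive_addf (derivable_mulf a d) (derivable_mulf b c).
rewrite (derive_oppf (derivable_mulf b d)) (derive_mulf a c) (derive_mulf b d) in e1.
rewrite (derive_mulf a d) (derive_mulf b c) in e2.
apply: (etrans (f_equal2 (@Complex R) e1 e2)).
move: ('D__ _ x) ('D__ _ x) ('D__ _ x) ('D__ _ x) (h x) (k x).
move=> p q r s [t u] [v w]; apply: complex_eqP => /=; ring.
Qed.

Lemma cderivableN i h x : cderivable i h x -> cderivable i (fun y => - h y) x.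
Proof.
move=> d; have -> : (fun y => - h y) = (fun y => (-1) * h y).
  by apply/funext => y; rewrite mulN1r.
exact: (cderivableM (cderivable_cst i (-1) x) d).
Qed.

Lemma pderiveN i h x : cderivable i h x ->
  pderive i (fun y => - h y) x = - pderive i h x.
Proof.
move=> d; have -> : (fun y => - h y) = (fun y => (-1) * h y).
  by apply/funext => y; rewrite mulN1r.
rewrite (pderiveM (cderivable_cst i (-1) x) d) pderive_cst.
by rewrite mul0r add0r mulN1r.
Qed.

Lemma cderivable_sum (I : Type) (r : seq I) i (F : I -> 'rV[R]_n -> R[i]) x :
  (forall a, cderivable i (F a) x) ->
  cderivable i (fun y => \sum_(a <- r) F a y) x.
Proof.
move=> dF; elim: r => [|a r IH].
  have -> : (fun y => \sum_(a <- [::]) F a y) = fun=> 0.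
    by apply/funext => y; rewrite big_nil.
  exact: cderivable_cst.
have -> : (fun y => \sum_(b <- a :: r) F b y) =
    (fun y => F a y + \sum_(b <- r) F b y).
  by apply/funext => y; rewrite big_cons.
exact: cderivableD.
Qed.

Lemma pderive_sum (I : Type) (r : seq I) i (F : I -> 'rV[R]_n -> R[i]) x :
  (forall a, cderivable i (F a) x) ->
  pderive i (fun y => \sum_(a <- r) F a y) x = \sum_(a <- r) pderive i (F a) x.
Proof.
move=> dF; elim: r => [|a r IH].
  have -> : (fun y => \sum_(a <- [::]) F a y) = fun=> 0.
    by apply/funext => y; rewrite big_nil.
  by rewrite pderive_cst big_nil.
have -> : (fun y => \sum_(b <- a :: r) F b y) =
    (fun y => F a y + \sum_(b <- r) F b y).
  by apply/funext => y; rewrite big_cons.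
by rewrite pderiveD ?big_cons ?IH //; exact: cderivable_sum.
Qed.

Lemma csmooth_pderive U h i : csmooth U h -> csmooth U (pderive i h).
Proof. by move=> [s1 s2]; split; apply: smooth_derive. Qed.

Lemma smooth_derive_comm U (f : 'rV[R]_n -> R) x i j : open U -> U x ->
  smooth U f ->
  'D_(evec R i) ('D_(evec R j) f) x = 'D_(evec R j) ('D_(evec R i) f) x.
Proof.
move=> oU Ux sf; have di := smooth_derive i sf; have dj := smooth_derive j sf.
apply: (derive_comm oU Ux).
- by move=> y Uy; split; apply: smooth_derivable Uy.
- exact: (smooth_continuous (smooth_derive i dj) Ux).
- exact: (smooth_continuous (smooth_derive j di) Ux).
Qed.

Lemma pderive_comm U h x i j : open U -> U x -> csmooth U h ->
  pderive i (pderive j h) x = pderive j (pderive i h) x.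
Proof.
move=> oU Ux [s1 s2]; rewrite /pderive /=.
exact: (f_equal2 (@Complex R) (smooth_derive_comm i j oU Ux s1)
  (smooth_derive_comm i j oU Ux s2)).
Qed.

End ComplexDerivative.

Section MatrixDerivative.
Variables (R : realType) (n : nat).
Implicit Types (U V : set 'rV[R]_n) (x : 'rV[R]_n) (a b : 'I_n).

Definition mderive p q a (A : 'rV[R]_n -> 'M[R[i]]_(p, q)) x : 'M[R[i]]_(p, q) :=
  \matrix_(i, j) pderive a (fun y => A y i j) x.

Lemma mderiveE p q a (A : 'rV[R]_n -> 'M[R[i]]_(p, q)) x i j :
  mderive a A x i j = pderive a (fun y => A y i j) x.
Proof. by rewrite mxE. Qed.

Lemma mderive_ext p q U a (A B : 'rV[R]_n -> 'M[R[i]]_(p, q)) x :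
  open U -> U x -> (forall y, U y -> A y = B y) -> mderive a A x = mderive a B x.
Proof.
move=> oU Ux e; apply/matrixP => i j; rewrite !mxE.
by apply: (pderive_ext a oU Ux) => y /e ->.
Qed.

Lemma mderive_cst p q a (A : 'M[R[i]]_(p, q)) x : mderive a (fun=> A) x = 0.
Proof. by apply/matrixP => i j; rewrite !mxE pderive_cst. Qed.

Lemma mderiveD p q U a (A B : 'rV[R]_n -> 'M[R[i]]_(p, q)) x :
  U x -> msmooth U A -> msmooth U B ->
  mderive a (fun y => A y + B y) x = mderive a A x + mderive a B x.
Proof.
move=> Ux sA sB; apply/matrixP => i j; rewrite !mxE.
rewrite -pderiveD; try exact: csmooth_cderivable Ux.
by apply: eq_pderive => y; rewrite mxE.
Qed.

Lemma mderiveM p q r U a (A : 'rV[R]_n -> 'M[R[i]]_(p, q))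
    (B : 'rV[R]_n -> 'M[R[i]]_(q, r)) x :
  U x -> msmooth U A -> msmooth U B ->
  mderive a (fun y => A y *m B y) x = mderive a A x *m B x + A x *m mderive a B x.
Proof.
move=> Ux sA sB; apply/matrixP => i j; rewrite !mxE.
have dA k l : cderivable a (fun y => A y k l) x by exact: csmooth_cderivable Ux.
have dB k l : cderivable a (fun y => B y k l) x by exact: csmooth_cderivable Ux.
transitivity (pderive a (fun y => \sum_k A y i k * B y k j) x).
  by apply: eq_pderive => y; rewrite mxE.
rewrite pderive_sum; last by move=> k; apply: cderivableM.
rewrite -big_split; apply: eq_bigr => k _ /=.
by rewrite pderiveM // !mxE.
Qed.

Lemma mderive_tr p q a (A : 'rV[R]_n -> 'M[R[i]]_(p, q)) x :
  mderive a (fun y => (A y)^T) x = (mderive a A x)^T.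
Proof.
apply/matrixP => i j; rewrite !mxE.
by apply: eq_pderive => y; rewrite mxE.
Qed.

Lemma msmooth_mderive p q U a (A : 'rV[R]_n -> 'M[R[i]]_(p, q)) :
  open U -> msmooth U A -> msmooth U (mderive a A).
Proof.
move=> oU sA i j; apply: csmooth_ext (csmooth_pderive a (sA i j)) => //.
by move=> x _; rewrite mxE.
Qed.

Lemma mderive_comm p q U a b (A : 'rV[R]_n -> 'M[R[i]]_(p, q)) x :
  open U -> U x -> msmooth U A ->
  mderive a (mderive b A) x = mderive b (mderive a A) x.
Proof.
move=> oU Ux sA; apply/matrixP => i j; rewrite ![LHS]mderiveE ![RHS]mderiveE.
rewrite (eq_pderive a x (fun y => mderiveE b A y i j)).
rewrite (eq_pderive b x (fun y => mderiveE a A y i j)).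
exact: (pderive_comm _ _ oU Ux (sA i j)).
Qed.

Lemma msmooth_ext p q U (A B : 'rV[R]_n -> 'M[R[i]]_(p, q)) : open U ->
  (forall x, U x -> A x = B x) -> msmooth U A -> msmooth U B.
Proof.
by move=> oU e sA i j; apply: csmooth_ext (sA i j) => // x Ux; rewrite e.
Qed.

Lemma msmooth_add p q U (A B : 'rV[R]_n -> 'M[R[i]]_(p, q)) : open U ->
  msmooth U A -> msmooth U B -> msmooth U (fun x => A x + B x).
Proof.
move=> oU sA sB i j; apply: csmooth_ext (csmooth_add oU (sA i j) (sB i j)) => //.
by move=> x _; rewrite mxE.
Qed.

Lemma msmooth_opp p q U (A : 'rV[R]_n -> 'M[R[i]]_(p, q)) : open U ->
  msmooth U A -> msmooth U (fun x => - A x).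
Proof.
move=> oU sA i j; apply: csmooth_ext (csmooth_opp oU (sA i j)) => //.
by move=> x _; rewrite mxE.
Qed.

Lemma msmooth_tr p q U (A : 'rV[R]_n -> 'M[R[i]]_(p, q)) : open U ->
  msmooth U A -> msmooth U (fun x => (A x)^T).
Proof.
move=> oU sA i j; apply: csmooth_ext (sA j i) => //.
by move=> x _; rewrite mxE.
Qed.

End MatrixDerivative.

(** * Exterior products as minors *)

Section Wedge.
Variable R : realType.
Local Notation C := R[i].

Lemma fun_ord1 (T : Type) (v : 'I_1 -> T) : v = fun=> v ord0.
Proof. by apply/funext => i; rewrite (ord1 i). Qed.

Lemma dfunE n (f : 'rV[R]_n -> C) x (v : 'I_1 -> 'I_n) :
  dfun f x v = pderive (v ord0) f x.
Proof. by rewrite /dfun /ext_d big_ord1 expr0 mul1r. Qed.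

Lemma ext_d1E n (w : dform R n 1) x (v : 'I_2 -> 'I_n) :
  ext_d w x v = pderive (v ord0) (fun y => w y (fun=> v ord_max)) x
    - pderive (v ord_max) (fun y => w y (fun=> v ord0)) x.
Proof.
rewrite /ext_d big_ord_recr big_ord1 /= expr0 mul1r expr1 mulN1r.
congr (_ - _).
  rewrite (_ : widen_ord _ ord0 = ord0); last exact: val_inj.
  apply: eq_pderive => y; congr (w y); rewrite [LHS]fun_ord1.
  by apply/funext => _; congr v; apply: val_inj.
apply: eq_pderive => y; congr (w y); rewrite [LHS]fun_ord1.
by apply/funext => _; congr v; apply: val_inj.
Qed.

Section PermSum.
Variables (k l : nat).

Definition perm_sum_fun (t : 'S_k) (u : 'S_l) (i : 'I_(k + l)) : 'I_(k + l) :=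
  match fintype.split i with inl j => lshift l (t j) | inr j => rshift k (u j) end.

Lemma perm_sum_inj t u : injective (perm_sum_fun t u).
Proof.
move=> i j; rewrite /perm_sum_fun -(splitK i) -(splitK j) !unsplitK.
case: (fintype.split i) => a; case: (fintype.split j) => b /= /eqP.
- by rewrite eq_lshift => /eqP /perm_inj ->.
- by rewrite eq_lrshift.
- by rewrite eq_rlshift.
- by rewrite eq_rshift => /eqP /perm_inj ->.
Qed.

Definition perm_sum t u : 'S_(k + l) := perm (@perm_sum_inj t u).

Lemma perm_sum_lshift t u i : perm_sum t u (lshift l i) = lshift l (t i).
Proof. by rewrite permE /perm_sum_fun (unsplitK (inl i)). Qed.

Lemma perm_sum_rshift t u i : perm_sum t u (rshift k i) = rshift k (u i).
Proof. by rewrite permE /perm_sum_fun (unsplitK (inr i)). Qed.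

(** The sign of a permutation is the determinant of its matrix, and this matrix is block
    diagonal. *)
Lemma sign_perm_sum t u :
  (-1) ^+ perm_sum t u = (-1) ^+ t * (-1) ^+ u :> C.
Proof.
rewrite -!det_perm.
have -> : perm_mx (perm_sum t u) = block_mx (perm_mx t) 0 0 (perm_mx u) :> 'M[C]_(k + l).
  apply/matrixP => i j; rewrite -(splitK i) -(splitK j).
  case: (fintype.split i) => a; case: (fintype.split j) => b /=;
    rewrite ?(block_mxEul, block_mxEur, block_mxEdl, block_mxEdr) !mxE
      ?perm_sum_lshift ?perm_sum_rshift ?eq_lshift ?eq_rshift ?eq_lrshift
      ?eq_rlshift //.
by rewrite det_ublock.
Qed.

End PermSum.

(* [minor_form A v] is the value of the product of the rows of [A], seen as
   covectors, on the coordinate vectors listed by [v]. *)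
Definition minor_form n k (A : 'M[C]_(k, n)) (v : 'I_k -> 'I_n) : C :=
  \det (\matrix_(i, j) A i (v j)).

(** Expand both minors over permutations [t] and [u]. For fixed [t] and [u], translating [s] by
    [perm_sum t u] turns the sum over [s] into the full Leibniz expansion of the large minor, so
    there are k! l! equal copies: exactly the factor divided out in [wedge]. *)
Lemma minor_form_sum n k l (A : 'M[C]_(k, n)) (B : 'M[C]_(l, n)) v :
  \sum_(s : 'S_(k + l)) (-1) ^+ s * (minor_form A (fun i => v (s (lshift l i))) *
     minor_form B (fun j => v (s (rshift k j)))) =
  (k`! * l`!)%N%:R * minor_form (col_mx A B) v.
Proof.
pose M := col_mx A B.
have E (s : 'S_(k + l)) : (-1) ^+ s * (minor_form A (fun i => v (s (lshift l i))) *
     minor_form B (fun j => v (s (rshift k j)))) =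
  \sum_(t : 'S_k) \sum_(u : 'S_l) (-1) ^+ (perm_sum t u * s)%g *
     \prod_i M i (v ((perm_sum t u * s)%g i)).
  rewrite /minor_form /determinant mulr_suml mulr_sumr; apply: eq_bigr => t _.
  rewrite mulr_sumr mulr_sumr; apply: eq_bigr => u _.
  rewrite odd_permM signr_addb sign_perm_sum big_split_ord /=.
  have -> : \prod_(i < k) M (lshift l i) (v ((perm_sum t u * s)%g (lshift l i))) =
      \prod_(i < k) (\matrix_(i, j) A i (v (s (lshift l j)))) i (t i).
    by apply: eq_bigr => i _; rewrite permM perm_sum_lshift mxE /M col_mxEu.
  have -> : \prod_(i < l) M (rshift k i) (v ((perm_sum t u * s)%g (rshift k i))) =
      \prod_(i < l) (\matrix_(i, j) B i (v (s (rshift k j)))) i (u i).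
    by apply: eq_bigr => i _; rewrite permM perm_sum_rshift mxE /M col_mxEd.
  move: (\prod_(i < k) _) (\prod_(i < l) _) => P Q.
  move: (_ ^+ s) (_ ^+ t) (_ ^+ u) => a b c.
  by ring.
rewrite (eq_bigr _ (fun s _ => E s)) exchange_big /=.
transitivity (\sum_(t : 'S_k) \sum_(u : 'S_l) minor_form M v).
  apply: eq_bigr => t _; rewrite exchange_big; apply: eq_bigr => u _ /=.
  rewrite /minor_form /determinant.
  rewrite [RHS](reindex_inj (mulgI (perm_sum t u))); apply: eq_bigr => s _.
  by congr (_ * _); apply: eq_bigr => i _; rewrite [RHS]mxE.
by rewrite !sumr_const -[in RHS](card_Sn k) -[in RHS](card_Sn l)
  -mulrnA mulr_natl mulnC.
Qed.

(** The left factor is a combination of products of covectors because it starts as [dE]; each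
    further factor then only appends rows to every term. *)
Lemma wedge_minor_form (I : finType) n k l (a : dform R n k) (b : dform R n l) x
    (c : I -> C) (A : I -> 'M[C]_(k, n)) (B : 'M[C]_(l, n)) :
  (forall v, a x v = \sum_i c i * minor_form (A i) v) ->
  (forall v, b x v = minor_form B v) ->
  forall v, wedge a b x v = \sum_i c i * minor_form (col_mx (A i) B) v.
Proof.
move=> aE bE v; rewrite /wedge.
transitivity (((k`! * l`!)%N%:R)^-1 * \sum_i c i *
    \sum_(s : 'S_(k + l)) (-1) ^+ s *
      (minor_form (A i) (fun j => v (s (lshift l j))) *
       minor_form B (fun j => v (s (rshift k j))))).
  congr (_ * _).
  rewrite (eq_bigr _ (fun i _ => mulr_sumr _ _ _ _)) exchange_big /=.
  apply: eq_bigr => s _; rewrite aE bE mulr_suml mulr_sumr.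
  by apply: eq_bigr => i _; rewrite -mulrA mulrCA.
rewrite mulr_sumr; apply: eq_bigr => i _; rewrite minor_form_sum.
have kl0 : ((k`! * l`!)%N%:R : C) != 0.
  by rewrite pnatr_eq0 -lt0n muln_gt0 !fact_gt0.
by rewrite mulrCA; congr (_ * _); rewrite mulrA mulVf // mul1r.
Qed.

Definition covector n (w : dform R n 1) x : 'rV[C]_n := \row_a w x (fun=> a).

Lemma covector_minor_form n (w : dform R n 1) x v :
  w x v = minor_form (covector w x) v.
Proof. by rewrite /minor_form det_mx11 !mxE [in LHS](fun_ord1 v). Qed.

Lemma minor_form2 n (a b : 'rV[C]_n) (v : 'I_2 -> 'I_n) :
  minor_form (col_mx a b) v =
  a 0 (v ord0) * b 0 (v ord_max) - a 0 (v ord_max) * b 0 (v ord0).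
Proof.
rewrite /minor_form (expand_det_row _ ord0) big_ord_recl big_ord1 /cofactor.
rewrite !det_mx11 !mxE /=.
have e0 : @fintype.split 1 1 ord0 = inl ord0.
  by case: splitP => j // _; rewrite (ord1 j).
have e1 : @fintype.split 1 1 (lift ord0 0) = inr ord0.
  by case: splitP => j; rewrite (ord1 j).
rewrite e0 e1 expr0 mul1r expr1 mulN1r mulrN.
rewrite (_ : lift ord0 0 = ord_max); last exact: val_inj.
by rewrite (_ : lift ord_max 0 = ord0) //; apply: val_inj.
Qed.

End Wedge.

(** * Explicit determinants of size four *)

Section Determinant4.
Variable F : comNzRingType.

(** The entries are indexed by [nat], so that the cofactor recursion unfolds by computation;
    [bump j] skips the deleted column. *)
Fixpoint row_expansion n (f : nat -> nat -> F) : F :=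
  if n is n'.+1 then
    \sum_(j < n'.+1) f 0%N j *
      ((-1) ^+ j * row_expansion n' (fun i k => f i.+1 (bump j k)))
  else 1.

Lemma det_row_expansion n (f : nat -> nat -> F) :
  \det (\matrix_(i < n, j < n) f i j) = row_expansion n f.
Proof.
elim: n f => [|n IH] f; first by rewrite det_mx00.
rewrite (expand_det_row _ ord0); apply: eq_bigr => j _; rewrite mxE /cofactor.
rewrite -[X in _ = _ * (_ * X)]/(row_expansion n (fun i k => f i.+1 (bump j k))).
rewrite -IH; congr (_ * (_ * \det _)).
by apply/matrixP => i k; rewrite !mxE.
Qed.

(** Laplace expansion along the first two rows: each 2 by 2 minor is a component of a product of two
    covectors. *)
Lemma det_mx4 (f : nat -> nat -> F) :
  \det (\matrix_(i < 4, j < 4) f i j) =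
    (f 0 0 * f 1 1 - f 0 1 * f 1 0) * (f 2 2 * f 3 3 - f 2 3 * f 3 2)
  - (f 0 0 * f 1 2 - f 0 2 * f 1 0) * (f 2 1 * f 3 3 - f 2 3 * f 3 1)
  + (f 0 0 * f 1 3 - f 0 3 * f 1 0) * (f 2 1 * f 3 2 - f 2 2 * f 3 1)
  + (f 0 1 * f 1 2 - f 0 2 * f 1 1) * (f 2 0 * f 3 3 - f 2 3 * f 3 0)
  - (f 0 1 * f 1 3 - f 0 3 * f 1 1) * (f 2 0 * f 3 2 - f 2 2 * f 3 0)
  + (f 0 2 * f 1 3 - f 0 3 * f 1 2) * (f 2 0 * f 3 1 - f 2 1 * f 3 0).
Proof.
rewrite det_row_expansion /= !big_ord_recl !big_ord0 /= /bump /=.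
ring.
Qed.

End Determinant4.

Definition four_rows (T : Type) n (a b c d : 'rV[T]_n) : 'M[T]_(4, n) :=
  col_mx (col_mx (col_mx a b) c) d.

Lemma mul_four_rows (F : comNzRingType) m n (a b c d : 'rV[F]_m) (X : 'M[F]_(m, n)) :
  four_rows a b c d *m X = four_rows (a *m X) (b *m X) (c *m X) (d *m X).
Proof.
rewrite /four_rows (@mul_col_mx _ (1 + 1 + 1) 1 _ _ (col_mx (col_mx a b) c) d X).
by rewrite !mul_col_mx.
Qed.

Section FourByFour.
Variable F : comNzRingType.

Lemma sum_ord4 (V : nmodType) (f : 'I_4 -> V) :
  \sum_k f k = f o1 + f o2 + f o3 + f o4.
Proof.
rewrite !big_ord_recl big_ord0 addr0 !addrA.
by congr (f _ + f _ + f _ + f _); apply: val_inj.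
Qed.

Lemma four_rowsE (a b c d : 'rV[F]_4) :
  four_rows a b c d = \matrix_(i, j) nth a [:: a; b; c; d] i 0 j.
Proof.
apply/matrixP => i j; rewrite !mxE.
case: splitP => k ek; last by rewrite ek (ord1 k).
rewrite !mxE; case: splitP => k' ek'; last by rewrite ek ek' (ord1 k').
rewrite !mxE; case: splitP => k2 ek2; rewrite (ord1 k2) in ek2 *.
  by rewrite ek ek' ek2.
by rewrite ek ek' ek2.
Qed.

Lemma det_four_rows (a b c d : 'rV[F]_4) :
  \det (four_rows a b c d) =
    (a 0 o1 * b 0 o2 - a 0 o2 * b 0 o1) * (c 0 o3 * d 0 o4 - c 0 o4 * d 0 o3)
  - (a 0 o1 * b 0 o3 - a 0 o3 * b 0 o1) * (c 0 o2 * d 0 o4 - c 0 o4 * d 0 o2)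
  + (a 0 o1 * b 0 o4 - a 0 o4 * b 0 o1) * (c 0 o2 * d 0 o3 - c 0 o3 * d 0 o2)
  + (a 0 o2 * b 0 o3 - a 0 o3 * b 0 o2) * (c 0 o1 * d 0 o4 - c 0 o4 * d 0 o1)
  - (a 0 o2 * b 0 o4 - a 0 o4 * b 0 o2) * (c 0 o1 * d 0 o3 - c 0 o3 * d 0 o1)
  + (a 0 o3 * b 0 o4 - a 0 o4 * b 0 o3) * (c 0 o1 * d 0 o2 - c 0 o2 * d 0 o1).
Proof.
have i1 : inord 0 = o1 by apply: val_inj; rewrite /= inordK.
have i2 : inord 1 = o2 by apply: val_inj; rewrite /= inordK.
have i3 : inord 2 = o3 by apply: val_inj; rewrite /= inordK.
have i4 : inord 3 = o4 by apply: val_inj; rewrite /= inordK.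
rewrite four_rowsE; transitivity (\det (\matrix_(i < 4, j < 4)
    nth a [:: a; b; c; d] i 0 (inord j))).
  by congr (\det _); apply/matrixP => i j; rewrite [LHS]mxE [RHS]mxE inord_val.
by rewrite (det_mx4 (fun i j => nth a [:: a; b; c; d] i 0 (inord j))) /= i1 i2 i3 i4.
Qed.

Definition row4 (a b c d : F) : 'rV[F]_4 := \row_j nth a [:: a; b; c; d] j.

(** The last two rows hold the coefficients of [Lambda] and [F] in (M, P, N, K). Both forms
    annihilate zm - k and zn - p, and the right side is twice the value of [Q] on these two vectors;
    in particular z' cancels. *)
Lemma sum_det_F (Q : 'M[F]_4) (z z' : F) : (forall i j, Q i j = - Q j i) ->
  \sum_k \sum_j Q k j * \det (four_rows (delta_mx 0 k) (delta_mx 0 j)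
    (row4 (- z') (- z) (-1) (- (z * z'))) (row4 1 0 0 z)) =
  2 * (z ^+ 2 * Q o1 o3 - z * Q o1 o2 - z * Q o4 o3 + Q o4 o2).
Proof.
move=> Qa; rewrite !sum_ord4 !det_four_rows !mxE /=.
rewrite (Qa o2 o1) (Qa o3 o1) (Qa o4 o1) (Qa o3 o2) (Qa o4 o2) (Qa o4 o3).
ring.
Qed.

(** Here the rows are [Lambda] and [F'], which annihilate z'p - k and z'n - m; the right side is - 2
    times the value of [Q] on these vectors. *)
Lemma sum_det_F' (Q : 'M[F]_4) (z z' : F) : (forall i j, Q i j = - Q j i) ->
  \sum_k \sum_j Q k j * \det (four_rows (delta_mx 0 k) (delta_mx 0 j)
    (row4 (- z') (- z) (-1) (- (z * z'))) (row4 0 1 0 z')) =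
  - 2 * (z' ^+ 2 * Q o2 o3 - z' * Q o2 o1 - z' * Q o4 o3 + Q o4 o1).
Proof.
move=> Qa; rewrite !sum_ord4 !det_four_rows !mxE /=.
rewrite (Qa o2 o1) (Qa o3 o1) (Qa o4 o1) (Qa o3 o2) (Qa o4 o2) (Qa o4 o3).
ring.
Qed.

End FourByFour.

(** * Vanishing of a product of a 2-form and three 1-forms *)

Section FiveForm.
Variables (R : realType) (n : nat).
Local Notation C := R[i].

(* The product of a 2-form [Q + E /\ be], with [Q] in the span of the rows of
   [X], and of three 1-forms [l X], [f X] and [E].  The term [E /\ be] drops
   out and [E] adjoins one independent covector to the rows of [X]. *)
Lemma five_form_eq0 (w : dform R n 2) (L F E : dform R n 1) u
    (X : 'M[C]_(4, n)) (Q : 'M[C]_4) (be : 'rV[C]_n) (l f : 'rV[C]_4) :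
  Q^T = - Q ->
  (forall v, w u v = (X^T *m Q *m X) (v ord0) (v ord_max) +
     (covector E u 0 (v ord0) * be 0 (v ord_max) -
      covector E u 0 (v ord_max) * be 0 (v ord0))) ->
  covector L u = l *m X -> covector F u = f *m X ->
  (exists v, minor_form (col_mx X (covector E u)) v != 0) ->
  (forall v, (wedge (wedge (wedge w L) F) E) u v = 0) <->
  \sum_k \sum_j Q k j *
    \det (four_rows (delta_mx 0 k) (delta_mx 0 j) l f) = 0.
Proof.
move=> Qa wE LE FE [v0 v0P].
(* One term for each ordered pair of rows of [X], halved because each unordered pair occurs twice,
   and one more term for [E /\ be]. *)
pose c (i : 'I_4 * 'I_4 + 'I_1) : C :=
  match i with inl p => Q p.1 p.2 / 2 | inr _ => 1 end.
pose A (i : 'I_4 * 'I_4 + 'I_1) : 'M[C]_(1 + 1, n) :=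
  match i with inl p => col_mx (row p.1 X) (row p.2 X)
  | inr _ => col_mx (covector E u) be end.
have two0 : (2 : C) != 0 by rewrite pnatr_eq0.
have wA v : w u v = \sum_i c i * minor_form (A i) v.
  rewrite big_sumType /= big_ord1 mul1r minor_form2 wE; congr (_ + _).
  rewrite -(pair_bigA _ (fun k j => Q k j / 2 * minor_form (col_mx (row k X) (row j X)) v)) /=.
  transitivity (\sum_k \sum_j (Q k j / 2 * (X k (v ord0) * X j (v ord_max)) -
      Q k j / 2 * (X k (v ord_max) * X j (v ord0)))); last first.
    apply: eq_bigr => k _; apply: eq_bigr => j _.
    by rewrite minor_form2 !mxE mulrBr.
  rewrite (eq_bigr _ (fun k _ => sumrB _ _ _ _)) sumrB.
  pose S := \sum_k \sum_j Q k j / 2 * (X k (v ord0) * X j (v ord_max)).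
  (* By antisymmetry of [Q] the subtracted half equals - [S]; the two copies of [S] absorb the
     factor 1/2 in [c]. *)
  transitivity (S + S); last first.
    congr (_ + _); rewrite /S exchange_big -sumrN; apply: eq_bigr => k _.
    rewrite -sumrN; apply: eq_bigr => j _; have -> : Q j k = - Q k j.
      by move/matrixP: Qa => /(_ k j); rewrite !mxE.
    by rewrite mulNr mulNr [X j _ * _]mulrC.
  rewrite /S -big_split mxE.
  transitivity (\sum_j \sum_k Q k j * (X k (v ord0) * X j (v ord_max))).
    apply: eq_bigr => j _; rewrite mxE mulr_suml; apply: eq_bigr => k _.
    by rewrite [X^T _ _]mxE (mulrC (X k _)) mulrA.
  rewrite exchange_big; apply: eq_bigr => k _ /=; rewrite -big_split.
  by apply: eq_bigr => j _ /=; rewrite -mulrDl -splitr.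
have cov (w1 : dform R n 1) v : w1 u v = minor_form (covector w1 u) v.
  exact: covector_minor_form.
have H1 := wedge_minor_form wA (cov L).
have H2 := wedge_minor_form H1 (cov F).
have H3 := wedge_minor_form H2 (cov E).
pose D := \sum_k \sum_j Q k j *
  \det (four_rows (delta_mx 0 k) (delta_mx 0 j) l f).
have E5 v : (wedge (wedge (wedge w L) F) E) u v =
    D / 2 * minor_form (col_mx X (covector E u)) v.
  rewrite H3 big_sumType /= big_ord1 mul1r.
  have -> : minor_form (col_mx (col_mx (col_mx (col_mx (covector E u) be)
      (covector L u)) (covector F u)) (covector E u)) v = 0.
    (* [i0] and [i1] index the first and the last row, both equal to the covector of [E]. *)
    set i0 : 'I_(1 + 1 + 1 + 1 + 1) := lshift 1 (lshift 1 (lshift 1 (lshift 1 ord0))).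
    set i1 : 'I_(1 + 1 + 1 + 1 + 1) := rshift 4 ord0.
    apply: (@determinant_alternate _ _ _ i0 i1) => // j.
    rewrite [LHS]mxE [RHS]mxE /i0 !col_mxEu.
    by rewrite (col_mxEd (col_mx (col_mx (col_mx _ be) _) _)).
  rewrite addr0.
  rewrite -(pair_bigA _ (fun k j => Q k j / 2 * minor_form (col_mx (col_mx (col_mx
    (col_mx (row k X) (row j X)) (covector L u)) (covector F u)) (covector E u)) v)) /=.
  rewrite /D !mulr_suml; apply: eq_bigr => k _; rewrite !mulr_suml.
  apply: eq_bigr => j _; rewrite [Q k j * _ / 2]mulrAC -[RHS]mulrA; congr (_ * _).
  set N := four_rows _ _ _ _.
  (* All rows but the last are combinations of the rows of [X]. Factoring the coefficients out
     leaves the fixed minor of [X] and [E], which is nonzero for [v0]. *)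
  have -> : col_mx (col_mx (col_mx (col_mx (row k X) (row j X)) (covector L u))
     (covector F u)) (covector E u) =
     (block_mx N 0 0 1%:M : 'M[C]_(4 + 1)) *m col_mx X (covector E u).
    rewrite mul_block_col !mul0mx addr0 add0r mul1mx /N mul_four_rows.
    by rewrite -LE -FE -!rowE.
  rewrite /minor_form.
  transitivity (\det ((block_mx N 0 0 1%:M : 'M[C]_(4 + 1)) *m
     (\matrix_(i, j) col_mx X (covector E u) i (v j)))).
    congr (\det _); apply/matrixP => a b; rewrite !mxE.
    by apply: eq_bigr => i _; congr (_ * _); rewrite [RHS]mxE.
  by rewrite det_mulmx det_ublock det1 mulr1.
split=> [/(_ v0)|D0 v]; last by rewrite E5 /D D0 !mul0r.
rewrite E5 => /eqP; rewrite !mulf_eq0 invr_eq0 (negbTE two0) (negbTE v0P) !orbF.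
by move/eqP.
Qed.

End FiveForm.

(** * Forms on the twistor bundle *)

Section TwistorSpace.
Variable R : realType.
Local Notation C := R[i].
Implicit Types (u v : 'rV[R]_(4 + 4)) (a b : 'I_4).

Lemma baseD u v : base (u + v) = base u + base v.
Proof. by apply/rowP => i; rewrite !mxE. Qed.

Lemma baseZ (h : R) u : base (h *: u) = h *: base u.
Proof. by apply/rowP => i; rewrite !mxE. Qed.

Lemma base_evec_lshift a : base (evec R (lshift 4 a)) = evec R a.
Proof. by apply/rowP => i; rewrite !mxE eq_lshift. Qed.

Lemma base_evec_rshift a : base (evec R (rshift 4 a)) = 0.
Proof. by apply/rowP => i; rewrite !mxE eq_lrshift. Qed.

(** [base] is linear, so the difference quotients already agree before the limit; derivability and
    derivatives transfer together. *)
Lemma base_quotient (f : 'rV[R]_4 -> R) u v :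
  (fun h : R => h^-1 *: (((f \o @base R) \o shift u) (h *: v) - (f \o @base R) u)) =
  (fun h : R => h^-1 *: ((f \o shift (base u)) (h *: base v) - f (base u))).
Proof. by apply/funext => h /=; rewrite baseD baseZ. Qed.

Lemma derivable_base (f : 'rV[R]_4 -> R) u v :
  derivable f (base u) (base v) -> derivable (f \o @base R) u v.
Proof. by rewrite /derivable base_quotient. Qed.

Lemma derive_base (f : 'rV[R]_4 -> R) u v :
  'D_v (f \o @base R) u = 'D_(base v) f (base u).
Proof. by rewrite /derive base_quotient. Qed.

Lemma cderivable_base U (f : 'rV[R]_4 -> C) u j : csmooth U f -> U (base u) ->
  cderivable j (f \o @base R) u.
Proof.
move=> sf Uu; rewrite -(splitK j); case: (fintype.split j) => a /=.
  have [d1 d2] := csmooth_cderivable a sf Uu; rewrite -base_evec_lshift in d1 d2.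
  split; [exact: (@derivable_base (fun y => complex.Re (f y)) _ _ d1)|].
  exact: (@derivable_base (fun y => complex.Im (f y)) _ _ d2).
have d0 (k : 'rV[R]_4 -> R) : derivable k (base u) (base (evec R (rshift 4 a))).
  by rewrite base_evec_rshift; exact: derivable0.
split; [exact: (@derivable_base (fun y => complex.Re (f y)) _ _ (d0 _))|].
exact: (@derivable_base (fun y => complex.Im (f y)) _ _ (d0 _)).
Qed.

Lemma pderive_base_lshift (f : 'rV[R]_4 -> C) u a :
  pderive (lshift 4 a) (f \o @base R) u = pderive a f (base u).
Proof.
have H (k : 'rV[R]_4 -> R) : 'D_(evec R (lshift 4 a)) (k \o @base R) u =
    'D_(evec R a) k (base u) by rewrite derive_base base_evec_lshift.
exact: (f_equal2 (@Complex R) (H (fun y => complex.Re (f y)))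
  (H (fun y => complex.Im (f y)))).
Qed.

Lemma pderive_base_rshift (f : 'rV[R]_4 -> C) u a :
  pderive (rshift 4 a) (f \o @base R) u = 0.
Proof.
have H (k : 'rV[R]_4 -> R) : 'D_(evec R (rshift 4 a)) (k \o @base R) u = 0.
  by rewrite derive_base base_evec_rshift derive0.
exact: (f_equal2 (@Complex R) (H (fun y => complex.Re (f y)))
  (H (fun y => complex.Im (f y)))).
Qed.

Lemma is_derive_entry n (u v : 'rV[R]_n) j :
  is_derive u v (fun w : 'rV[R]_n => w 0 j) (v 0 j).
Proof.
have q : (fun h : R => h^-1 *: (((fun w : 'rV[R]_n => w 0 j) \o shift u) (h *: v)
   - u 0 j)) @ 0^' --> v 0 j.
  apply: cvg_near_cst; near=> h.
  rewrite /= !mxE addrK /GRing.scale /= mulrA mulVf ?mul1r //.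
  by near: h; exact: nbhs_dnbhs_neq.
split; first by apply/cvg_ex; exists (v 0 j).
by apply/cvg_lim => //; exact: Rhausdorff.
Unshelve. all: by end_near. Qed.

(** The fibre components of dz = d(Re z) + i d(Im z), in the order Re z, Im z, Re z', Im z'. *)
Definition dz : 'rV[C]_4 := row4 1 'i 0 0.

Lemma zcoordE u : zcoord u = Complex (u 0 (rshift 4 o1)) (u 0 (rshift 4 o2)).
Proof. by rewrite /zcoord !mxE. Qed.

Lemma cderivable_zcoord u j : cderivable j (@zcoord R) u.
Proof.
split.
  have -> : (fun y => complex.Re (@zcoord R y)) = (fun y => y 0 (rshift 4 o1)).
    by apply/funext => y; rewrite zcoordE.
  by have [] := is_derive_entry u (evec R j) (rshift 4 o1).
have -> : (fun y => complex.Im (@zcoord R y)) = (fun y => y 0 (rshift 4 o2)).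
  by apply/funext => y; rewrite zcoordE.
by have [] := is_derive_entry u (evec R j) (rshift 4 o2).
Qed.

Lemma pderive_zcoord u j : pderive j (@zcoord R) u =
  Complex (j == rshift 4 o1)%:R (j == rshift 4 o2)%:R.
Proof.
rewrite /pderive.
have -> : (fun y => complex.Re (@zcoord R y)) = (fun y => y 0 (rshift 4 o1)).
  by apply/funext => y; rewrite zcoordE.
have -> : (fun y => complex.Im (@zcoord R y)) = (fun y => y 0 (rshift 4 o2)).
  by apply/funext => y; rewrite zcoordE.
have e k : 'D_(evec R j) (fun y : 'rV[R]_(4 + 4) => y 0 k) u = (j == k)%:R.
  have [_ ->] := is_derive_entry u (evec R j) k.
  by rewrite mxE eqxx eq_sym.
exact: (f_equal2 (@Complex R) (e _) (e _)).
Qed.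

Lemma pderive_zcoord_lshift u a : pderive (lshift 4 a) (@zcoord R) u = 0.
Proof. by rewrite pderive_zcoord !eq_lrshift. Qed.

Lemma pderive_zcoord_rshift u a : pderive (rshift 4 a) (@zcoord R) u = dz 0 a.
Proof.
rewrite pderive_zcoord !eq_rshift mxE.
by case: a => [[|[|[|[|]]]] ?].
Qed.

Lemma jacobian_base u i j : ('J (@base R) u) i j = base (evec R i) 0 j.
Proof.
rewrite /jacobian mxE.
have -> : @base R = (lsubmx : 'M[R]_(1, 4 + 4) -> 'M[R]_(1, 4)) by [].
rewrite diff_lin //; exact: continuous_lsubmx.
Qed.

Lemma lift_formE (w : dform R 4 1) u (v : 'I_1 -> 'I_(4 + 4)) : lift_form w u v =
  match fintype.split (v ord0) with inl a => w (base u) (fun=> a) | inr _ => 0 end.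
Proof.
rewrite /lift_form /pullback.
have e (s : {ffun 'I_1 -> 'I_4}) :
    \prod_(i < 1) cjacobian (@base R) u (v i) (s i) =
    (base (evec R (v ord0)) 0 (s ord0))%:C%C.
  by rewrite big_ord1 mxE jacobian_base.
rewrite (eq_bigr _ (fun s _ => f_equal2 *%R (e s) erefl)).
rewrite -[in LHS](splitK (v ord0)); case: (fintype.split (v ord0)) => a /=.
  rewrite (bigD1 [ffun=> a]) //= base_evec_lshift !ffunE mxE !eqxx mul1r big1.
    by rewrite addr0; congr w; apply/funext => i; rewrite ffunE.
  move=> s sa; rewrite mxE eqxx /=.
  have -> : (s ord0 == a) = false; last by rewrite mul0r.
  apply: contraNF sa => /eqP <-; apply/eqP/ffunP => i.
  by rewrite ffunE (ord1 i).
by rewrite big1 // => s _; rewrite base_evec_rshift mxE mul0r.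
Qed.

Lemma lift_form_lshift (w : dform R 4 1) u a :
  lift_form w u (fun=> lshift 4 a) = w (base u) (fun=> a).
Proof. by rewrite lift_formE (unsplitK (inl a)). Qed.

Lemma lift_form_rshift (w : dform R 4 1) u a :
  lift_form w u (fun=> rshift 4 a) = 0.
Proof. by rewrite lift_formE (unsplitK (inr a)). Qed.

End TwistorSpace.

Section TwistorEquation.
Variable R : realType.
Local Notation C := R[i].
Implicit Types (u : 'rV[R]_(4 + 4)) (x : 'rV[R]_4) (a b : 'I_4) (z : C)
  (theta : 'I_4 -> dform R 4 1) (Gamma : 'I_4 -> 'I_4 -> dform R 4 1).

(* The part of [Eform] without [dz], as a quadratic polynomial in a parameter
   [z] whose coefficients are 1-forms on the base, and its derivative in [z]. *)
Definition spin_form Gamma z a x : C :=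
  - Gamma o3 o2 x (fun=> a) + z * (Gamma o1 o1 x (fun=> a) - Gamma o4 o4 x (fun=> a))
  + z ^+ 2 * Gamma o2 o3 x (fun=> a).

Definition spin_form' Gamma z a x : C :=
  (Gamma o1 o1 x (fun=> a) - Gamma o4 o4 x (fun=> a)) + 2 * z * Gamma o2 o3 x (fun=> a).

(* [dE] modulo [E]. *)
Definition spin_curvature Gamma z x : 'M[C]_4 := \matrix_(a, b)
  (pderive a (spin_form Gamma z b) x - pderive b (spin_form Gamma z a) x
   - (spin_form Gamma z a x * spin_form' Gamma z b x
      - spin_form Gamma z b x * spin_form' Gamma z a x)).

(** This serves two cases: for a constant [z] the last term disappears and only the base is
    differentiated; for the fibre coordinate the last term is [dz] times the derivative of the
    quadratic in [z]. *)
Lemma pderive_quadratic n (j : 'I_n) (z f0 f1 f2 : 'rV[R]_n -> C)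
    (u : 'rV[R]_n) :
  cderivable j z u -> cderivable j f0 u -> cderivable j f1 u -> cderivable j f2 u ->
  pderive j (fun y => f0 y + z y * f1 y + z y ^+ 2 * f2 y) u =
  pderive j f0 u + z u * pderive j f1 u + z u ^+ 2 * pderive j f2 u
  + pderive j z u * (f1 u + 2 * z u * f2 u).
Proof.
move=> dz d0 d1 d2; have dzz := cderivableM dz dz.
have d3 := cderivableM dz d1; have d4 := cderivableM dzz d2.
rewrite (_ : (fun y => _) = fun y => (f0 y + z y * f1 y) + (z y * z y) * f2 y).
  rewrite (pderiveD (cderivableD d0 d3) d4) (pderiveD d0 d3) (pderiveM dz d1).
  rewrite (pderiveM dzz d2) (pderiveM dz dz).
  move: (pderive j z u) (pderive j f0 u) (pderive j f1 u) (pderive j f2 u) => p q r s.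
  by move: (z u) (f1 u) (f2 u) => z0 g1 g2; ring.
by apply/funext => y; rewrite expr2.
Qed.

Section Local.
Variables (U : set 'rV[R]_4) (theta : 'I_4 -> dform R 4 1)
  (Gamma : 'I_4 -> 'I_4 -> dform R 4 1).
Hypotheses (oU : open U) (cth : coframe U theta)
  (sG : forall i j, smooth_form U (Gamma i j)).

Let p0 a x : C := - Gamma o3 o2 x (fun=> a).
Let p1 a x : C := Gamma o1 o1 x (fun=> a) - Gamma o4 o4 x (fun=> a).
Let p2 a x : C := Gamma o2 o3 x (fun=> a).

Let sp0 a : csmooth U (p0 a).
Proof. by apply: csmooth_opp => //; exact: sG. Qed.

Let sp1 a : csmooth U (p1 a).
Proof.
by apply: csmooth_add => //; [exact: sG|apply: csmooth_opp => //; exact: sG].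
Qed.

Let sp2 a : csmooth U (p2 a). Proof. exact: sG. Qed.

Lemma pderive_spin_form z a b x : U x -> pderive a (spin_form Gamma z b) x =
  pderive a (p0 b) x + z * pderive a (p1 b) x + z ^+ 2 * pderive a (p2 b) x.
Proof.
move=> Ux; have := @pderive_quadratic _ a (fun=> z) (p0 b) (p1 b) (p2 b) x
  (cderivable_cst _ _ _) (csmooth_cderivable a (sp0 b) Ux)
  (csmooth_cderivable a (sp1 b) Ux) (csmooth_cderivable a (sp2 b) Ux).
by rewrite pderive_cst mul0r addr0.
Qed.

Lemma Eform_lshift u a : Eform Gamma u (fun=> lshift 4 a) =
  spin_form Gamma (zcoord u) a (base u).
Proof.
transitivity (dfun (@zcoord R) u (fun=> lshift 4 a)
  - lift_form (Gamma o3 o2) u (fun=> lshift 4 a)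
  + zcoord u * (lift_form (Gamma o1 o1) u (fun=> lshift 4 a)
                - lift_form (Gamma o4 o4) u (fun=> lshift 4 a))
  + zcoord u ^+ 2 * lift_form (Gamma o2 o3) u (fun=> lshift 4 a)) => //.
by rewrite !lift_form_lshift dfunE pderive_zcoord_lshift add0r.
Qed.

Lemma Eform_rshift u a : Eform Gamma u (fun=> rshift 4 a) = dz R 0 a.
Proof.
transitivity (dfun (@zcoord R) u (fun=> rshift 4 a)
  - lift_form (Gamma o3 o2) u (fun=> rshift 4 a)
  + zcoord u * (lift_form (Gamma o1 o1) u (fun=> rshift 4 a)
                - lift_form (Gamma o4 o4) u (fun=> rshift 4 a))
  + zcoord u ^+ 2 * lift_form (Gamma o2 o3) u (fun=> rshift 4 a)) => //.
by rewrite !lift_form_rshift dfunE pderive_zcoord_rshift !(subr0, mulr0, addr0).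
Qed.

Lemma cov_Eform u : covector (Eform Gamma) u =
  row_mx (\row_a spin_form Gamma (zcoord u) a (base u)) (dz R).
Proof.
apply/rowP => j; rewrite -(splitK j); case: (fintype.split j) => a /=.
  by rewrite mxE Eform_lshift row_mxEl mxE.
by rewrite mxE Eform_rshift row_mxEr.
Qed.

Let pderive_Eform u j b : U (base u) ->
  pderive j (fun y => Eform Gamma y (fun=> lshift 4 b)) u =
  pderive j (p0 b \o @base R) u + zcoord u * pderive j (p1 b \o @base R) u
  + zcoord u ^+ 2 * pderive j (p2 b \o @base R) u
  + pderive j (@zcoord R) u * spin_form' Gamma (zcoord u) b (base u).
Proof.
move=> Uu; rewrite (eq_pderive _ _ (fun y => Eform_lshift y b)).
exact: (@pderive_quadratic _ j (@zcoord R) (p0 b \o @base R)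
  (p1 b \o @base R) (p2 b \o @base R) u
  (cderivable_zcoord _ _) (cderivable_base _ (sp0 b) Uu)
  (cderivable_base _ (sp1 b) Uu) (cderivable_base _ (sp2 b) Uu)).
Qed.

Lemma pderive_Eform_ll u a b : U (base u) ->
  pderive (lshift 4 a) (fun y => Eform Gamma y (fun=> lshift 4 b)) u =
  pderive a (spin_form Gamma (zcoord u) b) (base u).
Proof.
move=> Uu; rewrite pderive_Eform // !pderive_base_lshift pderive_zcoord_lshift.
by rewrite mul0r addr0 pderive_spin_form.
Qed.

Lemma pderive_Eform_rl u c b : U (base u) ->
  pderive (rshift 4 c) (fun y => Eform Gamma y (fun=> lshift 4 b)) u =
  dz R 0 c * spin_form' Gamma (zcoord u) b (base u).
Proof.
move=> Uu; rewrite pderive_Eform // !pderive_base_rshift pderive_zcoord_rshift.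
by rewrite !mulr0 !add0r.
Qed.

Lemma pderive_Eform_rshift u j a :
  pderive j (fun y => Eform Gamma y (fun=> rshift 4 a)) u = 0.
Proof. by rewrite (eq_pderive _ _ (fun y => Eform_rshift y a)) pderive_cst. Qed.

(** Write E = dz + eps and let eps' be the derivative of eps in [z]. Then dE = d_x eps + dz /\ eps',
    where d_x differentiates along the base, and dz = E - eps turns this into (d_x eps - eps /\
    eps') + E /\ eps'. *)
Lemma ext_d_Eform u (v : 'I_2 -> 'I_(4 + 4)) : U (base u) ->
  let e := covector (Eform Gamma) u in
  let e' := row_mx (\row_b spin_form' Gamma (zcoord u) b (base u)) 0 : 'rV[C]_(4 + 4) in
  ext_d (Eform Gamma) u v =
  (block_mx (spin_curvature Gamma (zcoord u) (base u)) 0 0 0 : 'M[C]_(4 + 4))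
    (v ord0) (v ord_max)
  + (e 0 (v ord0) * e' 0 (v ord_max) - e 0 (v ord_max) * e' 0 (v ord0)).
Proof.
move=> Uu e e'; have rE (f : 'I_4 -> C) c : (\row_a f a) 0 c = f c by rewrite mxE.
have zE p q c d : (0 : 'M[C]_(p, q)) c d = 0 by rewrite mxE.
rewrite ext_d1E /e /e' cov_Eform.
rewrite -(splitK (v ord0)) -(splitK (v ord_max)).
case: (fintype.split (v ord0)) => a; case: (fintype.split (v ord_max)) => b;
  rewrite /unsplit.
- rewrite !(pderive_Eform_ll _ _ Uu) block_mxEul !row_mxEl.
  by rewrite [spin_curvature _ _ _ _ _]mxE !rE subrK.
- rewrite (pderive_Eform_rl _ _ Uu) pderive_Eform_rshift block_mxEur.
  rewrite !row_mxEl !row_mxEr !rE !zE.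
  by rewrite mulr0 !add0r.
- rewrite (pderive_Eform_rl _ _ Uu) pderive_Eform_rshift block_mxEdl.
  rewrite !row_mxEl !row_mxEr !rE !zE.
  by rewrite mulr0 !subr0 add0r.
- rewrite !pderive_Eform_rshift block_mxEdr !row_mxEr.
  by rewrite !zE !mulr0 !subr0 addr0.
Qed.

Let X u : 'M[C]_(4, 4 + 4) := row_mx (coframe_mx theta (base u)) 0.

Lemma cov_Lambdaform u : covector (Lambdaform theta) u =
  row4 (- zcoord' u) (- zcoord u) (-1) (- (zcoord u * zcoord' u)) *m X u.
Proof.
rewrite mul_mx_row mulmx0; apply/rowP => j.
rewrite -(splitK j); case: (fintype.split j) => a /=; rewrite mxE.
  transitivity (- lift_form (theta o3) u (fun=> lshift 4 a)
    - (zcoord u * zcoord' u) * lift_form (theta o4) u (fun=> lshift 4 a)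
    - zcoord u * lift_form (theta o2) u (fun=> lshift 4 a)
    - zcoord' u * lift_form (theta o1) u (fun=> lshift 4 a)) => //.
  rewrite !lift_form_lshift row_mxEl mxE sum_ord4 !mxE /=.
  move: (theta o1 _ _) (theta o2 _ _) (theta o3 _ _) (theta o4 _ _) => t1 t2 t3 t4.
  by move: (zcoord u) (zcoord' u) => z z'; ring.
transitivity (- lift_form (theta o3) u (fun=> rshift 4 a)
    - (zcoord u * zcoord' u) * lift_form (theta o4) u (fun=> rshift 4 a)
    - zcoord u * lift_form (theta o2) u (fun=> rshift 4 a)
    - zcoord' u * lift_form (theta o1) u (fun=> rshift 4 a)) => //.
by rewrite !lift_form_rshift row_mxEr mxE !mulr0 oppr0 !addr0.
Qed.

Lemma cov_Fform u : covector (Fform theta) u = row4 1 0 0 (zcoord u) *m X u.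
Proof.
rewrite mul_mx_row mulmx0; apply/rowP => j.
rewrite -(splitK j); case: (fintype.split j) => a /=; rewrite mxE.
  transitivity (lift_form (theta o1) u (fun=> lshift 4 a)
    + zcoord u * lift_form (theta o4) u (fun=> lshift 4 a)) => //.
  rewrite !lift_form_lshift row_mxEl mxE sum_ord4 !mxE /=.
  by rewrite mul1r !mul0r !addr0.
transitivity (lift_form (theta o1) u (fun=> rshift 4 a)
    + zcoord u * lift_form (theta o4) u (fun=> rshift 4 a)) => //.
by rewrite !lift_form_rshift row_mxEr mxE !mulr0 !addr0.
Qed.

Lemma cov_Fform' u : covector (Fform' theta) u = row4 0 1 0 (zcoord' u) *m X u.
Proof.
rewrite mul_mx_row mulmx0; apply/rowP => j.
rewrite -(splitK j); case: (fintype.split j) => a /=; rewrite mxE.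
  transitivity (lift_form (theta o2) u (fun=> lshift 4 a)
    + zcoord' u * lift_form (theta o4) u (fun=> lshift 4 a)) => //.
  rewrite !lift_form_lshift row_mxEl mxE sum_ord4 !mxE /=.
  by rewrite mul1r !mul0r !addr0 add0r.
transitivity (lift_form (theta o2) u (fun=> rshift 4 a)
    + zcoord' u * lift_form (theta o4) u (fun=> rshift 4 a)) => //.
by rewrite !lift_form_rshift row_mxEr mxE !mulr0 !addr0.
Qed.

(** Evaluate on the four base coordinate vectors and on the vector of Re z: [dz] is 1 on the latter
    and the coframe does not see it, so the matrix is block triangular with the determinant of the
    coframe. *)
Lemma E_independent u : U (base u) ->
  exists v, minor_form (col_mx (X u) (covector (Eform Gamma) u)) v != 0.
Proof.
move=> Uu.
exists (fun j : 'I_(4 + 1) =>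
  match fintype.split j with inl a => lshift 4 a | inr _ => rshift 4 o1 end).
rewrite /minor_form.
set e := \row_a spin_form Gamma (zcoord u) a (base u).
have -> : \matrix_(i, j) col_mx (X u) (covector (Eform Gamma) u) i
   (match @fintype.split 4 1 j with inl a => lshift 4 a | inr _ => rshift 4 o1 end) =
   block_mx (coframe_mx theta (base u)) 0 e 1%:M.
  apply/matrixP => i j; rewrite mxE -(splitK i) -(splitK j) unsplitK cov_Eform.
  case: (fintype.split i) => a; case: (fintype.split j) => b;
    rewrite /unsplit ?(block_mxEul, block_mxEur, block_mxEdl, block_mxEdr)
      ?col_mxEu ?col_mxEd ?row_mxEl ?row_mxEr //.
  - by rewrite [in RHS]mxE [LHS]mxE.
  - by rewrite (ord1 a) (ord1 b) !mxE.
rewrite det_lblock det1 mulr1 -unitfE -unitmxE.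
by have [_] := cth; exact.
Qed.

Lemma spin_curvature_anti z x i j :
  spin_curvature Gamma z x i j = - spin_curvature Gamma z x j i.
Proof. rewrite ![spin_curvature _ _ _ _ _]mxE.
by move: (pderive i _ x) (pderive j _ x) (_ * _) (_ * _) => A B P S; ring. Qed.

Definition frame_spin_curvature z x : 'M[C]_4 :=
  (dual_frame theta x)^T *m spin_curvature Gamma z x *m dual_frame theta x.

Lemma frame_spin_curvature_tr z x :
  (frame_spin_curvature z x)^T = - frame_spin_curvature z x.
Proof.
rewrite /frame_spin_curvature !trmx_mul trmxK.
have -> : (spin_curvature Gamma z x)^T = - spin_curvature Gamma z x.
  by apply/matrixP => i j; rewrite mxE spin_curvature_anti [RHS]mxE.
by rewrite mulNmx mulmxN !mulmxA.
Qed.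

Lemma twistor_equation u (f : 'rV[C]_4) (F : dform R (4 + 4) 1) : U (base u) ->
  covector F u = f *m X u ->
  let Q := frame_spin_curvature (zcoord u) (base u) in
  (forall v, (ext_d (Eform Gamma) \wedge Lambdaform theta \wedge F
     \wedge Eform Gamma)%DF u v = 0) <->
  \sum_k \sum_j Q k j * \det (four_rows (delta_mx 0 k) (delta_mx 0 j)
   (row4 (- zcoord' u) (- zcoord u) (-1) (- (zcoord u * zcoord' u))) f) = 0.
Proof.
move=> Uu FE Q.
have uT : coframe_mx theta (base u) \in unitmx by have [_] := cth; exact.
apply: (five_form_eq0 (frame_spin_curvature_tr _ _) _ (cov_Lambdaform u) FE
  (E_independent Uu)) => v.
rewrite (ext_d_Eform v Uu); congr (_ + _).
rewrite /X tr_row_mx trmx0 mul_col_mx mul0mx mul_col_row !mul0mx !mulmx0.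
rewrite /frame_spin_curvature /dual_frame !mulmxA -trmx_mul mulVmx // trmx1 mul1mx.
by rewrite mulmxKV.
Qed.

Lemma twistor_equation_F u : U (base u) ->
  let z := zcoord u in let Q := frame_spin_curvature z (base u) in
  (forall v, (ext_d (Eform Gamma) \wedge Lambdaform theta \wedge Fform theta
     \wedge Eform Gamma)%DF u v = 0) <->
  z ^+ 2 * Q o1 o3 - z * Q o1 o2 - z * Q o4 o3 + Q o4 o2 = 0.
Proof.
move=> Uu z Q; apply: (iff_trans (twistor_equation Uu (cov_Fform u))).
rewrite sum_det_F; last first.
  move=> i j; have /matrixP/(_ j i) := frame_spin_curvature_tr z (base u).
  by rewrite mxE [in RHS]mxE.
split=> [/eqP|-> //]; rewrite ?mulr0 // mulf_eq0 pnatr_eq0 /= => /eqP //.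
Qed.

Lemma twistor_equation_F' u : U (base u) ->
  let z' := zcoord' u in let Q := frame_spin_curvature (zcoord u) (base u) in
  (forall v, (ext_d (Eform Gamma) \wedge Lambdaform theta \wedge Fform' theta
     \wedge Eform Gamma)%DF u v = 0) <->
  z' ^+ 2 * Q o2 o3 - z' * Q o2 o1 - z' * Q o4 o3 + Q o4 o1 = 0.
Proof.
move=> Uu z' Q; apply: (iff_trans (twistor_equation Uu (cov_Fform' u))).
rewrite sum_det_F'; last first.
  move=> i j; have /matrixP/(_ j i) := frame_spin_curvature_tr (zcoord u) (base u).
  by rewrite mxE [in RHS]mxE.
split=> [/eqP|-> //]; rewrite ?mulr0 // mulf_eq0 oppr_eq0 pnatr_eq0 /= => /eqP //.
Qed.

End Local.
End TwistorEquation.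

(** * Connection and curvature matrices *)

Section MatrixEntries.
Variables (F : comNzRingType) (m n p : nat).

Lemma mxD_entry (A B : 'M[F]_(m, n)) i j : (A + B) i j = A i j + B i j.
Proof. by rewrite mxE. Qed.

Lemma mxN_entry (A : 'M[F]_(m, n)) i j : (- A) i j = - A i j.
Proof. by rewrite mxE. Qed.

Lemma mxM_entry (A : 'M[F]_(m, n)) (B : 'M[F]_(n, p)) i j :
  (A *m B) i j = \sum_k A i k * B k j.
Proof. by rewrite mxE. Qed.

Lemma tr_entry (A : 'M[F]_(m, n)) i j : A^T i j = A j i.
Proof. by rewrite mxE. Qed.

Lemma col_entry (A : 'M[F]_(m, n)) i j k : col j A i k = A i j.
Proof. by rewrite mxE. Qed.

End MatrixEntries.

Section MatrixConnection.
Variable R : realType.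
Local Notation C := R[i].
Implicit Types (U : set 'rV[R]_4) (g : 'rV[R]_4 -> 'M[C]_4) (A : dform R 4 1)
  (theta : 'I_4 -> dform R 4 1) (Gamma : 'I_4 -> 'I_4 -> dform R 4 1)
  (x : 'rV[R]_4) (a b c : 'I_4).

Lemma dform_sumE n k (I : finType) (F : I -> dform R n k)
    (x : 'rV[R]_n) v :
  (\sum_i F i) x v = \sum_i F i x v.
Proof. exact: (big_morph (fun w : dform R n k => w x v)). Qed.

Lemma wedge11E n (al be : dform R n 1) (x : 'rV[R]_n) (v : 'I_2 -> 'I_n) :
  wedge al be x v = al x (fun=> v ord0) * be x (fun=> v ord_max) -
                    al x (fun=> v ord_max) * be x (fun=> v ord0).
Proof.
have aE w : al x w = \sum_(i < 1) 1 * minor_form (covector al x) w.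
  by rewrite big_ord1 mul1r -covector_minor_form.
rewrite (wedge_minor_form aE (covector_minor_form be x)) big_ord1 mul1r.
by rewrite minor_form2 !mxE.
Qed.

Definition conn_mx Gamma a x : 'M[C]_4 := \matrix_(i, j) Gamma i j x (fun=> a).

Definition curv_mx Gamma a b x : 'M[C]_4 :=
  mderive a (conn_mx Gamma b) x - mderive b (conn_mx Gamma a) x
  + (conn_mx Gamma a x *m conn_mx Gamma b x - conn_mx Gamma b x *m conn_mx Gamma a x).

Lemma smooth_form1 U (w : dform R 4 1) :
  smooth_form U w <-> forall a, csmooth U (fun x => w x (fun=> a)).
Proof.
split=> [s a|s v]; first exact: s.
by rewrite (fun_ord1 v); exact: s.
Qed.

Lemma coframeP U theta :
  coframe U theta <-> msmooth U (coframe_mx theta) /\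
    (forall x, U x -> coframe_mx theta x \in unitmx).
Proof.
split=> -[s u]; split=> //.
  move=> i a; rewrite (_ : (fun x => _) = fun x => theta i x (fun=> a)).
    exact: s.
  by apply/funext => x; rewrite mxE.
move=> i; apply/smooth_form1 => a.
by rewrite (_ : (fun x => _) = fun x => coframe_mx theta x i a) //;
  apply/funext => x; rewrite mxE.
Qed.

Lemma conn_smoothP U Gamma : (forall i j, smooth_form U (Gamma i j)) <->
  (forall a, msmooth U (conn_mx Gamma a)).
Proof.
have e i j a : (fun x => conn_mx Gamma a x i j) = fun x => Gamma i j x (fun=> a).
  by apply/funext => x; rewrite mxE.
split=> [s a i j|s i j]; first by rewrite e; exact: s.
by apply/smooth_form1 => a; rewrite -e; exact: s.
Qed.

(** In coordinates, d theta = - Gamma /\ theta says that the covariant derivative along [a] of the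
    [b]-th column of the coframe matrix is symmetric in [a] and [b]. The metric equation becomes an
    identity between matrices. *)
Lemma weyl_connectionP U g A theta Gamma :
  weyl_connection U g A theta Gamma <->
  [/\ forall a, msmooth U (conn_mx Gamma a),
      forall x a, U x ->
        mderive a (frame_metric g theta) x
        - frame_metric g theta x *m conn_mx Gamma a x
        - (frame_metric g theta x *m conn_mx Gamma a x)^T
        = - A x (fun=> a) *: frame_metric g theta x
    & forall x a b, U x ->
        col b (mderive a (coframe_mx theta) x + conn_mx Gamma a x *m coframe_mx theta x)
        = col a (mderive b (coframe_mx theta) x
                 + conn_mx Gamma b x *m coframe_mx theta x)].
Proof.
have E1 x a i j : (mderive a (frame_metric g theta) x
        - frame_metric g theta x *m conn_mx Gamma a x
        - (frame_metric g theta x *m conn_mx Gamma a x)^T) i j =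
    dfun (fun y => frame_metric g theta y i j) x (fun=> a)
        - \sum_k frame_metric g theta x i k * Gamma k j x (fun=> a)
        - \sum_k frame_metric g theta x j k * Gamma k i x (fun=> a).
  rewrite dfunE !mxD_entry mderiveE !mxN_entry tr_entry !mxM_entry.
  by congr (_ - _ - _); apply: eq_bigr => k _; rewrite [conn_mx _ _ _ _ _]mxE.
have E2 x a b i :
   (col b (mderive a (coframe_mx theta) x + conn_mx Gamma a x *m coframe_mx theta x)
    - col a (mderive b (coframe_mx theta) x + conn_mx Gamma b x *m coframe_mx theta x)) i 0
   = ext_d (theta i) x (fun r : 'I_2 => if r == ord0 then a else b)
    - (- \sum_j (Gamma i j \wedge theta j)%DF) x (fun r : 'I_2 => if r == ord0 then a else b).
  have T c d : pderive c (fun y => coframe_mx theta y i d) x =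
      pderive c (fun y => theta i y (fun=> d)) x.
    by apply: eq_pderive => y; rewrite mxE.
  rewrite ext_d1E /= -[(- _ : dform R 4 2) _ _]/(- (_ x _)) dform_sumE opprK.
  rewrite mxD_entry mxN_entry !col_entry !mxD_entry !mderiveE !T !mxM_entry.
  rewrite (eq_bigr _ (fun j _ => wedge11E _ _ _ _)) /= sumrB opprD addrACA.
  by congr (_ + (_ - _)); apply: eq_bigr => j _; rewrite !mxE.
split=> [[s m t]|[s m t]].
  split; first exact/conn_smoothP.
    move=> x a Ux; apply/matrixP => i j; rewrite E1 m // !mxE.
    by rewrite -!/(frame_metric _ _ _).
  move=> x a b Ux; apply/eqP; rewrite -subr_eq0; apply/eqP/matrixP => i k.
  by rewrite (ord1 k) E2 t // subrr mxE.
split; first exact/conn_smoothP.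
  move=> i j x v Ux; have /matrixP/(_ i j) := m x (v ord0) Ux.
  by rewrite E1 [RHS]mxE (fun_ord1 v).
move=> i x Ux; apply/funext => v.
have /eqP := t x (v ord0) (v ord_max) Ux; rewrite -subr_eq0 => /eqP.
move/matrixP => /(_ i 0); rewrite E2 [RHS]mxE => /eqP; rewrite subr_eq0 => /eqP.
suff -> : (fun r : 'I_2 => if r == ord0 then v ord0 else v ord_max) = v by [].
by apply/funext => -[[|[|]] // p] /=; congr v; apply: val_inj.
Qed.

Lemma curvature_formE g theta Gamma i j x (v : 'I_2 -> 'I_4) :
  curvature_form g theta Gamma i j x v =
  (frame_metric g theta x *m curv_mx Gamma (v ord0) (v ord_max) x) i j.
Proof.
rewrite /curvature_form dform_sumE [RHS]mxE; apply: eq_bigr => h _.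
rewrite -[LHS]/(frame_metric g theta x i h * (ext_d (Gamma h j) x v
  + (\sum_k (Gamma h k \wedge Gamma k j)%DF) x v)).
congr (_ * _); rewrite dform_sumE ext_d1E [RHS]mxE; congr (_ + _).
  by rewrite mxD_entry mxN_entry !mderiveE; congr (_ - _);
    apply: eq_pderive => y; rewrite mxE.
rewrite (eq_bigr _ (fun k _ => wedge11E _ _ _ _)) sumrB.
by rewrite mxD_entry mxN_entry !mxM_entry; congr (_ - _); apply: eq_bigr => k _; rewrite !mxE.
Qed.

Lemma curv_mx_anti Gamma a b x : curv_mx Gamma a b x = - curv_mx Gamma b a x.
Proof. by rewrite /curv_mx opprD !opprB. Qed.

Definition frame_curv theta Gamma k l x : 'M[C]_4 :=
  \sum_a \sum_b (dual_frame theta x a k * dual_frame theta x b l) *: curv_mx Gamma a b x.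

Lemma riemannE g theta Gamma i j k l x :
  riemann g theta Gamma i j k l x =
  (frame_metric g theta x *m frame_curv theta Gamma k l x) i j.
Proof.
rewrite /riemann /frame_curv mulmx_sumr summxE; apply: eq_bigr => a _.
rewrite mulmx_sumr summxE; apply: eq_bigr => b _.
rewrite curvature_formE /= -scalemxAr [RHS]mxE -mulrA mulrC.
by [].
Qed.

Lemma frame_curv_anti theta Gamma k l x :
  frame_curv theta Gamma k l x = - frame_curv theta Gamma l k x.
Proof.
rewrite /frame_curv exchange_big -sumrN; apply: eq_bigr => b _ /=.
rewrite -sumrN; apply: eq_bigr => a _.
by rewrite curv_mx_anti scalerN mulrC.
Qed.

End MatrixConnection.

Section MatrixCancellations.
Variables (F : comNzRingType) (m n : nat).
Implicit Types p q r s t u w : 'M[F]_(m, n).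

Lemma commutator_cancel p q r s t u w :
  p + (u + q) + (r + t) - (p + (w + r) + (q + s)) = u - w + (t - s).
Proof. by apply/matrixP => i j; rewrite !mxE; ring. Qed.

Lemma cyclic_cancel p q r : p - q + (r - p) + (q - r) = 0.
Proof. by apply/matrixP => i j; rewrite !mxE; ring. Qed.

Lemma symmetrized_sum (h P Q S : 'M[F]_n) : h *m S + (h *m S)^T = 0 ->
  h *m (P - Q + S) + (h *m (P - Q + S))^T =
  h *m P + (h *m P)^T - (h *m Q + (h *m Q)^T).
Proof.
move/eqP; rewrite addrC addr_eq0 => /eqP; rewrite mulmxDr mulmxBr.
move: (h *m P) (h *m Q) (h *m S) => p q s E.
have E' i j : s j i = - s i j by have /matrixP/(_ i j) := E; rewrite !mxE.
by apply/matrixP => i j; rewrite !mxE E'; ring.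
Qed.

(** The hypotheses put [G1] and [G2] in the conformal Lie algebra of [h]; a commutator has no scalar
    part, so it is skew for [h]. *)
Lemma metric_commutator (h G1 G2 : 'M[F]_n) (a b : F) : h^T = h ->
  h *m G1 + (h *m G1)^T = a *: h -> h *m G2 + (h *m G2)^T = b *: h ->
  h *m (G1 *m G2 - G2 *m G1) + (h *m (G1 *m G2 - G2 *m G1))^T = 0.
Proof.
move=> hs H1 H2.
have E1 : h *m G1 = a *: h - G1^T *m h by rewrite -H1 trmx_mul hs addrK.
have E2 : h *m G2 = b *: h - G2^T *m h by rewrite -H2 trmx_mul hs addrK.
have P1 : h *m G1 *m G2 =
    a *: (b *: h - G2^T *m h) - G1^T *m (b *: h - G2^T *m h).
  by rewrite E1 mulmxBl -scalemxAl -mulmxA E2.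
have P2 : h *m G2 *m G1 =
    b *: (a *: h - G1^T *m h) - G2^T *m (a *: h - G1^T *m h).
  by rewrite E2 mulmxBl -scalemxAl -mulmxA E1.
rewrite mulmxBr !mulmxA linearB /= !trmx_mul hs P1 P2 !mulmxBr -!scalemxAr !mulmxA.
move: (G1^T *m h) (G2^T *m h) (G1^T *m G2^T *m h) (G2^T *m G1^T *m h) => p q r s.
by apply/matrixP => i j; rewrite !mxE; ring.
Qed.

End MatrixCancellations.

(** * The first Bianchi identity *)

Section Bianchi.
Variable R : realType.
Local Notation C := R[i].
Variables (U : set 'rV[R]_4) (theta : 'I_4 -> dform R 4 1)
  (Gamma : 'I_4 -> 'I_4 -> dform R 4 1).
Hypotheses (oU : open U) (cth : coframe U theta)
  (sG : forall a, msmooth U (conn_mx Gamma a)).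
Implicit Types (x : 'rV[R]_4) (a b c : 'I_4).
Local Notation T := (coframe_mx theta).
Local Notation e := (dual_frame theta).

Definition covariant a (v : 'rV[R]_4 -> 'cV[C]_4) x : 'cV[C]_4 :=
  mderive a v x + conn_mx Gamma a x *m v x.

Lemma mderive_covariant a b v x : U x -> msmooth U v ->
  mderive a (covariant b v) x = mderive a (mderive b v) x
    + (mderive a (conn_mx Gamma b) x *m v x + conn_mx Gamma b x *m mderive a v x).
Proof.
move=> Ux sv; rewrite -(mderiveM _ Ux) // -(mderiveD _ Ux) //.
  exact: msmooth_mderive.
exact: msmooth_mul.
Qed.

(** The second derivatives of [v] cancel because they commute, and the terms with one derivative of
    [v] cancel in pairs; the curvature is what remains. *)
Lemma covariant_comm a b v x : U x -> msmooth U v ->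
  covariant a (covariant b v) x - covariant b (covariant a v) x =
  curv_mx Gamma a b x *m v x.
Proof.
move=> Ux sv; rewrite {1 3}/covariant !mderive_covariant // /covariant !mulmxDr.
rewrite (mderive_comm a b oU Ux sv) /curv_mx !mulmxDl !mulNmx !mulmxA.
exact: commutator_cancel.
Qed.

Hypothesis torsion : forall x a b, U x ->
  col b (mderive a T x + conn_mx Gamma a x *m T x) =
  col a (mderive b T x + conn_mx Gamma b x *m T x).

Let t c x := col c (T x).

Let st c : msmooth U (t c).
Proof.
move=> i j; have [s _] := (coframeP U theta).1 cth.
rewrite (_ : (fun x => _) = fun x => T x i c); first exact: s.
by apply/funext => x; rewrite col_entry.
Qed.

Lemma covariant_frame x a b : U x -> covariant a (t b) x = covariant b (t a) x.
Proof.
have E c d : covariant c (t d) x = col d (mderive c T x + conn_mx Gamma c x *m T x).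
  apply/colP => i; rewrite col_entry !mxD_entry !mderiveE !mxM_entry.
  congr (_ + _); first by apply: eq_pderive => y; rewrite col_entry.
  by apply: eq_bigr => j _; rewrite col_entry.
by move=> Ux; rewrite !E torsion.
Qed.

(** Vanishing torsion allows the direction of the inner derivative and the index of the column to be
    exchanged. The three commutators then become p - q, q - r and r - p for the three cyclic second
    derivatives. *)
Lemma bianchi_coord a b c x : U x ->
  curv_mx Gamma a b x *m t c x + curv_mx Gamma b c x *m t a x
    + curv_mx Gamma c a x *m t b x = 0.
Proof.
move=> Ux.
have D c1 c2 c3 : covariant c1 (covariant c2 (t c3)) x =
    covariant c1 (covariant c3 (t c2)) x.
  exact: (f_equal2 +%R (mderive_ext c1 oU Ux (fun y Uy => covariant_frame c2 c3 Uy))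
    (f_equal (mulmx (conn_mx Gamma c1 x)) (covariant_frame c2 c3 Ux))).
pose p := covariant a (covariant b (t c)) x.
pose q := covariant b (covariant c (t a)) x.
pose r := covariant c (covariant a (t b)) x.
have E1 : p - q = curv_mx Gamma a b x *m t c x :=
  etrans (f_equal (fun w => p - w) (D b c a)) (covariant_comm a b Ux (st c)).
have E2 : q - r = curv_mx Gamma b c x *m t a x :=
  etrans (f_equal (fun w => q - w) (D c a b)) (covariant_comm b c Ux (st a)).
have E3 : r - p = curv_mx Gamma c a x *m t b x :=
  etrans (f_equal (fun w => r - w) (D a b c)) (covariant_comm c a Ux (st b)).
apply: etrans (esym (f_equal2 +%R (f_equal2 +%R E1 E2) E3)) _.
by rewrite addrAC cyclic_cancel.
Qed.

Lemma frame_mul x : U x -> T x *m e x = 1%:M.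
Proof. by move=> Ux; have [_ u] := cth; rewrite mulmxV // u. Qed.

Lemma frame_curv_col k l j i x : U x -> frame_curv theta Gamma k l x i j =
  \sum_a \sum_b \sum_c e x a k * e x b l * e x c j *
     (curv_mx Gamma a b x *m t c x) i 0.
Proof.
move=> Ux; rewrite /frame_curv summxE; apply: eq_bigr => a _.
rewrite summxE; apply: eq_bigr => b _; rewrite mxE.
have -> : curv_mx Gamma a b x i j = (curv_mx Gamma a b x *m T x *m e x) i j.
  by rewrite -mulmxA (frame_mul Ux) mulmx1.
rewrite [X in _ * X]mxM_entry mulr_sumr.
apply: eq_bigr => c _; rewrite [X in _ * X]mulrC mulrA; congr (_ * _).
by rewrite !mxM_entry; apply: eq_bigr => d _; rewrite col_entry.
Qed.

Lemma bianchi k l j i x : U x ->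
  frame_curv theta Gamma k l x i j + frame_curv theta Gamma l j x i k
  + frame_curv theta Gamma j k x i l = 0.
Proof.
move=> Ux; rewrite !frame_curv_col //.
set S1 := \sum_a _; set S2 := \sum_a _; set S3 := \sum_a _.
have -> : S2 = \sum_a \sum_b \sum_c e x a k * e x b l * e x c j *
     (curv_mx Gamma b c x *m t a x) i 0.
  rewrite /S2 [RHS]exchange_big; apply: eq_bigr => b _.
  rewrite [RHS]exchange_big; apply: eq_bigr => c _; apply: eq_bigr => a _.
  by congr (_ * _); move: (e x a k) (e x b l) (e x c j) => p q r; ring.
have -> : S3 = \sum_a \sum_b \sum_c e x a k * e x b l * e x c j *
     (curv_mx Gamma c a x *m t b x) i 0.
  rewrite /S3 exchange_big; apply: eq_bigr => a _.
  rewrite exchange_big; apply: eq_bigr => b _; apply: eq_bigr => c _.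
  by congr (_ * _); move: (e x a k) (e x b l) (e x c j) => p q r; ring.
rewrite /S1 -!big_split big1 // => a _; rewrite -!big_split big1 // => b _.
rewrite -!big_split big1 // => c _ /=; rewrite -!mulrDr.
by have /matrixP/(_ i 0) := bianchi_coord a b c Ux; rewrite !mxD_entry => ->;
  rewrite mxE mulr0.
Qed.

End Bianchi.

(** * The symmetric part of the curvature *)

Section MetricCurvature.
Variable R : realType.
Local Notation C := R[i].
Variables (U : set 'rV[R]_4) (h : 'M[C]_4) (A : dform R 4 1)
  (theta : 'I_4 -> dform R 4 1) (Gamma : 'I_4 -> 'I_4 -> dform R 4 1).
Hypotheses (oU : open U) (sA : smooth_form U A)
  (sG : forall a, msmooth U (conn_mx Gamma a)) (hs : h^T = h)
  (hG : forall x a, U x ->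
     h *m conn_mx Gamma a x + (h *m conn_mx Gamma a x)^T = A x (fun=> a) *: h).

(** Differentiating the metric equation of the connection yields the derivatives of [A], which
    combine to dA; the commutator contributes nothing by [metric_commutator]. *)
Lemma metric_curv_mx x a b : U x ->
  h *m curv_mx Gamma a b x + (h *m curv_mx Gamma a b x)^T =
  ext_d A x (fun r : 'I_2 => if r == ord0 then a else b) *: h.
Proof.
move=> Ux; have sh := @msmooth_cst R 4 _ _ U h.
have dhG c d : mderive c (fun y => h *m conn_mx Gamma d y + (h *m conn_mx Gamma d y)^T) x =
    h *m mderive c (conn_mx Gamma d) x + (h *m mderive c (conn_mx Gamma d) x)^T.
  have sm := msmooth_mul oU sh (sG d).
  rewrite (mderiveD _ Ux) //; last exact: msmooth_tr.
  by rewrite mderive_tr (mderiveM _ Ux) // mderive_cst mul0mx add0r.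
have dA c d : mderive c (fun y => A y (fun=> d) *: h) x =
    pderive c (fun y => A y (fun=> d)) x *: h.
  apply/matrixP => i j; rewrite mderiveE [RHS]mxE.
  rewrite (eq_pderive c x (fun y => mxE _ _ _ _ : (_ *: h) i j = A y (fun=> d) * h i j)).
  rewrite (pderiveM (csmooth_cderivable c (sA _) Ux) (cderivable_cst _ _ _)).
  by rewrite pderive_cst mulr0 addr0.
have D c d : h *m mderive c (conn_mx Gamma d) x + (h *m mderive c (conn_mx Gamma d) x)^T
    = pderive c (fun y => A y (fun=> d)) x *: h.
  by rewrite -dhG -dA; apply: (mderive_ext _ oU Ux) => y Uy; exact: hG.
have comm := metric_commutator hs (hG a Ux) (hG b Ux).
rewrite /curv_mx ext_d1E /= scalerBl -!D; exact: symmetrized_sum.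
Qed.

Lemma metric_frame_curv k l x : U x ->
  h *m frame_curv theta Gamma k l x + (h *m frame_curv theta Gamma k l x)^T =
  (\sum_a \sum_b dual_frame theta x a k * dual_frame theta x b l *
     ext_d A x (fun r : 'I_2 => if r == ord0 then a else b)) *: h.
Proof.
move=> Ux; rewrite /frame_curv mulmx_sumr linear_sum -big_split scaler_suml.
apply: eq_bigr => a _ /=; rewrite mulmx_sumr linear_sum -big_split scaler_suml.
apply: eq_bigr => b _ /=; rewrite -scalemxAr linearZ /= -scalerDr metric_curv_mx //.
by rewrite scalerA.
Qed.

End MetricCurvature.

(** * Change of coframe *)

Section GaugeAlgebra.
Variables (F : comNzRingType) (n : nat).
Implicit Types h K L P D : 'M[F]_n.

Lemma mxZ_entry m p (c : F) (M : 'M[F]_(m, p)) i j : (c *: M) i j = c * M i j.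
Proof. by rewrite mxE. Qed.

Lemma col_mulmx m p q (M : 'M[F]_(m, p)) (N : 'M[F]_(p, q)) j :
  col j (M *m N) = M *m col j N.
Proof. by rewrite !colE mulmxA. Qed.

Lemma trD_mx (M N : 'M[F]_n) : (M + N)^T = M^T + N^T.
Proof. exact: linearD. Qed.

Lemma gauge_metric_algebra h K P D dh (c : F) : h^T = h ->
  dh - P - P^T = - c *: h ->
  D^T *m h *m K + K^T *m dh *m K + K^T *m h *m D
    - (K^T *m P *m K + K^T *m h *m D) - (K^T *m P *m K + K^T *m h *m D)^T
  = - c *: (K^T *m h *m K).
Proof.
move=> hs E; have -> : dh = P + P^T - c *: h.
  by rewrite -scaleNr -E; apply/matrixP => i j; rewrite !mxE; ring.
rewrite trD_mx !trmx_mul !trmxK hs.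
rewrite mulmxBr mulmxDr mulmxBl mulmxDl -scalemxAr -scalemxAl !mulmxA.
move: (K^T *m h *m K) (K^T *m P *m K) (K^T *m P^T *m K) => u v w.
move: (D^T *m h *m K) (K^T *m h *m D) => p q.
by apply/matrixP => i j; rewrite !mxE; ring.
Qed.

(** [La], [Lb], [Ka], [Kb] stand for the first derivatives of [L] and [K], [Kab] for the common
    second derivative of [K], and [Gab] for the derivative of [Gb] along [a]. The hypotheses on [La]
    and [Lb] are the derivatives of L K = 1. *)
Lemma gauge_curv_algebra L K La Lb Ka Kb Kab Ga Gb Gab Gba :
  K *m L = 1%:M -> L *m Ka *m L = - La -> L *m Kb *m L = - Lb ->
  La *m (Gb *m K + Kb) + L *m (Gab *m K + Gb *m Ka + Kab)
  - (Lb *m (Ga *m K + Ka) + L *m (Gba *m K + Ga *m Kb + Kab))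
  + (L *m (Ga *m K + Ka) *m (L *m (Gb *m K + Kb))
     - L *m (Gb *m K + Kb) *m (L *m (Ga *m K + Ka)))
  = L *m (Gab - Gba + (Ga *m Gb - Gb *m Ga)) *m K.
Proof.
move=> KL Ea Eb.
have P G1 G2 K1 K2 L1 : L *m K1 *m L = - L1 ->
    L *m (G1 *m K + K1) *m (L *m (G2 *m K + K2)) =
    L *m G1 *m (G2 *m K + K2) - L1 *m (G2 *m K + K2).
  move=> E; rewrite mulmxA -mulNmx -E -mulmxDl; congr (_ *m _).
  by rewrite mulmxDr mulmxDl !mulmxA -(mulmxA (L *m G1)) KL mulmx1.
rewrite (P _ _ _ _ _ Ea) (P _ _ _ _ _ Eb) !mulmxDr !mulmxDl !mulmxN !mulNmx !mulmxA.
move: (La *m Gb *m K) (La *m Kb) (L *m Gab *m K) (L *m Gb *m Ka) (L *m Kab).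
move: (Lb *m Ga *m K) (Lb *m Ka) (L *m Gba *m K) (L *m Ga *m Kb).
move: (L *m Ga *m Gb *m K) (L *m Gb *m Ga *m K) => p q r s t u v w x y z.
by apply/matrixP => i j; rewrite !mxE; ring.
Qed.

Lemma mulmx_inv3 (E : fieldType) m (A B D : 'M[E]_m) :
  A \in unitmx -> B \in unitmx -> D \in unitmx ->
  invmx (A *m B *m D) = invmx D *m invmx B *m invmx A.
Proof.
move=> uA uB uD; have uABD : A *m B *m D \in unitmx by rewrite !unitmx_mul uA uB.
rewrite -[LHS]mulmx1.
have <- : A *m B *m D *m (invmx D *m invmx B *m invmx A) = 1%:M.
  by rewrite !mulmxA mulmxK // mulmxK // mulmxV.
by rewrite mulKmx.
Qed.

End GaugeAlgebra.

(** * The Ricci tensor as a matrix *)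

Section Ricci.
Variable R : realType.
Local Notation C := R[i].
Implicit Types (g : 'rV[R]_4 -> 'M[C]_4) (theta : 'I_4 -> dform R 4 1)
  (Gamma : 'I_4 -> 'I_4 -> dform R 4 1) (x : 'rV[R]_4).

(** As a trace of the curvature endomorphism the Ricci tensor does not involve the metric, so its
    behaviour under a change of coframe follows from that of the curvature alone. *)
Definition ric_mx theta Gamma x : 'M[C]_4 :=
  \matrix_(j, l) \sum_k frame_curv theta Gamma k l x k j.

Definition sym_ric0_mx g theta Gamma x : 'M[C]_4 :=
  let h := frame_metric g theta x in let ric := ric_mx theta Gamma x in
  2^-1 *: (ric + ric^T) - (\tr (invmx h *m ric^T) / 4) *: h.

(** A half-converted Ricci tensor: [b] is still a coordinate index and [j] a frame index, so a
    change of coframe acts on it by one multiplication on the right. *)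
Definition contracted_curv theta Gamma x : 'M[C]_4 :=
  \matrix_(b, j) \sum_a (dual_frame theta x *m curv_mx Gamma a b x) a j.

Lemma ric_mx_tr theta Gamma x :
  (ric_mx theta Gamma x)^T = (dual_frame theta x)^T *m contracted_curv theta Gamma x.
Proof.
apply/matrixP => l j; rewrite tr_entry mxM_entry mxE.
transitivity (\sum_k \sum_b \sum_a dual_frame theta x a k * dual_frame theta x b l *
    curv_mx Gamma a b x k j).
  apply: eq_bigr => k _; rewrite /frame_curv exchange_big summxE.
  apply: eq_bigr => b _; rewrite summxE; apply: eq_bigr => a _; exact: mxZ_entry.
rewrite exchange_big; apply: eq_bigr => b _ /=.
rewrite tr_entry mxE mulr_sumr exchange_big; apply: eq_bigr => a _.
rewrite mxM_entry mulr_sumr; apply: eq_bigr => k _.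
by rewrite [RHS]mulrCA mulrA.
Qed.

Lemma ricciE g theta Gamma j l x :
  (frame_metric g theta x)^T = frame_metric g theta x ->
  frame_metric g theta x \in unitmx ->
  ricci g theta Gamma j l x = ric_mx theta Gamma x j l.
Proof.
move=> hs hu; rewrite mxE /ricci exchange_big; apply: eq_bigr => k _ /=.
rewrite /frame_cometric; set h := frame_metric g theta x in hs hu *.
transitivity ((invmx h *m (h *m frame_curv theta Gamma k l x)) k j).
  rewrite mxM_entry; apply: eq_bigr => i _; rewrite riemannE; congr (_ * _).
  by rewrite -[in RHS]hs -trmx_inv tr_entry.
by rewrite mulKmx.
Qed.

Lemma sym_ricci0E g theta Gamma i j x :
  (frame_metric g theta x)^T = frame_metric g theta x ->
  frame_metric g theta x \in unitmx ->
  sym_ricci0 g theta Gamma i j x = sym_ric0_mx g theta Gamma x i j.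
Proof.
move=> hs hu; rewrite /sym_ricci0 /sym_ric0_mx !ricciE //.
rewrite mxD_entry mxN_entry !mxZ_entry mxD_entry tr_entry [_^-1 * _]mulrC; congr (_ - _).
rewrite [RHS]mulrAC; congr (_ * _ / _); rewrite /scalar_curvature /mxtrace.
apply: eq_bigr => k _; rewrite mxM_entry; apply: eq_bigr => l _.
by rewrite ricciE // tr_entry.
Qed.

End Ricci.

Section Gauge.
Variable R : realType.
Local Notation C := R[i].
Variables (U : set 'rV[R]_4) (g : 'rV[R]_4 -> 'M[C]_4) (A : dform R 4 1)
  (theta theta' : 'I_4 -> dform R 4 1) (Gamma : 'I_4 -> 'I_4 -> dform R 4 1)
  (L K : 'rV[R]_4 -> 'M[C]_4).
Hypotheses (oU : open U) (sL : msmooth U L) (sK : msmooth U K)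
  (LK : forall x, U x -> L x *m K x = 1%:M)
  (cth : coframe U theta)
  (thE : forall x, U x -> coframe_mx theta' x = L x *m coframe_mx theta x)
  (gs : forall x, U x -> (g x)^T = g x)
  (wG : weyl_connection U g A theta Gamma).
Implicit Types (x : 'rV[R]_4) (a b : 'I_4).

(** The usual law L Gamma L^-1 + L d(L^-1), with [K] in the place of L^-1. *)
Definition gauge_mx a x : 'M[C]_4 :=
  L x *m (conn_mx Gamma a x *m K x + mderive a K x).

Definition gauge : 'I_4 -> 'I_4 -> dform R 4 1 :=
  fun i j x v => gauge_mx (v ord0) x i j.

Lemma conn_gauge a x : conn_mx gauge a x = gauge_mx a x.
Proof. by apply/matrixP => i j; rewrite mxE. Qed.

Let KL x : U x -> K x *m L x = 1%:M. Proof. by move=> /LK /mulmx1C. Qed.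

Let sG a : msmooth U (conn_mx Gamma a).
Proof. by have [s _ _] := (weyl_connectionP _ _ _ _ _).1 wG; exact: s. Qed.

Lemma gauge_dual x : U x -> dual_frame theta' x = dual_frame theta x *m K x.
Proof.
move=> Ux; have [_ uT] := cth; have {}uT := uT x Ux.
have uL : L x \in unitmx by have [] := mulmx1_unit (LK Ux).
have uT' : coframe_mx theta' x \in unitmx by rewrite thE // unitmx_mul uL.
rewrite /dual_frame -[LHS]mulmx1.
have <- : coframe_mx theta' x *m (invmx (coframe_mx theta x) *m K x) = 1%:M.
  by rewrite thE // mulmxA mulmxK // LK.
by rewrite mulKmx.
Qed.

Lemma gauge_metric x : U x ->
  frame_metric g theta' x = (K x)^T *m frame_metric g theta x *m K x.
Proof. by move=> Ux; rewrite /frame_metric gauge_dual // trmx_mul !mulmxA. Qed.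

Let dLK a x : U x -> L x *m mderive a K x *m L x = - mderive a L x.
Proof.
move=> Ux; have : mderive a (fun y => L y *m K y) x = 0.
  rewrite -(mderive_cst a (1%:M : 'M[C]_4) x).
  by apply: (mderive_ext _ oU Ux) => y /LK.
rewrite (mderiveM a Ux sL sK) => /eqP; rewrite addrC addr_eq0 => /eqP ->.
by rewrite mulNmx -mulmxA KL // mulmx1.
Qed.

Let sgauge a : msmooth U (gauge_mx a).
Proof.
apply: msmooth_mul => //; apply: msmooth_add => //; first exact: msmooth_mul.
exact: msmooth_mderive.
Qed.

Lemma gauge_weyl_connection :
  msmooth U (frame_metric g theta) -> weyl_connection U g A theta' gauge.
Proof.
move=> sh; have [_ m t] := (weyl_connectionP _ _ _ _ _).1 wG.
have [sT uT] := (coframeP U theta).1 cth.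
apply/weyl_connectionP; split.
- by move=> a; apply: msmooth_ext (sgauge a) => // x _; rewrite conn_gauge.
- move=> x a Ux; rewrite conn_gauge gauge_metric //.
  set h := frame_metric g theta x; set Ga := conn_mx Gamma a x.
  have dh : mderive a (frame_metric g theta') x =
     (mderive a K x)^T *m h *m K x + (K x)^T *m mderive a (frame_metric g theta) x *m K x
     + (K x)^T *m h *m mderive a K x.
    rewrite (mderive_ext a oU Ux gauge_metric).
    have sKt := msmooth_tr oU sK.
    rewrite (mderiveM a Ux (msmooth_mul oU sKt sh) sK) (mderiveM a Ux sKt sh).
    by rewrite mderive_tr mulmxDl.
  have hG : (K x)^T *m h *m K x *m gauge_mx a x =
      (K x)^T *m (h *m Ga) *m K x + (K x)^T *m h *m mderive a K x.
    rewrite /gauge_mx mulmxA -(mulmxA _ (K x) (L x)) KL // mulmx1.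
    by rewrite mulmxDr !mulmxA.
  have hs : h^T = h by rewrite /h /frame_metric !trmx_mul trmxK gs // mulmxA.
  rewrite dh hG; apply: gauge_metric_algebra => //; exact: m.
- move=> x a b Ux.
  have E c : mderive c (coframe_mx theta') x + conn_mx gauge c x *m coframe_mx theta' x
      = L x *m (mderive c (coframe_mx theta) x + conn_mx Gamma c x *m coframe_mx theta x).
    rewrite (mderive_ext c oU Ux thE) (mderiveM c Ux sL sT) conn_gauge /gauge_mx thE //.
    rewrite !mulmxA mulmxDr mulmxDl !mulmxA dLK // -(mulmxA _ (K x) (L x)) KL // mulmx1.
    by rewrite mulmxBl addrC addrA subrK mulmxDr !mulmxA addrC.
  by rewrite (E a) (E b) !col_mulmx (t x a b Ux).
Qed.

Lemma gauge_curv a b x : U x ->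
  curv_mx gauge a b x = L x *m curv_mx Gamma a b x *m K x.
Proof.
move=> Ux; rewrite /curv_mx !conn_gauge.
have dg c d : mderive c (conn_mx gauge d) x =
    mderive c L x *m (conn_mx Gamma d x *m K x + mderive d K x) +
    L x *m (mderive c (conn_mx Gamma d) x *m K x + conn_mx Gamma d x *m mderive c K x
            + mderive c (mderive d K) x).
  rewrite (mderive_ext c oU Ux (fun y _ => conn_gauge d y)).
  have s1 := msmooth_mul oU (sG d) sK; have s2 := msmooth_mderive d oU sK.
  rewrite (mderiveM c Ux sL (msmooth_add oU s1 s2)) (mderiveD c Ux s1 s2).
  by rewrite (mderiveM c Ux (sG d) sK).
rewrite !dg (mderive_comm b a oU Ux sK); apply: gauge_curv_algebra.
- exact: KL.
- exact: dLK.
- exact: dLK.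
Qed.

Lemma gauge_ric_mx x : U x ->
  ric_mx theta' gauge x = (K x)^T *m ric_mx theta Gamma x *m K x.
Proof.
move=> Ux; apply: trmx_inj; rewrite !ric_mx_tr gauge_dual //.
have -> : contracted_curv theta' gauge x = contracted_curv theta Gamma x *m K x.
  apply/matrixP => b j; rewrite mxE mxM_entry.
  rewrite (eq_bigr _ (fun k _ => f_equal2 *%R (mxE _ _ _ _) erefl)).
  rewrite (eq_bigr _ (fun k _ => mulr_suml _ _ _ _)) exchange_big /=.
  apply: eq_bigr => a _; rewrite -mxM_entry gauge_curv // gauge_dual //.
  by rewrite -!mulmxA (mulmxA (K x)) KL // mul1mx.
rewrite trmx_mul [RHS]trmx_mul [(_^T *m ric_mx _ _ _)^T]trmx_mul trmxK.
by rewrite ric_mx_tr !mulmxA.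
Qed.

(** The Ricci matrix and the metric undergo the same congruence by [K]; the scalar curvature is
    unchanged because a trace is cyclic. *)
Lemma gauge_sym_ric0_mx x : U x -> frame_metric g theta x \in unitmx ->
  sym_ric0_mx g theta' gauge x = (K x)^T *m sym_ric0_mx g theta Gamma x *m K x.
Proof.
move=> Ux hu; rewrite /sym_ric0_mx gauge_ric_mx // gauge_metric //.
set h := frame_metric g theta x; set r := ric_mx theta Gamma x.
have uK : K x \in unitmx by have [] := mulmx1_unit (LK Ux).
have rE : ((K x)^T *m r *m K x)^T = (K x)^T *m r^T *m K x.
  by rewrite trmx_mul [X in _ *m X]trmx_mul trmxK !mulmxA.
have tE : \tr (invmx ((K x)^T *m h *m K x) *m ((K x)^T *m r^T *m K x)) =
    \tr (invmx h *m r^T).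
  rewrite mulmx_inv3 ?unitmx_tr // -!mulmxA mxtrace_mulC -!mulmxA.
  by rewrite mulmxV // mulmx1 mulKmx ?unitmx_tr.
rewrite rE tE mulmxBr mulmxBl -!scalemxAr -!scalemxAl mulmxDr mulmxDl.
by [].
Qed.

End Gauge.

(** * Curvature in a null coframe *)

Section CurvatureAlgebra.
Variable F : numFieldType.

Lemma ord4_ind (P : 'I_4 -> Prop) : P o1 -> P o2 -> P o3 -> P o4 -> forall i, P i.
Proof.
move=> p1 p2 p3 p4 [[|[|[|[|//]]]] i4].
- by rewrite (_ : Ordinal i4 = o1) //; apply: val_inj.
- by rewrite (_ : Ordinal i4 = o2) //; apply: val_inj.
- by rewrite (_ : Ordinal i4 = o3) //; apply: val_inj.
- by rewrite (_ : Ordinal i4 = o4) //; apply: val_inj.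
Qed.

Lemma quadratic_eq0 (a b c : F) :
  (forall z, a + z * b + z ^+ 2 * c = 0) -> [/\ a = 0, b = 0 & c = 0].
Proof.
move=> H; have h0 := H 0; have h1 := H 1; have hN := H (-1).
have a0 : a = 0 by rewrite -h0; ring.
have b0 : b = 0.
  have -> : b = ((a + 1 * b + 1 ^+ 2 * c) - (a + -1 * b + (-1) ^+ 2 * c)) / 2 by field.
  by rewrite h1 hN subrr mul0r.
split=> //; rewrite -h1 a0 b0; ring.
Qed.

(** The central difference formulas on the points 0, 1, -1, 2, -2 are exact for quartics and express
    each coefficient by values of the polynomial. *)
Lemma quartic_eq0 (a b c d e : F) :
  (forall z, a + z * b + z ^+ 2 * c + z ^+ 3 * d + z ^+ 4 * e = 0) ->
  [/\ a = 0, b = 0, c = 0, d = 0 & e = 0].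
Proof.
move=> H; pose p z := a + z * b + z ^+ 2 * c + z ^+ 3 * d + z ^+ 4 * e.
have p0 z : p z = 0 by exact: H.
split.
- have -> : a = p 0 by rewrite /p; ring.
  exact: p0.
- have -> : b = (8 * (p 1 - p (-1)) - (p 2 - p (-2))) / 12 by rewrite /p; field.
  by rewrite !p0 subrr mulr0 subrr mul0r.
- have -> : c = (16 * (p 1 + p (-1)) - (p 2 + p (-2)) - 30 * p 0) / 24.
    by rewrite /p; field.
  by rewrite !p0 addr0 !mulr0 !subr0 mul0r.
- have -> : d = ((p 2 - p (-2)) - 2 * (p 1 - p (-1))) / 12 by rewrite /p; field.
  by rewrite !p0 subrr mulr0 subrr mul0r.
- have -> : e = ((p 2 + p (-2)) - 4 * (p 1 + p (-1)) + 6 * p 0) / 24.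
    by rewrite /p; field.
  by rewrite !p0 addr0 !mulr0 subr0 addr0 mul0r.
Qed.

(* The matrix of [M P - N K]. *)
Definition null_metric : 'M[F]_4 := \matrix_(i, j) nth 0 (nth [::]
  [:: [:: 0; 2^-1; 0; 0]; [:: 2^-1; 0; 0; 0];
      [:: 0; 0; 0; - 2^-1]; [:: 0; 0; - 2^-1; 0]] i) j.

Variables (r : 'I_4 -> 'I_4 -> 'I_4 -> 'I_4 -> F) (f : 'I_4 -> 'I_4 -> F).
Hypotheses (r_anti : forall i j k l, r i j k l = - r i j l k)
  (r_sym : forall i j k l, r i j k l + r j i k l = f k l * null_metric i j)
  (r_bianchi : forall i j k l, r i j k l + r i k l j + r i l j k = 0).

(* [nric], [nscal], [nsric0] and [nweyl] are the Ricci tensor, the scalar curvature,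
   the trace-free symmetric Ricci tensor and the Weyl tensor of a curvature tensor
   [r] in a null coframe; [f] is the differential of the Weyl form. *)
Definition nric j l : F :=
  2 * (r o1 j o2 l + r o2 j o1 l - r o3 j o4 l - r o4 j o3 l).

Definition nscal : F := 2 * (nric o1 o2 + nric o2 o1 - nric o3 o4 - nric o4 o3).

(* The curvature on the bivectors of the self-dual plane spanned by [z m - k] and
   [z n - p]. *)
Definition sd_curv z k l : F :=
  r o4 o2 k l + z * (r o2 o1 k l + r o3 o4 k l) + z ^+ 2 * r o1 o3 k l.

Let r_diag i j k : r i j k k = 0.
Proof.
have /eqP := r_anti i j k k; rewrite -addr_eq0 -mulr2n mulrn_eq0 /=.
by move/eqP.
Qed.

Let two0 : (2 : F) != 0. Proof. by rewrite pnatr_eq0. Qed.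

Let r_null i k l : r i i k l = 0.
Proof.
have e : null_metric i i = 0 by move: i; apply: ord4_ind; rewrite mxE.
have /eqP := r_sym i i k l; rewrite e mulr0 -mulr2n mulrn_eq0 /=.
by move/eqP.
Qed.

Let r_swap i j k l : r i j k l = f k l * null_metric i j - r j i k l.
Proof. by rewrite -r_sym addrK. Qed.

Let kl21 i j := r_anti i j o2 o1.
Let kl31 i j := r_anti i j o3 o1.
Let kl41 i j := r_anti i j o4 o1.
Let kl32 i j := r_anti i j o3 o2.
Let kl42 i j := r_anti i j o4 o2.
Let kl43 i j := r_anti i j o4 o3.

Let ij21 k l : r o2 o1 k l = f k l / 2 - r o1 o2 k l.
Proof. by rewrite r_swap mxE. Qed.
Let ij43 k l : r o4 o3 k l = - (f k l / 2) - r o3 o4 k l.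
Proof. by rewrite r_swap mxE /= mulrN. Qed.
Let ij31 k l : r o3 o1 k l = - r o1 o3 k l.
Proof. by rewrite r_swap mxE /= mulr0 sub0r. Qed.
Let ij41 k l : r o4 o1 k l = - r o1 o4 k l.
Proof. by rewrite r_swap mxE /= mulr0 sub0r. Qed.
Let ij32 k l : r o3 o2 k l = - r o2 o3 k l.
Proof. by rewrite r_swap mxE /= mulr0 sub0r. Qed.
Let ij42 k l : r o4 o2 k l = - r o2 o4 k l.
Proof. by rewrite r_swap mxE /= mulr0 sub0r. Qed.

Let f_diag k : f k k = 0.
Proof.
have := r_sym o1 o2 k k; rewrite !r_diag addr0 mxE /= => /esym /eqP.
by rewrite mulf_eq0 invr_eq0 (negbTE two0) orbF => /eqP.
Qed.

(** Rewriting with these rules brings every component to increasing index pairs, where the linear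
    identities below can be decided by [field]. *)
Let rE := (kl21, kl31, kl41, kl32, kl42, kl43, ij21, ij43, ij31, ij41, ij32, ij42,
  r_diag, r_null, f_diag).

(** The identities below hold after [rE] only up to multiples of such cyclic sums. Each
    [transitivity] step states the required multiples explicitly, and [bi0] then removes them. *)
Let bi i j k l := r i j k l + r i k l j + r i l j k.

Let bi0 i j k l : bi i j k l = 0. Proof. exact: r_bianchi. Qed.

(** * The trace-free Ricci tensor and the polynomial of bidegree (2, 2) *)

Section EinsteinWeyl.

(** The digits in a name are the exponents of [z] and z' in the monomial whose coefficient it is,
    with the opposite sign when z' has exponent 1. *)
Let c00 := r o4 o2 o4 o1.
Let c01 := r o4 o2 o2 o1 + r o4 o2 o4 o3.
Let c02 := r o4 o2 o2 o3.
Let c10 := r o2 o1 o4 o1 + r o3 o4 o4 o1.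
Let c11 := (r o2 o1 o2 o1 + r o3 o4 o2 o1) + (r o2 o1 o4 o3 + r o3 o4 o4 o3).
Let c12 := r o2 o1 o2 o3 + r o3 o4 o2 o3.
Let c20 := r o1 o3 o4 o1.
Let c21 := r o1 o3 o2 o1 + r o1 o3 o4 o3.
Let c22 := r o1 o3 o2 o3.

Let e00 : nric o4 o4 = 4 * c00.
Proof.
transitivity (4 * c00 - 2 * bi o4 o1 o2 o4); last by rewrite bi0 mulr0 subr0.
by rewrite /bi /nric /c00 !rE; field.
Qed.

Let e01 : nric o2 o4 + nric o4 o2 = 4 * c01.
Proof.
transitivity (4 * c01 - 2 * bi o2 o1 o2 o4 + 2 * bi o4 o2 o3 o4).
  by rewrite /bi /nric /c01 !rE; field.
by rewrite !bi0 mulr0 subr0 addr0.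
Qed.

Let e02 : nric o2 o2 = 4 * c02.
Proof.
transitivity (4 * c02 + 2 * bi o2 o2 o3 o4); last by rewrite bi0 mulr0 addr0.
by rewrite /bi /nric /c02 !rE; field.
Qed.

Let e10 : nric o1 o4 + nric o4 o1 = - 4 * c10.
Proof.
transitivity (- 4 * c10 - 2 * bi o1 o1 o2 o4 - 2 * bi o4 o1 o3 o4).
  by rewrite /bi /nric /c10 !rE; field.
by rewrite !bi0 mulr0 !subr0.
Qed.

Let e11 : (nric o1 o2 + nric o2 o1) + (nric o3 o4 + nric o4 o3) = - 4 * c11.
Proof.
transitivity (- 4 * c11 + 2 * bi o1 o2 o3 o4 - 2 * bi o2 o1 o3 o4
  - 2 * bi o3 o1 o2 o4 + 2 * bi o4 o1 o2 o3).
  by rewrite /bi /nric /c11 !rE; field.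
by rewrite !bi0 mulr0 !subr0 !addr0.
Qed.

Let e12 : nric o2 o3 + nric o3 o2 = - 4 * c12.
Proof.
transitivity (- 4 * c12 + 2 * bi o2 o1 o2 o3 + 2 * bi o3 o2 o3 o4).
  by rewrite /bi /nric /c12 !rE; field.
by rewrite !bi0 mulr0 !addr0.
Qed.

Let e20 : nric o1 o1 = 4 * c20.
Proof.
transitivity (4 * c20 - 2 * bi o1 o1 o3 o4); last by rewrite bi0 mulr0 subr0.
by rewrite /bi /nric /c20 !rE; field.
Qed.

Let e21 : nric o1 o3 + nric o3 o1 = 4 * c21.
Proof.
transitivity (4 * c21 + 2 * bi o1 o1 o2 o3 - 2 * bi o3 o1 o3 o4).
  by rewrite /bi /nric /c21 !rE; field.
by rewrite !bi0 mulr0 subr0 addr0.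
Qed.

Let e22 : nric o3 o3 = 4 * c22.
Proof.
transitivity (4 * c22 + 2 * bi o3 o1 o2 o3); last by rewrite bi0 mulr0 addr0.
by rewrite /bi /nric /c22 !rE; field.
Qed.

Definition nsric0 i j : F := 2^-1 * (nric i j + nric j i) - nscal / 4 * null_metric i j.

(** Eight coefficients are multiples of components of the symmetrized Ricci tensor on which the
    metric vanishes. The ninth, [c11], is the sum of its (1,2) and (3,4) components; their
    difference is the scalar curvature, which the trace-free part subtracts. *)
Lemma mixed_curvature_eq0 :
  (forall z z', z' ^+ 2 * sd_curv z o2 o3 - z' * sd_curv z o2 o1
     - z' * sd_curv z o4 o3 + sd_curv z o4 o1 = 0) <->
  (forall i j, nsric0 i j = 0).
Proof.
have E z z' : z' ^+ 2 * sd_curv z o2 o3 - z' * sd_curv z o2 o1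
     - z' * sd_curv z o4 o3 + sd_curv z o4 o1 =
    (c00 + z * c10 + z ^+ 2 * c20) + z' * (- (c01 + z * c11 + z ^+ 2 * c21))
     + z' ^+ 2 * (c02 + z * c12 + z ^+ 2 * c22).
  by rewrite /sd_curv /c00 /c01 /c02 /c10 /c11 /c12 /c20 /c21 /c22; ring.
have sym i j : nsric0 i j = nsric0 j i.
  rewrite /nsric0 [nric j i + _]addrC; congr (_ - _ * _).
  by move: i j; apply: ord4_ind; apply: ord4_ind; rewrite !mxE.
split=> [H|H z z'].
  have H0 z : [/\ c00 + z * c10 + z ^+ 2 * c20 = 0,
      - (c01 + z * c11 + z ^+ 2 * c21) = 0 & c02 + z * c12 + z ^+ 2 * c22 = 0].
    by apply: quadratic_eq0 => z'; rewrite -E H.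
  have [a0 a1 a2] : [/\ c00 = 0, c10 = 0 & c20 = 0].
    by apply: quadratic_eq0 => z; have [] := H0 z.
  have [b0 b1 b2] : [/\ c01 = 0, c11 = 0 & c21 = 0].
    by apply: quadratic_eq0 => z; have [_ /eqP] := H0 z; rewrite oppr_eq0 => /eqP.
  have [d0 d1 d2] : [/\ c02 = 0, c12 = 0 & c22 = 0].
    by apply: quadratic_eq0 => z; have [] := H0 z.
  have tr0 : nric o3 o4 + nric o4 o3 = - (nric o1 o2 + nric o2 o1).
    by apply/eqP; rewrite -addr_eq0 addrC e11 b1 mulr0.
  have s12 : nsric0 o1 o2 = 0.
    rewrite /nsric0 /nscal mxE /=.
    have -> : nric o1 o2 + nric o2 o1 - nric o3 o4 - nric o4 o3 =
      (nric o1 o2 + nric o2 o1) - (nric o3 o4 + nric o4 o3) by ring.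
    by rewrite tr0; field.
  have s34 : nsric0 o3 o4 = 0.
    rewrite /nsric0 /nscal mxE /=.
    have -> : nric o1 o2 + nric o2 o1 - nric o3 o4 - nric o4 o3 =
      (nric o1 o2 + nric o2 o1) - (nric o3 o4 + nric o4 o3) by ring.
    by rewrite tr0; field.
  have s11 : nsric0 o1 o1 = 0 by rewrite /nsric0 mxE /= e20 a2; ring.
  have s22 : nsric0 o2 o2 = 0 by rewrite /nsric0 mxE /= e02 d0; ring.
  have s33 : nsric0 o3 o3 = 0 by rewrite /nsric0 mxE /= e22 d2; ring.
  have s44 : nsric0 o4 o4 = 0 by rewrite /nsric0 mxE /= e00 a0; ring.
  have s13 : nsric0 o1 o3 = 0 by rewrite /nsric0 mxE /= e21 b2; ring.
  have s14 : nsric0 o1 o4 = 0 by rewrite /nsric0 mxE /= e10 a1; ring.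
  have s23 : nsric0 o2 o3 = 0 by rewrite /nsric0 mxE /= e12 d1; ring.
  have s24 : nsric0 o2 o4 = 0 by rewrite /nsric0 mxE /= e01 b0; ring.
  by apply: ord4_ind; apply: ord4_ind => //; rewrite sym.
have half (x : F) : 2^-1 * x - nscal / 4 * 0 = 0 -> x = 0.
  move/eqP; rewrite mulr0 subr0 mulf_eq0 invr_eq0 (negbTE two0) => /eqP //.
have z4 (c : F) : 4 * c = 0 -> c = 0.
  by move/eqP; rewrite mulf_eq0 pnatr_eq0 /= => /eqP.
have n4 (c : F) : - 4 * c = 0 -> c = 0.
  by move/eqP; rewrite mulf_eq0 oppr_eq0 pnatr_eq0 /= => /eqP.
have S i j : null_metric i j = 0 -> nric i j + nric j i = 0.
  by move=> e; have := H i j; rewrite /nsric0 e => /half.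
have SD i : null_metric i i = 0 -> nric i i = 0.
  by move=> /S /eqP; rewrite -mulr2n mulrn_eq0 /= => /eqP.
have a0 : c00 = 0 by apply: z4; rewrite -e00 SD // mxE.
have a1 : c10 = 0 by apply: n4; rewrite -e10 S // mxE.
have a2 : c20 = 0 by apply: z4; rewrite -e20 SD // mxE.
have b0 : c01 = 0 by apply: z4; rewrite -e01 S // mxE.
have b2 : c21 = 0 by apply: z4; rewrite -e21 S // mxE.
have d0 : c02 = 0 by apply: z4; rewrite -e02 SD // mxE.
have d1 : c12 = 0 by apply: n4; rewrite -e12 S // mxE.
have d2 : c22 = 0 by apply: z4; rewrite -e22 SD // mxE.
have b1 : c11 = 0.
  apply: n4; rewrite -e11.
  have -> : (nric o1 o2 + nric o2 o1) + (nric o3 o4 + nric o4 o3) =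
     2 * (nsric0 o1 o2 + nsric0 o3 o4) by rewrite /nsric0 !mxE /=; field.
  by rewrite !H addr0 mulr0.
by rewrite E a0 a1 a2 b0 b1 b2 d0 d1 d2; ring.
Qed.

End EinsteinWeyl.

(** * The self-dual Weyl tensor and the quartic *)

Section SelfDualWeyl.
Hypothesis f0 : forall k l, f k l = 0.

Definition nweyl i j k l : F := r i j k l
  - (null_metric i k * nric j l - null_metric i l * nric j k
     - null_metric j k * nric i l + null_metric j l * nric i k) / 2
  + nscal * (null_metric i k * null_metric j l - null_metric i l * null_metric j k) / 6.

(** The coefficients of the quartic in increasing degree: up to constants, the five components of
    the self-dual Weyl spinor. *)
Let c0 := r o4 o2 o4 o2.
Let c1 := r o4 o2 o2 o1 + r o4 o2 o3 o4 + (r o2 o1 o4 o2 + r o3 o4 o4 o2).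
Let c2 := r o4 o2 o1 o3 + r o1 o3 o4 o2
  + (r o2 o1 o2 o1 + r o2 o1 o3 o4 + r o3 o4 o2 o1 + r o3 o4 o3 o4).
Let c3 := r o1 o3 o2 o1 + r o1 o3 o3 o4 + (r o2 o1 o1 o3 + r o3 o4 o1 o3).
Let c4 := r o1 o3 o1 o3.

Let wE := (rE, f0).

Lemma nweyl_anti i j k l : nweyl i j k l = - nweyl j i k l.
Proof.
have rij : r i j k l = - r j i k l by rewrite r_swap f0 mul0r sub0r.
by rewrite /nweyl rij; ring.
Qed.

Lemma nweyl_antikl i j k l : nweyl i j k l = - nweyl i j l k.
Proof. by rewrite /nweyl r_anti; ring. Qed.

Let n11 : null_metric o1 o1 = 0. Proof. by rewrite mxE. Qed.
Let n12 : null_metric o1 o2 = 2^-1. Proof. by rewrite mxE. Qed.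
Let n13 : null_metric o1 o3 = 0. Proof. by rewrite mxE. Qed.
Let n14 : null_metric o1 o4 = 0. Proof. by rewrite mxE. Qed.
Let n21 : null_metric o2 o1 = 2^-1. Proof. by rewrite mxE. Qed.
Let n22 : null_metric o2 o2 = 0. Proof. by rewrite mxE. Qed.
Let n23 : null_metric o2 o3 = 0. Proof. by rewrite mxE. Qed.
Let n24 : null_metric o2 o4 = 0. Proof. by rewrite mxE. Qed.
Let n31 : null_metric o3 o1 = 0. Proof. by rewrite mxE. Qed.
Let n32 : null_metric o3 o2 = 0. Proof. by rewrite mxE. Qed.
Let n33 : null_metric o3 o3 = 0. Proof. by rewrite mxE. Qed.
Let n34 : null_metric o3 o4 = - 2^-1. Proof. by rewrite mxE. Qed.
Let n41 : null_metric o4 o1 = 0. Proof. by rewrite mxE. Qed.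
Let n42 : null_metric o4 o2 = 0. Proof. by rewrite mxE. Qed.
Let n43 : null_metric o4 o3 = - 2^-1. Proof. by rewrite mxE. Qed.
Let n44 : null_metric o4 o4 = 0. Proof. by rewrite mxE. Qed.
Let nE := (n11, n12, n13, n14, n21, n22, n23, n24, n31, n32, n33, n34, n41, n42, n43, n44,
  (fun x : F => mul0r x), (fun x : F => subr0 x), (fun x : F => sub0r x),
  (fun x : F => addr0 x), (fun x : F => add0r x), (fun x : F => mulr0 x)).

(** The components of the 2-form w_ij along P /\ K, N /\ M and N /\ K - M /\ P vanish. *)
Definition sd_part i j := [/\ nweyl i j o2 o4 = 0, nweyl i j o1 o3 = 0
  & nweyl i j o1 o2 = nweyl i j o3 o4].

(** Both index pairs of the curvature are evaluated on the same plane, so only the totally symmetric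
    spinor part enters the quartic: the Ricci tensor and the scalar curvature drop out. Modulo
    cyclic sums the components in [sd_part] are multiples of the coefficients, and each coefficient
    is a combination of components of [nweyl]. *)
Lemma self_dual_weyl_eq0 :
  (forall z, z ^+ 2 * sd_curv z o1 o3 - z * sd_curv z o1 o2
     - z * sd_curv z o4 o3 + sd_curv z o4 o2 = 0) <->
  (forall i j, sd_part i j).
Proof.
have E z : z ^+ 2 * sd_curv z o1 o3 - z * sd_curv z o1 o2
     - z * sd_curv z o4 o3 + sd_curv z o4 o2 =
    c0 + z * c1 + z ^+ 2 * c2 + z ^+ 3 * c3 + z ^+ 4 * c4.
  by rewrite /sd_curv /c0 /c1 /c2 /c3 /c4 !wE; field.
split=> [H|H z].
  have [h0 h1 h2 h3 h4] : [/\ c0 = 0, c1 = 0, c2 = 0, c3 = 0 & c4 = 0].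
    by apply: quartic_eq0 => z; rewrite -E.
  have s12 : sd_part o1 o2.
    split; [| |apply/eqP; rewrite -subr_eq0; apply/eqP].
    - transitivity (c1 / 4 - bi o2 o1 o2 o4 / 4 + bi o4 o2 o3 o4 / 4).
        by rewrite /nweyl /c1 /bi /nscal /nric !nE ?wE; field.
      by rewrite !bi0 h1; ring.
    - transitivity (- (c3 / 4) - bi o1 o1 o2 o3 / 4 + bi o3 o1 o3 o4 / 4).
        by rewrite /nweyl /c3 /bi /nscal /nric !nE ?wE; field.
      by rewrite !bi0 h3; ring.
    - transitivity (c2 / 3 - bi o1 o2 o3 o4 / 3 + bi o2 o1 o3 o4 / 3 + bi o3 o1 o2 o4
        / 6 - bi o4 o1 o2 o3 / 6).
        by rewrite /nweyl /c2 /bi /nscal /nric !nE ?wE; field.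
      by rewrite !bi0 h2; ring.
  have s13 : sd_part o1 o3.
    split; [| |apply/eqP; rewrite -subr_eq0; apply/eqP].
    - transitivity (- (c2 / 6) - bi o1 o2 o3 o4 / 12 + bi o2 o1 o3 o4 / 12 - bi o3 o1
        o2 o4 / 12 + bi o4 o1 o2 o3 / 12).
        by rewrite /nweyl /c2 /bi /nscal /nric !nE ?wE; field.
      by rewrite !bi0 h2; ring.
    - transitivity (c4).
        by rewrite /nweyl /c4 /nscal /nric !nE ?wE; field.
      by rewrite h4; ring.
    - transitivity (- (c3 / 2)).
        by rewrite /nweyl /c3 /nscal /nric !nE ?wE; field.
      by rewrite h3; ring.
  (* For the pairs (1,4) and (2,3) only cyclic sums occur and no coefficient of the quartic: these
     pairs are anti-self-dual, and the Weyl tensor does not mix the two kinds of bivectors. *)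
  have s14 : sd_part o1 o4.
    split; [| |apply/eqP; rewrite -subr_eq0; apply/eqP].
    - transitivity (- (bi o4 o1 o2 o4 / 2)).
        by rewrite /nweyl /bi /nscal /nric !nE ?wE; field.
      by rewrite !bi0; ring.
    - transitivity (bi o1 o1 o3 o4 / 2).
        by rewrite /nweyl /bi /nscal /nric !nE ?wE; field.
      by rewrite !bi0; ring.
    - transitivity (bi o1 o1 o2 o4 / 2 + bi o4 o1 o3 o4 / 2).
        by rewrite /nweyl /bi /nscal /nric !nE ?wE; field.
      by rewrite !bi0; ring.
  have s23 : sd_part o2 o3.
    split; [| |apply/eqP; rewrite -subr_eq0; apply/eqP].
    - transitivity (- (bi o2 o2 o3 o4 / 2)).
        by rewrite /nweyl /bi /nscal /nric !nE ?wE; field.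
      by rewrite !bi0; ring.
    - transitivity (bi o3 o1 o2 o3 / 2).
        by rewrite /nweyl /bi /nscal /nric !nE ?wE; field.
      by rewrite !bi0; ring.
    - transitivity (bi o2 o1 o2 o3 / 2 + bi o3 o2 o3 o4 / 2).
        by rewrite /nweyl /bi /nscal /nric !nE ?wE; field.
      by rewrite !bi0; ring.
  have s24 : sd_part o2 o4.
    split; [| |apply/eqP; rewrite -subr_eq0; apply/eqP].
    - transitivity (c0).
        by rewrite /nweyl /c0 /nscal /nric !nE ?wE; field.
      by rewrite h0; ring.
    - transitivity (- (c2 / 6) - bi o1 o2 o3 o4 / 12 + bi o2 o1 o3 o4 / 12 - bi o3 o1
        o2 o4 / 12 + bi o4 o1 o2 o3 / 12).
        by rewrite /nweyl /c2 /bi /nscal /nric !nE ?wE; field.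
      by rewrite !bi0 h2; ring.
    - transitivity (c1 / 2).
        by rewrite /nweyl /c1 /nscal /nric !nE ?wE; field.
      by rewrite h1; ring.
  have s34 : sd_part o3 o4.
    split; [| |apply/eqP; rewrite -subr_eq0; apply/eqP].
    - transitivity (- (c1 / 4) - bi o2 o1 o2 o4 / 4 + bi o4 o2 o3 o4 / 4).
        by rewrite /nweyl /c1 /bi /nscal /nric !nE ?wE; field.
      by rewrite !bi0 h1; ring.
    - transitivity (c3 / 4 - bi o1 o1 o2 o3 / 4 + bi o3 o1 o3 o4 / 4).
        by rewrite /nweyl /c3 /bi /nscal /nric !nE ?wE; field.
      by rewrite !bi0 h3; ring.
    - transitivity (- (c2 / 3) - bi o1 o2 o3 o4 / 6 + bi o2 o1 o3 o4 / 6 + bi o3 o1 o2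
        o4 / 3 - bi o4 o1 o2 o3 / 3).
        by rewrite /nweyl /c2 /bi /nscal /nric !nE ?wE; field.
      by rewrite !bi0 h2; ring.
  have diag i : sd_part i i.
    have d k l : nweyl i i k l = 0.
      have /eqP := nweyl_anti i i k l; rewrite -addr_eq0 -mulr2n mulrn_eq0 /=.
      by move/eqP.
    by split; rewrite !d.
  have swap i j : sd_part i j -> sd_part j i.
    by move=> [p q s]; split; rewrite !(nweyl_anti j i) ?p ?q ?s ?oppr0.
  by apply: ord4_ind; apply: ord4_ind => //; apply: swap.
have [p0 _ _] := H o4 o2; have [_ p4 _] := H o1 o3.
have [_ p2 p1] := H o4 o2; have [q2 _ q3] := H o1 o3.
have [u1 u3 u2] := H o2 o1; have [v1 v3 v2] := H o3 o4.
have w4224 : c0 = - nweyl o4 o2 o2 o4.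
  by rewrite /nweyl /c0 /nscal /nric !nE ?wE; field.
have w1 : c1 = nweyl o4 o2 o3 o4 - nweyl o4 o2 o1 o2
    - nweyl o2 o1 o2 o4 - nweyl o3 o4 o2 o4.
  by rewrite /nweyl /c1 /nscal /nric !nE ?wE; field.
have w2 : c2 = nweyl o4 o2 o1 o3 - nweyl o1 o3 o2 o4
    + (nweyl o2 o1 o3 o4 - nweyl o2 o1 o1 o2)
    + (nweyl o3 o4 o3 o4 - nweyl o3 o4 o1 o2).
  by rewrite /nweyl /c2 /nscal /nric !nE ?wE; field.
have w3 : c3 = nweyl o1 o3 o3 o4 - nweyl o1 o3 o1 o2
    + nweyl o2 o1 o1 o3 + nweyl o3 o4 o1 o3.
  by rewrite /nweyl /c3 /nscal /nric !nE ?wE; field.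
have w4 : c4 = nweyl o1 o3 o1 o3.
  by rewrite /nweyl /c4 /nscal /nric !nE ?wE; field.
rewrite E w4224 w1 w2 w3 w4 p0 p4 p1 p2 q2 q3 u1 u2 u3 v1 v2 v3; ring.
Qed.

End SelfDualWeyl.
End CurvatureAlgebra.

(** * The Weyl connection and its curvature in a null cotetrad *)

Section NullFrame.
Variable R : realType.
Local Notation C := R[i].
Local Notation h := (null_metric C).

Definition null_cometric : 'M[C]_4 := \matrix_(i, j) nth 0 (nth [::]
  [:: [:: 0; 2; 0; 0]; [:: 2; 0; 0; 0]; [:: 0; 0; 0; - 2]; [:: 0; 0; - 2; 0]] i) j.

Lemma null_metricE i j : h i j = nth 0 (nth [::]
  [:: [:: 0; 2^-1; 0; 0]; [:: 2^-1; 0; 0; 0];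
      [:: 0; 0; 0; - 2^-1]; [:: 0; 0; - 2^-1; 0]] i) j.
Proof. by rewrite mxE. Qed.

Lemma null_metricK : h *m null_cometric = 1%:M.
Proof.
apply/matrixP; apply: ord4_ind; apply: ord4_ind;
  rewrite mxM_entry sum_ord4 !mxE /=; by field.
Qed.

Lemma null_metric_tr : h^T = h.
Proof. by apply/matrixP; apply: ord4_ind; apply: ord4_ind; rewrite !mxE. Qed.

Lemma null_metric_unit : h \in unitmx.
Proof. by have [] := mulmx1_unit null_metricK. Qed.

Lemma invmx_null_metric : invmx h = null_cometric.
Proof.
by rewrite -[LHS]mulmx1 -null_metricK mulKmx // null_metric_unit.
Qed.

Lemma null_mul1 (M : 'M[C]_4) j : (h *m M) o1 j = 2^-1 * M o2 j.
Proof. by rewrite mxM_entry sum_ord4 !mxE /= !mul0r !addr0 add0r. Qed.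
Lemma null_mul2 (M : 'M[C]_4) j : (h *m M) o2 j = 2^-1 * M o1 j.
Proof. by rewrite mxM_entry sum_ord4 !mxE /= !mul0r !addr0. Qed.
Lemma null_mul3 (M : 'M[C]_4) j : (h *m M) o3 j = - (2^-1 * M o4 j).
Proof. by rewrite mxM_entry sum_ord4 !mxE /= !mul0r !add0r mulNr. Qed.
Lemma null_mul4 (M : 'M[C]_4) j : (h *m M) o4 j = - (2^-1 * M o3 j).
Proof. by rewrite mxM_entry sum_ord4 !mxE /= !mul0r !add0r addr0 mulNr. Qed.
Definition null_mulE := (null_mul1, null_mul2, null_mul3, null_mul4).

Section Local.
Variables (U : set 'rV[R]_4) (g : 'rV[R]_4 -> 'M[C]_4) (A : dform R 4 1)
  (theta : 'I_4 -> dform R 4 1) (Gamma : 'I_4 -> 'I_4 -> dform R 4 1).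
Hypotheses (oU : open U) (cth : coframe U theta)
  (hN : forall x, U x -> frame_metric g theta x = h)
  (wG : weyl_connection U g A theta Gamma).
Implicit Types (x : 'rV[R]_4) (a b : 'I_4) (z : C).

Let sG a : msmooth U (conn_mx Gamma a).
Proof. by have [s _ _] := (weyl_connectionP _ _ _ _ _).1 wG; exact: s. Qed.

Lemma null_connection x a : U x ->
  h *m conn_mx Gamma a x + (h *m conn_mx Gamma a x)^T = A x (fun=> a) *: h.
Proof.
move=> Ux; have [_ m _] := (weyl_connectionP _ _ _ _ _).1 wG.
have := m x a Ux; rewrite (mderive_ext a oU Ux hN) mderive_cst hN //.
by rewrite sub0r -opprD scaleNr => /oppr_inj.
Qed.

(** The metric being constant, the metric equation is linear in the connection. Solving it entry by
    entry leaves six connection forms besides [A]: the (1,1), (4,4), (3,2), (2,3), (3,1) and (4,2)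
    entries. *)
Lemma null_connection_entries x a : U x ->
  let G i j := Gamma i j x (fun=> a) in let c := A x (fun=> a) in
  [/\ [/\ G o2 o1 = 0, G o1 o2 = 0, G o4 o3 = 0 & G o3 o4 = 0],
      G o2 o2 = c - G o1 o1, G o3 o3 = c - G o4 o4 &
      [/\ G o4 o1 = G o2 o3, G o2 o4 = G o3 o1, G o1 o3 = G o4 o2
        & G o1 o4 = G o3 o2]].
Proof.
move=> Ux G c; have /matrixP H := null_connection a Ux.
have E i j : (h *m conn_mx Gamma a x) i j + (h *m conn_mx Gamma a x) j i = c * h i j.
  by have := H i j; rewrite mxD_entry tr_entry mxZ_entry.
have gE i j : conn_mx Gamma a x i j = G i j by rewrite mxE.
have e11 := E o1 o1; have e22 := E o2 o2; have e33 := E o3 o3; have e44 := E o4 o4.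
have e12 := E o1 o2; have e34 := E o3 o4; have e13 := E o1 o3; have e14 := E o1 o4.
have e23 := E o2 o3; have e24 := E o2 o4.
rewrite !null_mulE !gE !null_metricE /= in e11 e22 e33 e44 e12 e34 e13 e14 e23 e24.
split.
- split.
  + have -> : G o2 o1 = 2^-1 * G o2 o1 + 2^-1 * G o2 o1 by field.
    by rewrite e11 mulr0.
  + have -> : G o1 o2 = 2^-1 * G o1 o2 + 2^-1 * G o1 o2 by field.
    by rewrite e22 mulr0.
  + have -> : G o4 o3 = - (- (2^-1 * G o4 o3) - (2^-1 * G o4 o3)) by field.
    by rewrite e33 mulr0 oppr0.
  + have -> : G o3 o4 = - (- (2^-1 * G o3 o4) - (2^-1 * G o3 o4)) by field.
    by rewrite e44 mulr0 oppr0.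
- have -> : G o2 o2 = 2 * (2^-1 * G o2 o2 + 2^-1 * G o1 o1) - G o1 o1 by field.
  by rewrite e12; field.
- have -> : G o3 o3 = - 2 * (- (2^-1 * G o4 o4) - 2^-1 * G o3 o3) - G o4 o4 by field.
  by rewrite e34; field.
- split.
  + have -> : G o4 o1 = G o2 o3 - 2 * (2^-1 * G o2 o3 - 2^-1 * G o4 o1) by field.
    by rewrite e13; ring.
  + have -> : G o2 o4 = G o3 o1 + 2 * (2^-1 * G o2 o4 - 2^-1 * G o3 o1) by field.
    by rewrite e14; ring.
  + have -> : G o1 o3 = G o4 o2 + 2 * (2^-1 * G o1 o3 - 2^-1 * G o4 o2) by field.
    by rewrite e23; ring.
  + have -> : G o1 o4 = G o3 o2 + 2 * (2^-1 * G o1 o4 - 2^-1 * G o3 o2) by field.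
    by rewrite e24; ring.
Qed.

Let sGij i j a : csmooth U (fun x => Gamma i j x (fun=> a)).
Proof. by have [s _ _] := wG; exact: s. Qed.

(** The map sending a matrix G to the quadratic vector field - G32 + z (G11 - G44) + z^2 G23 on the
    line of [z] respects brackets on the matrices described by [null_connection_entries]. Hence the
    bracket term of [spin_curvature] is the image of the matrix commutator in the curvature. *)
Lemma spin_curvature_curv z x a b : U x ->
  spin_curvature Gamma z x a b =
  - curv_mx Gamma a b x o3 o2
  + z * (curv_mx Gamma a b x o1 o1 - curv_mx Gamma a b x o4 o4)
  + z ^+ 2 * curv_mx Gamma a b x o2 o3.
Proof.
move=> Ux; pose G i j c := Gamma i j x (fun=> c).
pose D c i j d := pderive c (fun y => Gamma i j y (fun=> d)) x.
have dS c d : pderive c (spin_form Gamma z d) x =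
    - D c o3 o2 d + z * (D c o1 o1 d - D c o4 o4 d) + z ^+ 2 * D c o2 o3 d.
  have [sGf _ _] := wG.
  have dG i j : cderivable c (fun y => Gamma i j y (fun=> d)) x.
    exact: csmooth_cderivable (sGij i j d) Ux.
  rewrite (pderive_spin_form oU sGf) // (pderiveN (dG _ _)).
  by rewrite (pderiveD (dG _ _) (cderivableN (dG _ _))) (pderiveN (dG _ _)).
have cE i j : curv_mx Gamma a b x i j = D a i j b - D b i j a +
    (\sum_k G i k a * G k j b - \sum_k G i k b * G k j a).
  have dE c d : mderive c (conn_mx Gamma d) x i j = D c i j d.
    by rewrite mderiveE; apply: eq_pderive => y; rewrite mxE.
  rewrite /curv_mx !(mxD_entry, mxN_entry) !dE !mxM_entry.
  by congr (_ + (_ - _)); apply: eq_bigr => k _; rewrite !mxE.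
rewrite !cE !sum_ord4 mxE !dS /spin_form /spin_form'.
have [[a21 a12 a43 a34] a22 a33 [a41 a24 a13 a14]] := null_connection_entries a Ux.
have [[b21 b12 b43 b34] b22 b33 [b41 b24 b13 b14]] := null_connection_entries b Ux.
rewrite /G a21 a12 a43 a34 a22 a33 a41 a24 a13 a14.
rewrite b21 b12 b43 b34 b22 b33 b41 b24 b13 b14.
move: (D a o3 o2 b) (D b o3 o2 a) (D a o1 o1 b) (D b o1 o1 a).
move: (D a o4 o4 b) (D b o4 o4 a) (D a o2 o3 b) (D b o2 o3 a).
move: (A x _) (A x _).
move: (Gamma o1 o1 x (fun=> a)) (Gamma o4 o4 x (fun=> a)) (Gamma o3 o2 x (fun=> a)).
move: (Gamma o2 o3 x (fun=> a)) (Gamma o3 o1 x (fun=> a)) (Gamma o4 o2 x (fun=> a)).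
move: (Gamma o1 o1 x (fun=> b)) (Gamma o4 o4 x (fun=> b)) (Gamma o3 o2 x (fun=> b)).
move: (Gamma o2 o3 x (fun=> b)) (Gamma o3 o1 x (fun=> b)) (Gamma o4 o2 x (fun=> b)).
by clear; move: z => *; ring.
Qed.

Definition null_riemann x i j k l : C := (h *m frame_curv theta Gamma k l x) i j.

(** The factor 2 compensates the entries 1/2 and - 1/2 of [null_metric] that lower the first index
    in [null_riemann]. *)
Lemma frame_spin_curvatureE z x k l : U x ->
  frame_spin_curvature theta Gamma z x k l = 2 * sd_curv (null_riemann x) z k l.
Proof.
move=> Ux; pose e := dual_frame theta x.
transitivity (\sum_a \sum_b (e a k * e b l) * spin_curvature Gamma z x a b).
  rewrite /frame_spin_curvature mxM_entry exchange_big; apply: eq_bigr => b _ /=.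
  rewrite mxM_entry mulr_suml; apply: eq_bigr => a _.
  by rewrite tr_entry mulrAC.
have fE i j : frame_curv theta Gamma k l x i j =
    \sum_a \sum_b (e a k * e b l) * curv_mx Gamma a b x i j.
  rewrite /frame_curv summxE; apply: eq_bigr => a _; rewrite summxE.
  by apply: eq_bigr => b _; rewrite mxZ_entry.
rewrite /sd_curv /null_riemann !null_mulE !fE.
transitivity (- (\sum_a \sum_b (e a k * e b l) * curv_mx Gamma a b x o3 o2)
  + z * (\sum_a \sum_b (e a k * e b l) * curv_mx Gamma a b x o1 o1
         - \sum_a \sum_b (e a k * e b l) * curv_mx Gamma a b x o4 o4)
  + z ^+ 2 * \sum_a \sum_b (e a k * e b l) * curv_mx Gamma a b x o2 o3); last first.
  move: (\sum_a _) (\sum_a _) (\sum_a _) (\sum_a _) => p q r s; by field.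
rewrite -sumrN -sumrB !mulr_sumr -!big_split; apply: eq_bigr => a _ /=.
rewrite -sumrN -sumrB !mulr_sumr -!big_split; apply: eq_bigr => b _ /=.
rewrite spin_curvature_curv //.
move: (e a k * e b l) (curv_mx _ _ _ _ _ _) (curv_mx _ _ _ _ _ _).
move: (curv_mx _ _ _ _ _ _) (curv_mx _ _ _ _ _ _) => p q r s t; ring.
Qed.

Lemma null_riemann_anti x i j k l : null_riemann x i j k l = - null_riemann x i j l k.
Proof. by rewrite /null_riemann frame_curv_anti mulmxN mxN_entry. Qed.

Definition frame_faraday x k l : C := \sum_a \sum_b dual_frame theta x a k *
  dual_frame theta x b l * ext_d A x (fun r : 'I_2 => if r == ord0 then a else b).

Lemma null_riemann_sym (sA : smooth_form U A) x i j k l : U x ->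
  null_riemann x i j k l + null_riemann x j i k l = frame_faraday x k l * h i j.
Proof.
move=> Ux; have /matrixP/(_ i j) := metric_frame_curv theta oU sA sG null_metric_tr
  (fun x a (Ux : U x) => null_connection a Ux) k l Ux.
by rewrite mxD_entry tr_entry mxZ_entry.
Qed.

Lemma null_riemann_bianchi x i j k l : U x ->
  null_riemann x i j k l + null_riemann x i k l j + null_riemann x i l j k = 0.
Proof.
move=> Ux; have [_ _ t] := (weyl_connectionP _ _ _ _ _).1 wG.
rewrite /null_riemann !mxM_entry -!big_split big1 // => m _ /=.
by rewrite -!mulrDr (bianchi oU cth sG t) // mulr0.
Qed.

Lemma ricci_null x j l : U x ->
  ricci g theta Gamma j l x = nric (null_riemann x) j l.
Proof.
move=> Ux; rewrite ricciE ?hN ?null_metric_tr ?null_metric_unit // mxE sum_ord4.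
rewrite /nric /null_riemann !null_mulE.
by move: (frame_curv _ _ _ _ _ _ _) (frame_curv _ _ _ _ _ _ _)
  (frame_curv _ _ _ _ _ _ _) (frame_curv _ _ _ _ _ _ _) => p q r s; field.
Qed.

Lemma scalar_curvature_null x : U x ->
  scalar_curvature g theta Gamma x = nscal (null_riemann x).
Proof.
move=> Ux; rewrite /scalar_curvature !sum_ord4 /frame_cometric hN //.
rewrite invmx_null_metric !ricci_null // !mxE /= /nscal.
move: (nric _) => r; ring.
Qed.

Lemma weyl_tensor_null x i j k l : U x ->
  weyl_tensor g theta Gamma i j k l x = nweyl (null_riemann x) i j k l.
Proof.
move=> Ux; rewrite /weyl_tensor /nweyl scalar_curvature_null // !ricci_null // hN //.
by rewrite riemannE hN.
Qed.

Lemma sym_ricci0_null x i j : U x ->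
  sym_ricci0 g theta Gamma i j x = nsric0 (null_riemann x) i j.
Proof.
move=> Ux; rewrite /sym_ricci0 /nsric0 scalar_curvature_null // !ricci_null // hN //.
by rewrite [_^-1 * _]mulrC [nscal _ / 4 * _]mulrAC.
Qed.

End Local.
End NullFrame.

(** * Anti-self-dual 2-forms in components *)

Section AsdForms.
Variable R : realType.
Local Notation C := R[i].
Variables (U : set 'rV[R]_4) (g : 'rV[R]_4 -> 'M[C]_4)
  (theta : 'I_4 -> dform R 4 1) (Gamma : 'I_4 -> 'I_4 -> dform R 4 1).
Hypotheses (cth : coframe U theta)
  (hN : forall x, U x -> frame_metric g theta x = null_metric C).
Local Notation T := (coframe_mx theta).

Lemma asd_2formP x i j : U x ->
  asd_2form theta (weyl_2form g theta Gamma i j) x <->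
  sd_part (null_riemann theta Gamma x) i j.
Proof.
move=> Ux; pose W : 'M[C]_4 := \matrix_(k, l) nweyl (null_riemann theta Gamma x) i j k l.
(* The component matrix of r M /\ K + s (N /\ K + M /\ P) + t N /\ P. *)
pose S (r s t : C) : 'M[C]_4 := \matrix_(k, l) nth 0 (nth [::]
  [:: [:: 0; s; 0; r]; [:: - s; 0; - t; 0]; [:: 0; t; 0; s]; [:: - r; 0; - s; 0]] k) l.
have WE k l : W k l = nweyl (null_riemann theta Gamma x) i j k l by rewrite mxE.
have Wa k l : W k l = - W l k.
  by rewrite !WE; apply: nweyl_antikl => *; exact: null_riemann_anti.
have uT : T x \in unitmx by have [_] := cth; exact.
have tE k v : theta k x (fun=> v) = T x k v by rewrite mxE.
have LE (v : 'I_2 -> 'I_4) : weyl_2form g theta Gamma i j x v =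
    ((T x)^T *m W *m T x) (v ord0) (v ord_max).
  rewrite /weyl_2form dform_sumE.
  transitivity (\sum_k \sum_l (W k l / 2 * (T x k (v ord0) * T x l (v ord_max)) -
      W k l / 2 * (T x k (v ord_max) * T x l (v ord0)))).
    apply: eq_bigr => k _; rewrite dform_sumE; apply: eq_bigr => l _.
    rewrite -[LHS]/(weyl_tensor g theta Gamma i j k l x / 2 * (wedge (theta k) (theta l) x v)).
    by rewrite (weyl_tensor_null Gamma hN) // -WE wedge11E !tE mulrBr.
  rewrite (eq_bigr _ (fun k _ => sumrB _ _ _ _)) sumrB.
  pose Q := \sum_k \sum_l W k l / 2 * (T x k (v ord0) * T x l (v ord_max)).
  (* Antisymmetry of [W] makes both halves of the product equal, which cancels the 1/2 in the
     definition of w_ij. *)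
  transitivity (Q + Q).
    congr (_ + _); rewrite /Q exchange_big -sumrN; apply: eq_bigr => k _.
    rewrite -sumrN; apply: eq_bigr => l _; rewrite Wa mulNr mulNr opprK.
    by rewrite [T x l _ * _]mulrC.
  rewrite /Q -big_split mxM_entry.
  transitivity (\sum_j \sum_k W k j * (T x k (v ord0) * T x j (v ord_max))); last first.
    apply: eq_bigr => l _; rewrite mxM_entry mulr_suml; apply: eq_bigr => k _.
    by rewrite tr_entry [T x k _ * W k l]mulrC mulrA.
  rewrite [RHS]exchange_big; apply: eq_bigr => k _; rewrite -big_split.
  by apply: eq_bigr => l _ /=; rewrite -mulrDl -splitr.
have RE r s t (v : 'I_2 -> 'I_4) :
    r * (theta o1 \wedge theta o4)%DF x v
    + s * (theta o3 \wedge theta o4 + theta o1 \wedge theta o2)%DF x v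
    + t * (theta o3 \wedge theta o2)%DF x v =
    ((T x)^T *m S r s t *m T x) (v ord0) (v ord_max).
  rewrite -[(_ + _)%DF x v]/((theta o3 \wedge theta o4)%DF x v
    + (theta o1 \wedge theta o2)%DF x v).
  rewrite !wedge11E !tE !(mxM_entry, sum_ord4, tr_entry) ![S _ _ _ _ _]mxE /=.
  move: (T x o1 (v ord0)) (T x o2 (v ord0)) (T x o3 (v ord0)) (T x o4 (v ord0)).
  move: (T x o1 (v ord_max)) (T x o2 (v ord_max)) (T x o3 (v ord_max)) (T x o4 (v ord_max)).
  by move=> *; ring.
have inj (M N : 'M[C]_4) : (forall v : 'I_2 -> 'I_4,
    ((T x)^T *m M *m T x) (v ord0) (v ord_max) =
    ((T x)^T *m N *m T x) (v ord0) (v ord_max)) -> M = N.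
  move=> e; have {}e : (T x)^T *m M *m T x = (T x)^T *m N *m T x.
    apply/matrixP => a b; exact: (e (fun r : 'I_2 => if r == ord0 then a else b)).
  have := f_equal (mulmx^~ (invmx (T x))) e; rewrite !mulmxK //.
  by move/(f_equal (mulmx (invmx (T x)^T))); rewrite !mulKmx ?unitmx_tr.
split=> [[r [s [t H]]]|[w24 w13 w12]].
  have {}H : W = S r s t by apply: inj => v; rewrite -LE -RE.
  by split; rewrite -!WE H !mxE.
suff WS : W = S (W o1 o4) (W o1 o2) (W o3 o2).
  by exists (W o1 o4), (W o1 o2), (W o3 o2) => v; rewrite LE RE -WS.
have d k : W k k = 0.
  have /eqP := Wa k k; rewrite -addr_eq0 -mulr2n mulrn_eq0 /= => /eqP //.
rewrite -!WE in w24 w13 w12.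
apply/matrixP; apply: ord4_ind; apply: ord4_ind; rewrite [RHS]mxE /= ?d //.
all: rewrite ?w24 ?w13 ?w12 // Wa ?w24 ?w13 ?w12 ?oppr0 //.
Qed.

End AsdForms.

(** * Change of the Weyl form *)

Lemma colD_mx (F : comNzRingType) m n (M N : 'M[F]_(m, n)) j :
  col j (M + N) = col j M + col j N.
Proof. by apply/matrixP => i k; rewrite !mxE. Qed.

Lemma half_skew_symmetrize (F : numFieldType) n (h M : 'M[F]_n) (c : F) : h^T = h ->
  2^-1 *: (c *: h + M - M^T) + (2^-1 *: (c *: h + M - M^T))^T = c *: h.
Proof.
move=> hs; apply/matrixP => i j; have hij : h j i = h i j by rewrite -[in LHS]hs mxE.
by rewrite !mxE hij; move: (h i j) (M i j) (M j i) => p q r; field.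
Qed.

Lemma lower_shift (F : numFieldType) n (h k : 'M[F]_n) (v : 'cV[F]_n) (f : 'rV[F]_n)
    (c : F) : h *m k = 1%:M -> h^T = h ->
  h *m ((2^-1)%:M *m (c%:M + v *m f - k *m (f^T *m v^T) *m h)) =
  2^-1 *: (c *: h + h *m (v *m f) - (h *m (v *m f))^T).
Proof.
move=> hk hs; rewrite mul_scalar_mx -scalemxAr mulmxBr mulmxDr mul_mx_scalar.
by rewrite !mulmxA hk mul1mx !trmx_mul hs !mulmxA.
Qed.

Lemma shift_mulmx (F : comNzRingType) n (h k : 'M[F]_n) (v w : 'cV[F]_n)
    (f : 'rV[F]_n) (c d : F) : f *m w = d%:M ->
  (c%:M + v *m f - k *m (f^T *m v^T) *m h) *m w =
  c *: w + d *: v - k *m (f^T *m (v^T *m h *m w)).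
Proof.
move=> fw; rewrite mulmxBl mulmxDl mul_scalar_mx -(mulmxA v) fw mul_mx_scalar.
by rewrite !mulmxA.
Qed.

Lemma symmetric_formC (F : comNzRingType) n (h : 'M[F]_n) (v w : 'cV[F]_n) :
  h^T = h -> v^T *m h *m w = w^T *m h *m v.
Proof.
move=> hs; transitivity (v^T *m h *m w)^T.
  by apply/matrixP => i j; rewrite (ord1 i) (ord1 j) [RHS]mxE.
by rewrite trmx_mul trmx_mul trmxK hs mulmxA.
Qed.

Section ChangeOfWeylForm.
Variable R : realType.
Local Notation C := R[i].
Local Notation h := (null_metric C).
Variables (U : set 'rV[R]_4) (g : 'rV[R]_4 -> 'M[C]_4) (A B : dform R 4 1)
  (theta : 'I_4 -> dform R 4 1) (Gamma : 'I_4 -> 'I_4 -> dform R 4 1).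
Hypotheses (oU : open U) (cth : coframe U theta)
  (hN : forall x, U x -> frame_metric g theta x = h)
  (wG : weyl_connection U g A theta Gamma)
  (sA : smooth_form U A) (sB : smooth_form U B).
Implicit Types (x : 'rV[R]_4) (a b i j k : 'I_4) (z : C).
Local Notation T := (coframe_mx theta).
Local Notation e := (dual_frame theta).

Definition form_diff a x : C := B x (fun=> a) - A x (fun=> a).

Definition frame_diff x : 'rV[C]_4 := (\row_a form_diff a x) *m e x.

(** With beta = B - A this is (beta delta^i_j + theta^i beta_j - beta^i theta_j) / 2. The first term
    changes the right-hand side of the metric equation by beta g; the other two form a part skew for
    g, chosen so that the whole is symmetric in its lower indices and the torsion stays zero. *)
Definition shift_mx a x : 'M[C]_4 := (2^-1)%:M *m
  ((form_diff a x)%:M + col a (T x) *m frame_diff x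
   - null_cometric R *m ((frame_diff x)^T *m (col a (T x))^T) *m h).

(* The Weyl connection forms of [g] and [B], from those of [g] and [A]. *)
Definition shift_conn : 'I_4 -> 'I_4 -> dform R 4 1 :=
  fun i j x v => Gamma i j x v + shift_mx (v ord0) x i j.

Lemma conn_shift a x : conn_mx shift_conn a x = conn_mx Gamma a x + shift_mx a x.
Proof. by apply/matrixP => i j; rewrite !mxD_entry ![conn_mx _ _ _ _ _]mxE. Qed.

Let sT : msmooth U T. Proof. by have [] := (coframeP U theta).1 cth. Qed.

Let uT x : U x -> T x \in unitmx.
Proof. by have [_] := (coframeP U theta).1 cth; exact. Qed.

Let se : msmooth U e. Proof. exact: msmooth_invmx. Qed.

Let sdiff a : csmooth U (form_diff a).
Proof. exact: csmooth_add oU (sB _) (csmooth_opp oU (sA _)). Qed.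

Lemma msmooth_frame_diff : msmooth U frame_diff.
Proof.
apply: msmooth_mul => // i a; apply: csmooth_ext (sdiff a) => // x _.
by rewrite mxE.
Qed.

Let scol a : msmooth U (fun x => col a (T x)).
Proof. by move=> i j; apply: (csmooth_ext oU _ (sT i a)) => x _; rewrite col_entry. Qed.

Lemma msmooth_shift a : msmooth U (shift_mx a).
Proof.
apply: msmooth_mul => //; first exact: msmooth_cst.
apply: msmooth_add => //; first apply: msmooth_add => //.
- move=> i j; apply: csmooth_ext (csmooth_mul oU (sdiff a)
    (csmooth_cst U ((i == j)%:R : C))) => // x _.
  by rewrite [RHS]mxE mulr_natr.
- exact: msmooth_mul oU (scol a) msmooth_frame_diff.
- apply: msmooth_opp => //; apply: msmooth_mul => //; last exact: msmooth_cst.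
  apply: msmooth_mul => //; first exact: msmooth_cst.
  exact: msmooth_mul oU (msmooth_tr oU msmooth_frame_diff) (msmooth_tr oU (scol a)).
Qed.

Lemma frame_diff_col a x : U x -> frame_diff x *m col a (T x) = (form_diff a x)%:M.
Proof.
move=> Ux; rewrite /frame_diff -col_mulmx -mulmxA mulVmx ?uT // mulmx1.
by apply/matrixP => i j; rewrite (ord1 i) (ord1 j) !mxE.
Qed.

Lemma shift_weyl_connection : weyl_connection U g B theta shift_conn.
Proof.
have [sG m t] := (weyl_connectionP _ _ _ _ _).1 wG.
apply/weyl_connectionP; split.
- move=> a; apply: (msmooth_ext oU (fun x _ => esym (conn_shift a x))).
  exact: msmooth_add oU (sG a) (msmooth_shift a).
- move=> x a Ux; rewrite conn_shift (mderive_ext a oU Ux hN) mderive_cst hN //.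
  have c := null_connection oU hN wG a Ux.
  rewrite mulmxDr trD_mx sub0r -opprD addrACA c scaleNr; congr (- _).
  have -> : h *m shift_mx a x = 2^-1 *: (form_diff a x *: h
      + h *m (col a (T x) *m frame_diff x) - (h *m (col a (T x) *m frame_diff x))^T).
    by apply: lower_shift; [exact: null_metricK|exact: null_metric_tr].
  by rewrite (half_skew_symmetrize _ _ (null_metric_tr R)) -scalerDl addrC subrK.
- move=> x a b Ux.
  have E c d : col d (mderive c T x + conn_mx shift_conn c x *m T x) =
      col d (mderive c T x + conn_mx Gamma c x *m T x) + col d (shift_mx c x *m T x).
    by rewrite conn_shift mulmxDl addrA colD_mx.
  apply: etrans (E a b) (etrans _ (esym (E b a))); apply: (f_equal2 +%R (t x a b Ux)).
  (* On the frame the correction reads beta_c t_d + beta_d t_c - beta^# g(t_c, t_d), up to the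
     factor 1/2, which is symmetric in [c] and [d]. *)
  have S c d : col d (shift_mx c x *m T x) = (2^-1)%:M *m
      (form_diff c x *: col d (T x) + form_diff d x *: col c (T x)
       - null_cometric R *m ((frame_diff x)^T *m ((col c (T x))^T *m h *m col d (T x)))).
    rewrite col_mulmx /shift_mx -(mulmxA (2^-1)%:M); congr (_ *m _).
    exact: shift_mulmx (frame_diff_col d Ux).
  have hs := symmetric_formC (col a (T x)) (col b (T x)) (null_metric_tr R).
  apply: etrans (S a b) (etrans _ (esym (S b a))).
  by rewrite hs [X in X - _]addrC.
Qed.

End ChangeOfWeylForm.

Section Contraction.
Variable F : comNzRingType.
Implicit Types (X Y u v : 'I_4 -> F) (M : 'I_4 -> 'I_4 -> F).

Definition pairing X u : F := \sum_a X a * u a.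

Definition contract X Y M : F := \sum_a \sum_b X a * Y b * M a b.

Definition alt2 u v a b : F := u a * v b - u b * v a.

Lemma contract_ext X Y M M' : (forall a b, M a b = M' a b) ->
  contract X Y M = contract X Y M'.
Proof. by move=> e; apply: eq_bigr => a _; apply: eq_bigr => b _; rewrite e. Qed.

Lemma contract_alt2 X Y M c u v :
  contract X Y (fun a b => M a b + c * alt2 u v a b) =
  contract X Y M + c * (pairing X u * pairing Y v - pairing Y u * pairing X v).
Proof.
rewrite /contract.
have -> : c * (pairing X u * pairing Y v - pairing Y u * pairing X v) =
    \sum_a \sum_b X a * Y b * (c * alt2 u v a b).
  rewrite (mulrC (pairing Y u)) /pairing !mulr_suml -sumrB mulr_sumr.
  apply: eq_bigr => a _; rewrite !mulr_sumr -sumrB mulr_sumr.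
  by apply: eq_bigr => b _; rewrite /alt2; move: (X a) (Y b) (u a) (u b) (v a) (v b) => *; ring.
rewrite -big_split; apply: eq_bigr => a _; rewrite -big_split.
by apply: eq_bigr => b _; rewrite mulrDr.
Qed.

Lemma pairingD X u v : pairing X (fun a => u a + v a) = pairing X u + pairing X v.
Proof. by rewrite /pairing -big_split; apply: eq_bigr => a _; rewrite mulrDr. Qed.

Lemma pairingZ X c u : pairing X (fun a => c * u a) = c * pairing X u.
Proof. by rewrite /pairing mulr_sumr; apply: eq_bigr => a _; rewrite mulrCA. Qed.

(** Both sides are the value of [Q] on zm - k and zn - p. On the right these vectors have coordinate
    components, in which the exterior derivatives are computed. *)
Lemma contract_congr (e Q : 'M[F]_4) (z : F) :
  let Q' := e^T *m Q *m e in
  z ^+ 2 * Q' o1 o3 - z * Q' o1 o2 - z * Q' o4 o3 + Q' o4 o2 =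
  contract (fun a => z * e a o1 - e a o4) (fun b => z * e b o3 - e b o2) Q.
Proof.
move=> Q'; have E i j : Q' i j = \sum_a \sum_b e a i * e b j * Q a b.
  rewrite /Q' mxM_entry exchange_big; apply: eq_bigr => b _ /=.
  rewrite mxM_entry mulr_suml; apply: eq_bigr => a _.
  by rewrite tr_entry mulrAC.
rewrite !E /contract !mulr_sumr -!sumrB -big_split; apply: eq_bigr => a _ /=.
rewrite !mulr_sumr -!sumrB -big_split; apply: eq_bigr => b _ /=.
by move: (Q a b) (e a o1) (e a o4) (e b o3) (e b o2) => *; ring.
Qed.

End Contraction.

(** * Invariance of the self-dual equation under a change of the Weyl form *)

Section SpinInvariance.
Variable R : realType.
Local Notation C := R[i].
Local Notation h := (null_metric C).
Variables (U : set 'rV[R]_4) (g : 'rV[R]_4 -> 'M[C]_4) (A B : dform R 4 1)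
  (theta : 'I_4 -> dform R 4 1) (Gamma : 'I_4 -> 'I_4 -> dform R 4 1).
Hypotheses (oU : open U) (cth : coframe U theta)
  (hN : forall x, U x -> frame_metric g theta x = h)
  (wG : weyl_connection U g A theta Gamma)
  (sA : smooth_form U A) (sB : smooth_form U B).
Implicit Types (x : 'rV[R]_4) (a b i j k : 'I_4) (z : C).
Local Notation T := (coframe_mx theta).
Local Notation Gamma' := (shift_conn A B theta Gamma).

Lemma raise_lower_entries (M : 'M[C]_4) : let N := null_cometric R *m M *m h in
  [/\ N o3 o2 = - M o4 o1, N o2 o3 = - M o1 o4, N o1 o1 = M o2 o2 & N o4 o4 = M o3 o3].
Proof.
move=> N; split; rewrite /N !(mxM_entry, sum_ord4) !null_metricE !mxE /=;
  move: (M o1 o1) (M o1 o2) (M o1 o3) (M o1 o4) (M o2 o1) (M o2 o2) (M o2 o3) (M o2 o4);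
  move: (M o3 o1) (M o3 o2) (M o3 o3) (M o3 o4) (M o4 o1) (M o4 o2) (M o4 o3) (M o4 o4);
  by move=> *; field.
Qed.

Local Notation fd j x := (frame_diff A B theta x 0 j).

Lemma shift_entries a x : let s := shift_mx A B theta a x in
  let d := form_diff A B a x in
  [/\ s o3 o2 = 2^-1 * (T x o3 a * fd o2 x + fd o4 x * T x o1 a),
      s o2 o3 = 2^-1 * (T x o2 a * fd o3 x + fd o1 x * T x o4 a),
      s o1 o1 = 2^-1 * (d + T x o1 a * fd o1 x - fd o2 x * T x o2 a)
    & s o4 o4 = 2^-1 * (d + T x o4 a * fd o4 x - fd o3 x * T x o3 a)].
Proof.
move=> s d; have [e32 e23 e11 e44] := raise_lower_entries
  ((frame_diff A B theta x)^T *m (col a (T x))^T).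
have mE i j : ((frame_diff A B theta x)^T *m (col a (T x))^T) i j = fd i x * T x j a.
  by rewrite mxM_entry big_ord1 !tr_entry col_entry.
have vE i j : (col a (T x) *m frame_diff A B theta x) i j = T x i a * fd j x.
  by rewrite mxM_entry big_ord1 col_entry.
have dE i j : (d%:M : 'M[C]_4) i j = d *+ (i == j) by rewrite mxE.
have sE i j : s i j = 2^-1 * (d *+ (i == j) + T x i a * fd j x
   - (null_cometric R *m ((frame_diff A B theta x)^T *m (col a (T x))^T) *m h) i j).
  by rewrite /s /shift_mx mul_scalar_mx mxZ_entry mxD_entry mxD_entry mxN_entry vE dE.
by split; rewrite sE ?e32 ?e23 ?e11 ?e44 mE /= ?mulr0n ?mulr1n ?add0r ?opprK.
Qed.

(** [p] and [q] are the values of B - A on zm - k and zn - p, while [F] and [H] are the forms M + zK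
    and N + zP that annihilate both vectors. [eta] is the change of [spin_form], so it vanishes on
    the plane as well, and [eta'] is its derivative in [z]. *)
Let p z x : C := z * fd o1 x - fd o4 x.
Let q z x : C := z * fd o3 x - fd o2 x.
Let F z a x : C := T x o1 a + z * T x o4 a.
Let H z a x : C := T x o3 a + z * T x o2 a.
Let eta z a x : C := 2^-1 * (p z x * F z a x + q z x * H z a x).
Let eta' z a x : C := 2^-1 * (fd o1 x * T x o1 a - fd o2 x * T x o2 a
  - fd o4 x * T x o4 a + fd o3 x * T x o3 a
  + 2 * z * (T x o2 a * fd o3 x + fd o1 x * T x o4 a)).

Lemma spin_form_shift z a x : spin_form Gamma' z a x = spin_form Gamma z a x + eta z a x.
Proof.
have [e32 e23 e11 e44] := shift_entries a x.
rewrite /spin_form /shift_conn /= e32 e23 e11 e44 /eta /p /q /F /H.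
move: (Gamma _ _ _ _) (Gamma _ _ _ _) (Gamma _ _ _ _) (Gamma _ _ _ _) => g1 g2 g3 g4.
move: (fd o1 x) (fd o2 x) (fd o3 x) (fd o4 x) => f1 f2 f3 f4.
move: (T x o1 a) (T x o2 a) (T x o3 a) (T x o4 a) (form_diff A B a x) => t1 t2 t3 t4 d.
by field.
Qed.

Lemma spin_form'_shift z a x :
  spin_form' Gamma' z a x = spin_form' Gamma z a x + eta' z a x.
Proof.
have [e32 e23 e11 e44] := shift_entries a x.
rewrite /spin_form' /shift_conn /= e23 e11 e44 /eta'.
move: (Gamma _ _ _ _) (Gamma _ _ _ _) (Gamma _ _ _ _) => g1 g2 g3.
move: (fd o1 x) (fd o2 x) (fd o3 x) (fd o4 x) => f1 f2 f3 f4.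
move: (T x o1 a) (T x o2 a) (T x o3 a) (T x o4 a) (form_diff A B a x) => t1 t2 t3 t4 d.
by field.
Qed.

Let sT i a : csmooth U (fun x => T x i a).
Proof. by have [+ _] := (coframeP U theta).1 cth; apply. Qed.

Let sfd j : csmooth U (fun x => fd j x).
Proof. exact: msmooth_frame_diff. Qed.

Let sZD z f1 f2 : csmooth U f1 -> csmooth U f2 -> csmooth U (fun x => f1 x + z * f2 x).
Proof. by move=> sf sk; exact: csmooth_add oU sf (csmooth_mul oU (csmooth_cst U z) sk). Qed.

Let sZB z f1 f2 : csmooth U f1 -> csmooth U f2 -> csmooth U (fun x => z * f1 x - f2 x).
Proof.
move=> sf sk; apply: csmooth_add oU _ (csmooth_opp oU sk).
exact: csmooth_mul oU (csmooth_cst U z) sf.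
Qed.

Let sG i j a : csmooth U (fun x => Gamma i j x (fun=> a)).
Proof. by have [s _ _] := wG; exact: s. Qed.

Let sS z b : csmooth U (spin_form Gamma z b).
Proof.
apply: csmooth_add oU _ (csmooth_mul oU (csmooth_cst U (z ^+ 2)) (sG _ _ _)).
exact: sZD (csmooth_opp oU (sG _ _ _)) (csmooth_add oU (sG _ _ _) (csmooth_opp oU (sG _ _ _))).
Qed.

Lemma pderive_spin_form_shift z a b x : U x ->
  pderive a (spin_form Gamma' z b) x = pderive a (spin_form Gamma z b) x
  + 2^-1 * ((pderive a (p z) x * F z b x
             + p z x * (pderive a (fun y => T y o1 b) x + z * pderive a (fun y => T y o4 b) x))
          + (pderive a (q z) x * H z b x
             + q z x * (pderive a (fun y => T y o3 b) x + z * pderive a (fun y => T y o2 b) x))).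
Proof.
move=> Ux; rewrite (eq_pderive _ _ (spin_form_shift z b)).
have dF i j : pderive a (fun y => T y i b + z * T y j b) x =
    pderive a (fun y => T y i b) x + z * pderive a (fun y => T y j b) x.
  have d1 := csmooth_cderivable a (sT i b) Ux.
  have d2 := csmooth_cderivable a (sT j b) Ux.
  rewrite (pderiveD d1 (cderivableM (cderivable_cst a z x) d2)).
  by rewrite (pderiveM (cderivable_cst a z x) d2) pderive_cst mul0r add0r.
have sF : csmooth U (F z b) by exact: sZD (sT _ _) (sT _ _).
have sH : csmooth U (H z b) by exact: sZD (sT _ _) (sT _ _).
have sp : csmooth U (p z) by exact: sZB (sfd _) (sfd _).
have sq : csmooth U (q z) by exact: sZB (sfd _) (sfd _).
have D f (sf : csmooth U f) := csmooth_cderivable a sf Ux.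
have sPF := csmooth_mul oU sp sF; have sQH := csmooth_mul oU sq sH.
have sPQ := csmooth_add oU sPF sQH.
rewrite (pderiveD (D _ (sS z b)) (cderivableM (cderivable_cst a 2^-1 x) (D _ sPQ))).
rewrite (pderiveM (cderivable_cst a 2^-1 x) (D _ sPQ)) pderive_cst mul0r add0r.
rewrite (pderiveD (D _ sPF) (D _ sQH)) (pderiveM (D _ sp) (D _ sF)).
by rewrite (pderiveM (D _ sq) (D _ sH)) (dF o1 o4) (dF o3 o2).
Qed.

Let X z x a : C := z * dual_frame theta x a o1 - dual_frame theta x a o4.
Let Y z x a : C := z * dual_frame theta x a o3 - dual_frame theta x a o2.

Let pairing_frame x i j : U x -> \sum_a dual_frame theta x a j * T x i a = (i == j)%:R.
Proof.
move=> Ux; have uT : T x \in unitmx by have [_] := (coframeP U theta).1 cth; exact.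
have /matrixP/(_ i j) := mulmxV uT; rewrite mxM_entry [RHS]mxE => <-.
by apply: eq_bigr => a _; rewrite mulrC.
Qed.

Let pairing_diff x i j k z : U x -> pairing
   (fun a => z * dual_frame theta x a j - dual_frame theta x a k) (T x i) =
  z * (i == j)%:R - (i == k)%:R.
Proof.
move=> Ux; rewrite -!(pairing_frame i _ Ux) mulr_sumr -sumrB.
by apply: eq_bigr => a _; rewrite mulrBl mulrA.
Qed.

Let torsion x a b i : U x ->
  pderive a (fun y => T y i b) x + \sum_j Gamma i j x (fun=> a) * T x j b =
  pderive b (fun y => T y i a) x + \sum_j Gamma i j x (fun=> b) * T x j a.
Proof.
move=> Ux; have [_ _ t] := (weyl_connectionP _ _ _ _ _).1 wG.
have E c d : col d (mderive c T x + conn_mx Gamma c x *m T x) i 0 =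
  pderive c (fun y => T y i d) x + \sum_j Gamma i j x (fun=> c) * T x j d.
  rewrite col_entry mxD_entry mderiveE mxM_entry; congr (_ + _).
  by apply: eq_bigr => j _; rewrite [conn_mx _ _ _ _ _]mxE.
by rewrite -!E (t x a b Ux).
Qed.

(** On the plane every product with a factor [F], [H] or [eta] vanishes. There remain p dF + q dH,
    halved, and the product of [spin_form] with [eta']. By the torsion equation dF and dH give the
    values of [spin_form] on the two spanning vectors, on which [eta'] is - p / 2 and - q / 2, and
    the two contributions cancel. *)
Lemma self_dual_equation_shift z x : U x ->
  let Q := frame_spin_curvature theta Gamma z x in
  let Q' := frame_spin_curvature theta Gamma' z x in
  z ^+ 2 * Q' o1 o3 - z * Q' o1 o2 - z * Q' o4 o3 + Q' o4 o2 =
  z ^+ 2 * Q o1 o3 - z * Q o1 o2 - z * Q o4 o3 + Q o4 o2.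
Proof.
move=> Ux Q Q'; apply: etrans (contract_congr _ _ _) (etrans _ (esym (contract_congr _ _ _))).
pose s a := spin_form Gamma z a x; pose s' a := spin_form' Gamma z a x.
pose n a := eta z a x; pose n' a := eta' z a x; pose t i a := T x i a.
pose G i j a := Gamma i j x (fun=> a).
pose f a := F z a x; pose k a := H z a x.
have SE a b : spin_curvature Gamma' z x a b = spin_curvature Gamma z x a b
  + 2^-1 * alt2 (fun c => pderive c (p z) x) f a b
  + 2^-1 * alt2 (fun c => pderive c (q z) x) k a b
  + (- 2^-1 * p z x) * alt2 (fun c => G o1 o1 c + z * G o4 o1 c) (t o1) a b
  + (- 2^-1 * p z x) * alt2 (fun c => G o1 o2 c + z * G o4 o2 c) (t o2) a b
  + (- 2^-1 * p z x) * alt2 (fun c => G o1 o3 c + z * G o4 o3 c) (t o3) a b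
  + (- 2^-1 * p z x) * alt2 (fun c => G o1 o4 c + z * G o4 o4 c) (t o4) a b
  + (- 2^-1 * q z x) * alt2 (fun c => G o3 o1 c + z * G o2 o1 c) (t o1) a b
  + (- 2^-1 * q z x) * alt2 (fun c => G o3 o2 c + z * G o2 o2 c) (t o2) a b
  + (- 2^-1 * q z x) * alt2 (fun c => G o3 o3 c + z * G o2 o3 c) (t o3) a b
  + (- 2^-1 * q z x) * alt2 (fun c => G o3 o4 c + z * G o2 o4 c) (t o4) a b
  + (-1) * alt2 s n' a b + (-1) * alt2 n (fun c => s' c + n' c) a b.
  (* The torsion equations, solved for one of the two derivatives, make all derivatives of the
     coframe cancel and leave products of connection forms with the coframe. *)
  have T1 := canRL (addrK _) (torsion a b o1 Ux); have T2 := canRL (addrK _) (torsion a b o2 Ux).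
  have T3 := canRL (addrK _) (torsion a b o3 Ux); have T4 := canRL (addrK _) (torsion a b o4 Ux).
  rewrite [LHS]mxE [spin_curvature Gamma _ _ _ _]mxE !(pderive_spin_form_shift _ _ _ Ux).
  rewrite !spin_form_shift !spin_form'_shift T1 T2 T3 T4 !sum_ord4 /alt2 /n /n' /s /s' /f /k /t /G.
  move: (pderive a (spin_form Gamma z b) x) (pderive b (spin_form Gamma z a) x).
  move: (pderive a (p z) x) (pderive a (q z) x) (pderive b (p z) x) (pderive b (q z) x).
  move: (pderive b _ x) (pderive b _ x) (pderive b _ x) (pderive b _ x).
  move: (spin_form Gamma z a x) (spin_form Gamma z b x).
  move: (spin_form' Gamma z a x) (spin_form' Gamma z b x) (p z x) (q z x).
  move: (F z a x) (F z b x) (H z a x) (H z b x).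
  move: (eta z a x) (eta z b x) (eta' z a x) (eta' z b x).
  move: (T x o1 a) (T x o2 a) (T x o3 a) (T x o4 a).
  move: (T x o1 b) (T x o2 b) (T x o3 b) (T x o4 b).
  move: (Gamma o1 o1 x _) (Gamma o1 o2 x _) (Gamma o1 o3 x _) (Gamma o1 o4 x _).
  move: (Gamma o1 o1 x _) (Gamma o1 o2 x _) (Gamma o1 o3 x _) (Gamma o1 o4 x _).
  move: (Gamma o2 o1 x _) (Gamma o2 o2 x _) (Gamma o2 o3 x _) (Gamma o2 o4 x _).
  move: (Gamma o2 o1 x _) (Gamma o2 o2 x _) (Gamma o2 o3 x _) (Gamma o2 o4 x _).
  move: (Gamma o3 o1 x _) (Gamma o3 o2 x _) (Gamma o3 o3 x _) (Gamma o3 o4 x _).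
  move: (Gamma o3 o1 x _) (Gamma o3 o2 x _) (Gamma o3 o3 x _) (Gamma o3 o4 x _).
  move: (Gamma o4 o1 x _) (Gamma o4 o2 x _) (Gamma o4 o3 x _) (Gamma o4 o4 x _).
  move: (Gamma o4 o1 x _) (Gamma o4 o2 x _) (Gamma o4 o3 x _) (Gamma o4 o4 x _).
  by move: (z) => *; ring.
rewrite -[LHS]/(contract (X z x) (Y z x) (spin_curvature Gamma' z x)).
rewrite -[RHS]/(contract (X z x) (Y z x) (spin_curvature Gamma z x)).
rewrite (contract_ext _ _ SE) !contract_alt2.
have Gz (u : 'I_4 -> C) : (forall a, u a = 0) -> forall V, pairing V u = 0.
  by move=> Z V; rewrite /pairing big1 // => a _; rewrite Z mulr0.
have Ge (u v : 'I_4 -> C) : (forall a, u a = v a) -> forall V, pairing V u = pairing V v.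
  by move=> Z V; apply: eq_bigr => a _; rewrite Z.
have N a := null_connection_entries oU hN wG a Ux.
have g12 := Gz (G o1 o2) (fun a => let: And4 (And4 _ e _ _) _ _ _ := N a in e).
have g43 := Gz (G o4 o3) (fun a => let: And4 (And4 _ _ e _) _ _ _ := N a in e).
have g21 := Gz (G o2 o1) (fun a => let: And4 (And4 e _ _ _) _ _ _ := N a in e).
have g34 := Gz (G o3 o4) (fun a => let: And4 (And4 _ _ _ e) _ _ _ := N a in e).
have g13 := Ge (G o1 o3) (G o4 o2) (fun a => let: And4 _ _ _ (And4 _ _ e _) := N a in e).
have g24 := Ge (G o2 o4) (G o3 o1) (fun a => let: And4 _ _ _ (And4 _ e _ _) := N a in e).
have g14 := Ge (G o1 o4) (G o3 o2) (fun a => let: And4 _ _ _ (And4 _ _ _ e) := N a in e).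
have g41 := Ge (G o4 o1) (G o2 o3) (fun a => let: And4 _ _ _ (And4 e _ _ _) := N a in e).
(* [A] enters both entries in the same way, so their difference is free of it; it is this difference
   that survives the evaluation on the plane. *)
have g2233 V : pairing V (G o2 o2) - pairing V (G o3 o3) =
    pairing V (G o4 o4) - pairing V (G o1 o1).
  rewrite /pairing -!sumrB; apply: eq_bigr => a _.
  have [_ e2 e3 _] := N a; rewrite -!mulrBr; congr (_ * _).
  by rewrite /G e2 e3; move: (A x _) (Gamma o1 o1 x _) (Gamma o4 o4 x _) => *; ring.
have L V u v : pairing V (fun c => u c + z * v c) = pairing V u + z * pairing V v.
  by rewrite pairingD pairingZ.
have pf V : pairing V f = pairing V (t o1) + z * pairing V (t o4) by exact: L.
have pk V : pairing V k = pairing V (t o3) + z * pairing V (t o2) by exact: L.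
have pn V : pairing V n = 2^-1 * (p z x * pairing V f + q z x * pairing V k).
  rewrite /pairing !mulr_sumr -big_split mulr_sumr; apply: eq_bigr => a _ /=.
  by rewrite /f /k /n /eta; move: (F z a x) (H z a x) (p z x) (q z x) (V a) => *; ring.
have pn' V : pairing V n' = 2^-1 * (fd o1 x * pairing V (t o1) - fd o2 x * pairing V (t o2)
  - fd o4 x * pairing V (t o4) + fd o3 x * pairing V (t o3)
  + 2 * z * (pairing V (t o2) * fd o3 x + fd o1 x * pairing V (t o4))).
  rewrite /pairing !sum_ord4 /n' /eta' /t; move: (V o1) (V o2) (V o3) (V o4).
  move: (fd o1 x) (fd o2 x) (fd o3 x) (fd o4 x).
  move: (T x o1 o1) (T x o1 o2) (T x o1 o3) (T x o1 o4).
  move: (T x o2 o1) (T x o2 o2) (T x o2 o3) (T x o2 o4).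
  move: (T x o3 o1) (T x o3 o2) (T x o3 o3) (T x o3 o4).
  move: (T x o4 o1) (T x o4 o2) (T x o4 o3) (T x o4 o4).
  by move: (z) => *; field.
have ps V : pairing V s = - pairing V (G o3 o2)
    + z * (pairing V (G o1 o1) - pairing V (G o4 o4)) + z ^+ 2 * pairing V (G o2 o3).
  rewrite /pairing -sumrN -sumrB !mulr_sumr -!big_split; apply: eq_bigr => a _ /=.
  rewrite /s /spin_form /G.
  by move: (V a) (Gamma _ _ _ _) (Gamma _ _ _ _) (Gamma _ _ _ _) (Gamma _ _ _ _) => *; ring.
have tX i : pairing (X z x) (t i) = z * (i == o1)%:R - (i == o4)%:R by exact: pairing_diff.
have tY i : pairing (Y z x) (t i) = z * (i == o3)%:R - (i == o2)%:R by exact: pairing_diff.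
rewrite !L !pn !pn' !ps !pf !pk !tX !tY /= !g12 !g43 !g21 !g34 !g13 !g24 !g14 !g41.
rewrite (canRL (subrK _) (g2233 (X z x))) /p /q.
move: (contract _ _ _) (pairing _ _) (pairing _ _) (pairing _ _) (pairing _ _).
move: (pairing _ _) (pairing _ _) (pairing _ _) (pairing _ _) (pairing _ _).
move: (pairing _ _) (pairing _ _) (pairing _ _) (pairing _ _) (pairing _ _).
move: (fd o1 x) (fd o2 x) (fd o3 x) (fd o4 x).
by move: (z) => *; field.
Qed.

End SpinInvariance.

(** * Anti-self-duality and the first twistor equation *)

Section NullCotetrad.
Variables (R : realType) (M : oriented_manifold R 4) (G : weyl_geometry M)
  (eta : volume_form G) (c : chart M).
Local Notation C := R[i].
Implicit Types (U : set 'rV[R]_4) (theta : 'I_4 -> dform R 4 1)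
  (Gamma : 'I_4 -> 'I_4 -> dform R 4 1) (x : 'rV[R]_4) (z : C).

Lemma null_metric_congr theta x a b :
  ((coframe_mx theta x)^T *m null_metric C *m coframe_mx theta x) a b =
  sym_prod (theta o1) (theta o2) x a b - sym_prod (theta o3) (theta o4) x a b.
Proof.
rewrite -mulmxA mxM_entry sum_ord4 !null_mulE !tr_entry ![coframe_mx _ _ _ _]mxE.
rewrite /sym_prod; move: (theta o1 x _) (theta o2 x _) (theta o3 x _) (theta o4 x _).
by move: (theta o1 x _) (theta o2 x _) (theta o3 x _) (theta o4 x _) => *; field.
Qed.

Section Fixed.
Variables (U : set 'rV[R]_4) (theta : 'I_4 -> dform R 4 1).
Hypothesis nth : null_cotetrad eta c U theta.

Lemma null_cotetrad_metric x : U x -> frame_metric (metric G c) theta x = null_metric C.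
Proof.
have [_ _ [_ uT] gE _] := nth; move=> Ux; have {}uT := uT x Ux.
have -> : frame_metric (metric G c) theta x = (dual_frame theta x)^T *m
    ((coframe_mx theta x)^T *m null_metric C *m coframe_mx theta x) *m dual_frame theta x.
  rewrite /frame_metric; congr (_ *m _ *m _); apply/matrixP => a b.
  by rewrite null_metric_congr gE.
by rewrite !mulmxA -trmx_mul mulmxV // trmx1 mul1mx -mulmxA mulmxV // mulmx1.
Qed.

Lemma weyl_form_cotetrad_smooth : smooth_form U (weyl_form G c).
Proof.
by have [_ Uc _ _ _] := nth; move=> v; apply: csmooth_sub Uc _; exact: weyl_form_smooth.
Qed.

Lemma frame_faraday0 x k l : frame_faraday 0 theta x k l = 0.
Proof.
rewrite /frame_faraday big1 // => a _; rewrite big1 // => b _.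
rewrite (_ : ext_d _ _ _ = 0) ?mulr0 // ext_d1E.
have p0 i (v : 'I_1 -> 'I_4) : pderive i (fun y => (0 : dform R 4 1) y v) x = 0.
  exact: pderive_cst.
by rewrite !p0 subrr.
Qed.

(** For the Levi-Civita connection the Weyl form is zero, so the curvature is skew in its first
    index pair, as [self_dual_weyl_eq0] requires. *)
Lemma asd_weyl_equation Gamma x : U x ->
  levi_civita_connection U (metric G c) theta Gamma ->
  (forall i j, asd_2form theta (weyl_2form (metric G c) theta Gamma i j) x) <->
  (forall z, let Q := frame_spin_curvature theta Gamma z x in
    z ^+ 2 * Q o1 o3 - z * Q o1 o2 - z * Q o4 o3 + Q o4 o2 = 0).
Proof.
move=> Ux wG; have [oU _ cth _ _] := nth; have hN := null_cotetrad_metric.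
have s0 : smooth_form U (0 : dform R 4 1) by move=> v; exact: csmooth_cst.
have S := self_dual_weyl_eq0 (null_riemann_anti theta Gamma x)
  (fun i j k l => null_riemann_sym oU hN wG s0 i j k l Ux)
  (fun i j k l => null_riemann_bianchi oU cth wG i j k l Ux)
  (frame_faraday0 x).
have E z : let Q := frame_spin_curvature theta Gamma z x in
    z ^+ 2 * Q o1 o3 - z * Q o1 o2 - z * Q o4 o3 + Q o4 o2 =
    2 * (z ^+ 2 * sd_curv (null_riemann theta Gamma x) z o1 o3
     - z * sd_curv (null_riemann theta Gamma x) z o1 o2
     - z * sd_curv (null_riemann theta Gamma x) z o4 o3
     + sd_curv (null_riemann theta Gamma x) z o4 o2).
  move=> Q; rewrite /Q !(frame_spin_curvatureE oU hN wG) //.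
  by move: (sd_curv _ _ _ _) (sd_curv _ _ _ _) (sd_curv _ _ _ _) (sd_curv _ _ _ _) => *; ring.
split=> [H z Q|H i j].
  apply: etrans (E z) _; rewrite S.2 ?mulr0 // => i j; exact: (asd_2formP Gamma cth hN i j Ux).1.
apply: (asd_2formP Gamma cth hN i j Ux).2; apply: S.1 => z.
by have /eqP := etrans (esym (E z)) (H z); rewrite mulf_eq0 pnatr_eq0 /= => /eqP.
Qed.

End Fixed.

Definition twistor_point x z z' : 'rV[R]_(4 + 4) := row_mx x
  (row4 (complex.Re z) (complex.Im z) (complex.Re z') (complex.Im z')).

Lemma base_twistor_point x z z' : base (twistor_point x z z') = x.
Proof. exact: row_mxKl. Qed.

Lemma zcoord_twistor_point x z z' : zcoord (twistor_point x z z') = z.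
Proof. by rewrite /zcoord row_mxKr !mxE /=; case: z. Qed.

Lemma zcoord'_twistor_point x z z' : zcoord' (twistor_point x z z') = z'.
Proof. by rewrite /zcoord' row_mxKr !mxE /=; case: z'. Qed.

End NullCotetrad.

Section AntiSelfDual.
Variables (R : realType) (M : oriented_manifold R 4) (G : weyl_geometry M)
  (eta : volume_form G).

Lemma twistor_equation_F_asd :
  vanishes_on_PP' eta (fun theta Gamma =>
     ext_d (Eform Gamma) \wedge Lambdaform theta \wedge Fform theta
       \wedge Eform Gamma)%DF
  <-> anti_self_dual eta.
Proof.
split=> [H c U theta Gamma nth wG x i j Ux|H c U theta Gamma nth wG u v Uu].
  have [oU _ cth _ _] := nth; have hN := null_cotetrad_metric nth.
  have s0 : smooth_form U (0 : dform R 4 1) by move=> ?; exact: csmooth_cst.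
  have sA := weyl_form_cotetrad_smooth nth.
  (* The reduced equation depends on [z] alone, so any z' may be used; 0 is taken. *)
  apply: (asd_weyl_equation nth Ux wG).2 => z; pose u := twistor_point x z 0.
  (* The twistor equation is assumed for Weyl connections of the given form, while [Gamma] is a
     Levi-Civita connection: the shift runs from 0 to [weyl_form]. *)
  have wG' := shift_weyl_connection oU cth hN wG s0 sA.
  have [sG' _ _] := wG'; have Uu : U (base u) by rewrite base_twistor_point.
  have := (twistor_equation_F oU cth sG' Uu).1 (fun v => H _ _ _ _ nth wG' _ v Uu).
  rewrite base_twistor_point zcoord_twistor_point => <-.
  by rewrite (self_dual_equation_shift oU cth hN wG s0 sA z Ux).
have [oU _ cth _ _] := nth; have hN := null_cotetrad_metric nth.
have s0 : smooth_form U (0 : dform R 4 1) by move=> ?; exact: csmooth_cst.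
have sA := weyl_form_cotetrad_smooth nth.
(* The shift in the opposite direction provides the Levi-Civita connection to which
   anti-self-duality applies. *)
have wG' := shift_weyl_connection oU cth hN wG sA s0.
have [sG _ _] := wG; apply: (twistor_equation_F oU cth sG Uu).2.
rewrite -(self_dual_equation_shift oU cth hN wG sA s0 _ Uu).
apply: (asd_weyl_equation nth Uu wG').1 => i j; exact: H wG' _ _ _ Uu.
Qed.

End AntiSelfDual.

(** * Existence of null cotetrads *)

Section SymmetricCongruence.
Variable F : numFieldType.

(** Polarization: if the quadratic form vanishes on every vector, its values on basis vectors and on
    their pairwise sums give twice each entry of [k]. *)
Lemma nonisotropic_vector n (k : 'M[F]_n) : k^T = k -> k != 0 ->
  exists v : 'rV[F]_n, (v *m k *m v^T) 0 0 != 0.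
Proof.
move=> ks k0; apply: contrapT => N; case/eqP: k0.
have q (v : 'rV[F]_n) : (v *m k *m v^T) 0 0 = 0.
  by have [//|Nv] := eqVneq ((v *m k *m v^T) 0 0) 0; case: N; exists v.
have b i j : ((delta_mx 0 i : 'rV[F]_n) *m k *m (delta_mx 0 j : 'rV[F]_n)^T) 0 0 = k i j.
  by rewrite trmx_delta -rowE -colE !mxE.
have d i : k i i = 0 by rewrite -b q.
apply/matrixP => i j; rewrite [RHS]mxE.
have := q ((delta_mx 0 i : 'rV[F]_n) + delta_mx 0 j).
rewrite [(_ + _)^T]linearD /= !mulmxDl !mulmxDr !mxD_entry !b !d.
have -> : k j i = k i j by rewrite -[in LHS]ks mxE.
by rewrite add0r addr0 -mulr2n => /eqP; rewrite mulrn_eq0 /= => /eqP.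
Qed.

(** The first row of [row_ebase v] is proportional to [v], so this invertible matrix brings a
    nonisotropic vector into the first position. *)
Lemma nonzero_corner n (k : 'M[F]_n.+1) : k^T = k -> k != 0 ->
  exists2 P : 'M[F]_n.+1, P \in unitmx & (P *m k *m P^T) 0 0 != 0.
Proof.
move=> ks k0; have [v qv] := nonisotropic_vector ks k0.
exists (row_ebase v); first exact: row_ebase_unit.
have v0 : v != 0 by apply: contraNneq qv => ->; rewrite !mul0mx mxE.
have vE : v = col_ebase v 0 0 *: row 0 (row_ebase v).
  rewrite -[LHS]mulmx_ebase rank_rV v0 [col_ebase v]mx11_scalar mul_scalar_mx.
  rewrite mxE eqxx mulr1n -scalemxAl; congr (_ *: _).
  rewrite rowE; congr (_ *m _); apply/matrixP => i j.
  by rewrite (ord1 i) !mxE /= ltnS leqn0 eq_sym andbT.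
have rE : (row 0 (row_ebase v) *m k *m (row 0 (row_ebase v))^T) 0 0 =
    (row_ebase v *m k *m (row_ebase v)^T) 0 0.
  rewrite -row_mul !mxM_entry; apply: eq_bigr => j _.
  by rewrite !tr_entry [row _ _ _ _]mxE [row _ _ _ _]mxE.
apply: contraNneq qv => r0; rewrite [v in v *m k]vE [v in v^T]vE.
rewrite [(_ *: _)^T]linearZ /= -!scalemxAl -scalemxAr !mxZ_entry rE r0.
by rewrite !mulr0.
Qed.

Lemma ursubmx_entry m1 m2 n1 n2 (A : 'M[F]_(m1 + m2, n1 + n2)) i j :
  ursubmx A i j = A (lshift m2 i) (rshift n1 j).
Proof. by rewrite !mxE. Qed.

Lemma drsubmx_entry m1 m2 n1 n2 (A : 'M[F]_(m1 + m2, n1 + n2)) i j :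
  drsubmx A i j = A (rshift m1 i) (rshift n1 j).
Proof. by rewrite !mxE. Qed.

Definition corner n (k : 'M[F]_(1 + n)) : F := ulsubmx k 0 0.

Lemma cornerE n (k : 'M[F]_(1 + n)) : corner k = (k : 'M[F]_n.+1) 0 0.
Proof. by rewrite /corner !mxE; congr (k _ _); apply: val_inj. Qed.

Definition schur n (k : 'M[F]_(1 + n)) : 'M[F]_n :=
  drsubmx k - (corner k)^-1 *: ((ursubmx k)^T *m ursubmx k).

(** One step of a Cholesky factorization: [s] is a square root of the corner and [S] a root of the
    Schur complement. *)
Definition root_block n (s : F) (k : 'M[F]_(1 + n)) (S : 'M[F]_n) : 'M[F]_(1 + n) :=
  block_mx s%:M (s^-1 *: ursubmx k) 0 S.

Lemma symmetric_block n (k : 'M[F]_(1 + n)) : k^T = k ->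
  k = block_mx (corner k)%:M (ursubmx k) (ursubmx k)^T (drsubmx k).
Proof.
move=> ks; rewrite -[LHS]submxK /corner -mx11_scalar; congr block_mx.
by rewrite trmx_ursub ks.
Qed.

Lemma root_blockE n s (k : 'M[F]_(1 + n)) S : k^T = k -> s ^+ 2 = corner k ->
  corner k != 0 -> S^T *m S = schur k -> (root_block s k S)^T *m root_block s k S = k.
Proof.
move=> ks s2 k0 SS; have s0 : s != 0.
  by apply: contraNneq k0 => s0; rewrite -s2 s0 expr0n.
rewrite [RHS](symmetric_block ks) /root_block tr_block_mx mulmx_block trmx0.
rewrite !mulmx0 !mul0mx !addr0 SS /schur tr_scalar_mx -scalar_mxM -expr2 s2.
rewrite mul_scalar_mx scalerA divff // scale1r mul_mx_scalar linearZ /= scalerA.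
rewrite divff // scale1r -scalemxAl -scalemxAr scalerA -invfM -expr2 s2.
by rewrite addrC subrK.
Qed.

Lemma det_schur n (k : 'M[F]_(1 + n)) : k^T = k -> corner k != 0 ->
  \det k = corner k * \det (schur k).
Proof.
move=> ks k0; pose b := ursubmx k.
have {1}-> : k = block_mx 1%:M 0 ((corner k)^-1 *: b^T) 1%:M *m
    block_mx (corner k)%:M b 0 (schur k).
  rewrite [LHS](symmetric_block ks) mulmx_block ?mul0mx ?mul1mx ?mulmx0 ?addr0.
  rewrite mul_mx_scalar scalerA divff // scale1r -scalemxAl.
  by rewrite /schur addrC subrK.
by rewrite det_mulmx det_lblock det_ublock !det1 !mul1r det_scalar1.
Qed.

Lemma schur_tr n (k : 'M[F]_(1 + n)) : k^T = k -> (schur k)^T = schur k.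
Proof.
move=> ks; rewrite /schur linearB /= linearZ /= trmx_mul trmxK trmx_drsub ks.
by [].
Qed.

End SymmetricCongruence.

Section SmoothRoot.
Variables (R : realType) (m : nat).
Local Notation C := R[i].
Implicit Types (U V : set 'rV[R]_m) (x : 'rV[R]_m).

Lemma msmooth_block p q r s U (A : 'rV[R]_m -> 'M[C]_(p, r)) (B : 'rV[R]_m -> 'M[C]_(p, s))
    (D : 'rV[R]_m -> 'M[C]_(q, r)) (E : 'rV[R]_m -> 'M[C]_(q, s)) : open U ->
  msmooth U A -> msmooth U B -> msmooth U D -> msmooth U E ->
  msmooth U (fun x => block_mx (A x) (B x) (D x) (E x)).
Proof.
move=> oU sA sB sD sE i j; rewrite -(splitK i) -(splitK j).
case: (fintype.split i) => a; case: (fintype.split j) => b.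
- by apply: (csmooth_ext oU _ (sA a b)) => x _; rewrite block_mxEul.
- by apply: (csmooth_ext oU _ (sB a b)) => x _; rewrite block_mxEur.
- by apply: (csmooth_ext oU _ (sD a b)) => x _; rewrite block_mxEdl.
- by apply: (csmooth_ext oU _ (sE a b)) => x _; rewrite block_mxEdr.
Qed.

Lemma msmooth_scale p q U f (A : 'rV[R]_m -> 'M[C]_(p, q)) : open U ->
  csmooth U f -> msmooth U A -> msmooth U (fun x => f x *: A x).
Proof.
move=> oU sf sA i j; apply: (csmooth_ext oU _ (csmooth_mul oU sf (sA i j))) => x _.
by rewrite mxZ_entry.
Qed.

(** Induction on the size. A constant congruence by [P] makes the corner nonzero at [x], hence
    nonzero and with a smooth square root on a neighbourhood; the Schur complement there is
    symmetric, smooth and invertible at [x], so the induction hypothesis applies to it. *)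
Lemma smooth_symmetric_root n (k : 'rV[R]_m -> 'M[C]_n) U x : open U -> U x ->
  msmooth U k -> (forall y, U y -> (k y)^T = k y) -> k x \in unitmx ->
  exists V, exists S : 'rV[R]_m -> 'M[C]_n, [/\ open V, V x, V `<=` U, msmooth V S
    & forall y, V y -> (S y)^T *m S y = k y].
Proof.
elim: n k U => [|n IH] k U oU Ux sk ks ku.
  exists U, (fun=> 0); split=> //; first exact: msmooth_cst.
  by move=> y _; apply/matrixP => -[].
have k0 : k x != 0 by apply: contraTneq ku => ->; rewrite unitmxE det0 unitr0.
have [P uP cP] := nonzero_corner (ks x Ux) k0.
pose l y : 'M[C]_(1 + n) := P *m k y *m P^T.
have sl : msmooth U l.
  exact: (msmooth_mul oU (msmooth_mul oU (msmooth_cst U P) sk) (msmooth_cst U P^T)).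
have ls y : U y -> (l y)^T = l y.
  by move=> Uy; rewrite /l !trmx_mul trmxK ks // mulmxA.
have cE y : corner (l y) = (l y : 'M[C]_n.+1) 0 0 by rewrite cornerE.
have sc : csmooth U (fun y => corner (l y)).
  by apply: (csmooth_ext oU _ (sl 0 0)) => y _; rewrite cE.
have c0 : corner (l x) != 0 by rewrite cE.
have [V1 [s [oV1 V1x V1U ss sE]]] := csmooth_sqrt oU Ux sc c0.
pose V2 := [set y | V1 y /\ corner (l y) != 0].
have V21 : V2 `<=` V1 by move=> y [].
have V2U : V2 `<=` U by move=> y [/V1U].
have oV2 : open V2 by exact: open_neq0 oV1 (csmooth_sub V1U sc).
have sc2 := csmooth_sub V2U sc; have sl2 := msmooth_sub V2U sl.
have sur : msmooth V2 (fun y => ursubmx (l y)).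
  move=> i j; apply: (csmooth_ext oV2 _ (sl2 (lshift n i) (rshift 1 j))) => y _.
  by rewrite ursubmx_entry.
have ssch : msmooth V2 (fun y => schur (l y)).
  apply: (msmooth_add oV2 _ (msmooth_opp oV2 _)).
    move=> i j; apply: (csmooth_ext oV2 _ (sl2 (rshift 1 i) (rshift 1 j))) => y _.
    by rewrite drsubmx_entry.
  apply: (msmooth_scale oV2 (csmooth_inv oV2 _ sc2) _); first by move=> y [].
  exact: msmooth_mul oV2 (msmooth_tr oV2 sur) sur.
have schu : schur (l x) \in unitmx.
  have : l x \in unitmx by rewrite /l !unitmx_mul unitmx_tr uP ku.
  by rewrite !unitmxE (det_schur (ls x Ux) c0) unitrM => /andP[].
have [V [S [oV Vx VV2 sS SE]]] := IH _ V2 oV2 (conj V1x c0) ssch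
  (fun y Vy => schur_tr (ls y (V2U y Vy))) schu.
(* The root is built for P k P^T; the factor on the right undoes this congruence. *)
exists V, (fun y => (root_block (s y) (l y) (S y) : 'M[C]_n.+1) *m invmx P^T); split=> //.
- by move=> y /VV2 /V2U.
- have VV1 : V `<=` V1 by move=> y /VV2 /V21.
  have s0 y : V y -> s y != 0.
    move=> Vy; have [V1y cy] := VV2 y Vy; apply: contraNneq cy => s0.
    by rewrite -sE // s0 expr0n.
  have ssV := csmooth_sub VV1 ss.
  have sB : msmooth V (fun y => block_mx (s y)%:M ((s y)^-1 *: ursubmx (l y))
      (0 : 'M[C]_(n, 1)) (S y)).
    apply: (msmooth_block oV _ _ _ sS).
    - apply: (msmooth_ext oV _ (msmooth_scale oV ssV (msmooth_cst V 1%:M))) => y _.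
      by rewrite scalemx1.
    - exact: msmooth_scale oV (csmooth_inv oV s0 ssV) (msmooth_sub VV2 sur).
    - exact: msmooth_cst.
  exact: msmooth_mul oV sB (msmooth_cst V (invmx P^T)).
- move=> y Vy; have [V1y cy] := VV2 y Vy; have Uy := V1U y V1y.
  rewrite trmx_mul mulmxA -(mulmxA (invmx P^T)^T).
  rewrite (root_blockE (ls y Uy) (sE y V1y) cy (SE y Vy)) /l trmx_inv trmxK.
  by rewrite !mulmxA mulVmx // mul1mx mulmxK // unitmx_tr.
Qed.

End SmoothRoot.

Section NullCotetradExistence.
Variable R : realType.
Local Notation C := R[i].
Local Notation h := (null_metric C).

(* Rows [e1 + i e2, e1 - i e2, e3 + i e4, - e3 + i e4] of an orthonormal coframe,
   the first two being exchanged when [s = -1]. *)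
Definition null_rows (s : C) : 'M[C]_4 := \matrix_(i, j) nth 0 (nth [::]
  [:: [:: 1; s * 'i; 0; 0]; [:: 1; - (s * 'i); 0; 0];
      [:: 0; 0; 1; 'i]; [:: 0; 0; - 1; 'i]] i) j.

Lemma null_rows_congr s : s ^+ 2 = 1 -> (null_rows s)^T *m h *m null_rows s = 1%:M.
Proof.
move=> s2; have i2 := sqrCi C; have ss : (s * 'i) ^+ 2 = -1 by rewrite exprMn s2 i2 mul1r.
rewrite -mulmxA; apply/matrixP; apply: ord4_ind; apply: ord4_ind;
  rewrite mxM_entry sum_ord4 !null_mulE !mxE /= ?mulr1n ?mulr0n;
  move: (s * 'i) ('i : C) ss i2 => t u.
all: try by move=> t2 u2; field.
  move=> t2 u2; transitivity (- (s * u) ^+ 2); first by field.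
  by rewrite t2 opprK.
move=> t2 u2; transitivity (- u ^+ 2); first by field.
by rewrite u2 opprK.
Qed.

(** The factor 4 is the square root of the 16 relating [vol] to the determinant of the metric; [s]
    carries the orientation. *)
Lemma det_null_rows s : \det (null_rows s) = 4 * s.
Proof.
rewrite /null_rows (det_mx4 (fun i j => nth 0 (nth [::] [:: [:: 1; s * 'i; 0; 0];
  [:: 1; - (s * 'i); 0; 0]; [:: 0; 0; 1; 'i]; [:: 0; 0; - 1; 'i]] i) j)) /=.
transitivity (- 4 * s * 'i ^+ 2); first by move: ('i : C) => u; ring.
by rewrite sqrCi; ring.
Qed.

Lemma wedge_minor n k l (a : dform R n k) (b : dform R n l) x A B :
  (forall v, a x v = minor_form A v) -> (forall v, b x v = minor_form B v) ->
  forall v, wedge a b x v = minor_form (col_mx A B) v.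
Proof.
move=> aE bE v.
rewrite (@wedge_minor_form _ 'I_1 _ _ _ a b x (fun=> 1) (fun=> A) B) ?big_ord1 ?mul1r //.
by move=> w; rewrite big_ord1 mul1r.
Qed.

Lemma wedge4_det (theta : 'I_4 -> dform R 4 1) x :
  (theta o1 \wedge theta o2 \wedge theta o3 \wedge theta o4)%DF x id =
  \det (coframe_mx theta x).
Proof.
have E := wedge_minor (wedge_minor (wedge_minor (covector_minor_form (theta o1) x)
  (covector_minor_form (theta o2) x)) (covector_minor_form (theta o3) x))
  (covector_minor_form (theta o4) x).
apply: etrans (E id) _; rewrite /minor_form; congr (\det _).
apply/matrixP => i j; rewrite [LHS]mxE.
transitivity (four_rows (covector (theta o1) x) (covector (theta o2) x)
  (covector (theta o3) x) (covector (theta o4) x) i j); first by [].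
rewrite four_rowsE [LHS]mxE [RHS]mxE.
by move: i; apply: ord4_ind; rewrite /= mxE.
Qed.

Definition forms_of_mx (T : 'rV[R]_4 -> 'M[C]_4) : 'I_4 -> dform R 4 1 :=
  fun i x v => T x i (v ord0).

Lemma coframe_mxK T x : coframe_mx (forms_of_mx T) x = T x.
Proof. by apply/matrixP => i j; rewrite mxE. Qed.

(** The rows of a root [S] of the metric form an orthonormal coframe, and [null_rows s] recombines
    them into a null one. Since vol^2 = (4 det S)^2, the sign [s] can be chosen to match the
    orientation at [x]. *)
Lemma exists_null_cotetrad (M : oriented_manifold R 4) (G : weyl_geometry M)
    (eta : volume_form G) (c : chart M) U x :
  open U -> U `<=` chart_image c -> U x ->
  exists V theta, [/\ null_cotetrad eta c V theta, V x & V `<=` U].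
Proof.
move=> oU Uc Ux; pose g := metric G c.
have sg : msmooth U g by move=> i j; exact: csmooth_sub Uc (metric_smooth _ _ _ _).
have [V [S [oV Vx VU sS SE]]] := smooth_symmetric_root oU Ux sg
  (fun y Uy => Defs.metric_sym G (Uc y Uy)) (metric_nondeg G (Uc x Ux)).
have Vc y : V y -> chart_image c y by move=> /VU /Uc.
have sD := csmooth_det oV sS; have sv := csmooth_sub Vc (vol_smooth eta c).
have gD y : V y -> \det (S y) ^+ 2 = \det (g y).
  by move=> Vy; rewrite -SE // det_mulmx det_tr expr2.
have D0 y : V y -> \det (S y) != 0.
  move=> Vy; have := metric_nondeg G (Vc y Vy); rewrite unitmxE unitfE.
  by rewrite -/(g y) -gD // sqrf_eq0.
have vE y : V y -> vol eta c y ^+ 2 = (4 * \det (S y)) ^+ 2.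
  move=> Vy; rewrite (vol_sqr eta (Vc y Vy)) exprMn gD //.
  by congr (_ * _); rewrite expr2 -natrM.
have [s [s2 sx]] : exists s : C, s ^+ 2 = 1 /\ vol eta c x = 4 * s * \det (S x).
  have /eqP := vE x Vx; rewrite eqf_sqr => /orP[/eqP->|/eqP->].
    by exists 1; rewrite expr1n mulr1.
  by exists (-1); rewrite sqrrN expr1n mulrN1 mulNr.
have s0 : s != 0.
  by apply/eqP => s0; move: s2; rewrite s0 expr0n => /esym/eqP; rewrite oner_eq0.
have n0 : vol eta c x + 4 * s * \det (S x) != 0.
  by rewrite sx -mulr2n mulrn_eq0 /= !mulf_neq0 ?pnatr_eq0 ?D0.
have ss := csmooth_add oV sv (csmooth_mul oV (csmooth_cst V (4 * s)) sD).
(* On [W] the second factor of vol^2 - (4 s det S)^2 is nonzero, so the first one vanishes and the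
   orientation is right on all of [W], not only at [x]. *)
pose W := [set y | V y /\ vol eta c y + 4 * s * \det (S y) != 0].
have WV : W `<=` V by move=> y [].
pose T y := null_rows s *m S y.
have dT y : \det (T y) = 4 * s * \det (S y) by rewrite det_mulmx det_null_rows.
exists W; exists (forms_of_mx T); split=> //; last by move=> y /WV /VU.
split.
- exact: (open_neq0 oV ss).
- by move=> y /WV /Vc.
- apply/coframeP; split.
    have oW : open W by exact: open_neq0 oV ss.
    apply: (msmooth_ext oW (fun y _ => esym (coframe_mxK T y))).
    exact: (msmooth_mul oW (msmooth_cst W (null_rows s)) (msmooth_sub WV sS)).
  move=> y [Vy yn]; rewrite coframe_mxK unitmxE unitfE dT !mulf_neq0 ?pnatr_eq0 ?D0 //.
- move=> y a b /WV Vy; rewrite -null_metric_congr coframe_mxK -/g -SE //.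
  by rewrite /T trmx_mul -!mulmxA (mulmxA _^T h) (mulmxA (_^T *m h)) null_rows_congr // mul1mx.
- move=> y [Vy yn]; rewrite wedge4_det coframe_mxK dT; apply/eqP.
  have e : (4 * s * \det (S y)) ^+ 2 = (4 * \det (S y)) ^+ 2.
    by rewrite !exprMn s2 mulr1.
  have /eqP := vE y Vy; rewrite -e -subr_eq0 subr_sqr mulf_eq0 (negPf yn) orbF subr_eq0.
  by [].
Qed.

End NullCotetradExistence.

Lemma congruenceK (F : comNzRingType) n (K L S : 'M[F]_n) : K *m L = 1%:M ->
  L^T *m (K^T *m S *m K) *m L = S.
Proof.
by move=> KL; rewrite !mulmxA -trmx_mul KL trmx1 mul1mx -mulmxA KL mulmx1.
Qed.

(** * The Einstein-Weyl equations and the second twistor equation *)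

Section EinsteinWeyl.
Variables (R : realType) (M : oriented_manifold R 4) (G : weyl_geometry M)
  (eta : volume_form G).
Local Notation C := R[i].

Lemma sym_ricci0_equation (c : chart M) U (theta : 'I_4 -> dform R 4 1) Gamma x :
  null_cotetrad eta c U theta ->
  weyl_connection U (metric G c) (weyl_form G c) theta Gamma -> U x ->
  (forall i j, sym_ricci0 (metric G c) theta Gamma i j x = 0) <->
  (forall z z' : C, let Q := frame_spin_curvature theta Gamma z x in
    z' ^+ 2 * Q o2 o3 - z' * Q o2 o1 - z' * Q o4 o3 + Q o4 o1 = 0).
Proof.
move=> nth wG Ux; have [oU _ cth _ _] := nth; have hN := null_cotetrad_metric nth.
have sA := weyl_form_cotetrad_smooth nth.
have S := mixed_curvature_eq0 (null_riemann_anti theta Gamma x)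
  (fun i j k l => null_riemann_sym oU hN wG sA i j k l Ux)
  (fun i j k l => null_riemann_bianchi oU cth wG i j k l Ux).
have E z z' : let Q := frame_spin_curvature theta Gamma z x in
    z' ^+ 2 * Q o2 o3 - z' * Q o2 o1 - z' * Q o4 o3 + Q o4 o1 =
    2 * (z' ^+ 2 * sd_curv (null_riemann theta Gamma x) z o2 o3
     - z' * sd_curv (null_riemann theta Gamma x) z o2 o1
     - z' * sd_curv (null_riemann theta Gamma x) z o4 o3
     + sd_curv (null_riemann theta Gamma x) z o4 o1).
  move=> Q; rewrite /Q !(frame_spin_curvatureE oU hN wG) //.
  by move: (sd_curv _ _ _ _) (sd_curv _ _ _ _) (sd_curv _ _ _ _) (sd_curv _ _ _ _) => *; ring.
split=> [H z z' Q|H i j].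
  apply: etrans (E z z') _; rewrite S.2 ?mulr0 // => i j.
  by rewrite -(sym_ricci0_null Gamma hN i j Ux).
rewrite (sym_ricci0_null Gamma hN i j Ux); apply: S.1 => z z'.
by have /eqP := etrans (esym (E z z')) (H z z'); rewrite mulf_eq0 pnatr_eq0 /= => /eqP.
Qed.

Lemma twistor_equation_F'_einstein_weyl :
  vanishes_on_PP' eta (fun theta Gamma =>
     ext_d (Eform Gamma) \wedge Lambdaform theta \wedge Fform' theta
       \wedge Eform Gamma)%DF
  <-> einstein_weyl G.
Proof.
split=> [H c U theta Gamma oU Uc cth wG x i j Ux|H c U theta Gamma nth wG u v Uu].
  have [V [theta' [nth Vx VU]]] := exists_null_cotetrad eta oU Uc Ux.
  have [oV _ cth' _ _] := nth; have hN := null_cotetrad_metric nth.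
  have [sT uT] := (coframeP U theta).1 cth.
  have [sT' uT'] := (coframeP V theta').1 cth'.
  have Vc y : V y -> chart_image c y by move=> /VU /Uc.
  have cthV : coframe V theta.
    by apply/coframeP; split; [exact: msmooth_sub VU sT|move=> y /VU /uT].
  have wGV : weyl_connection V (metric G c) (weyl_form G c) theta Gamma.
    have [s m t] := wG; split=> [a b w|a b y w /VU|a y /VU]; [|exact: m|exact: t].
    exact: csmooth_sub VU (s a b w).
  (* [L] carries the given coframe to the null cotetrad and [K] is its inverse. The gauge transform
     of [Gamma] is then a Weyl connection in the cotetrad, to which the twistor hypothesis
     applies. *)
  pose L y := coframe_mx theta' y *m invmx (coframe_mx theta y).
  pose K y := coframe_mx theta y *m invmx (coframe_mx theta' y).
  have sTV := msmooth_sub VU sT.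
  have uTV y : V y -> coframe_mx theta y \in unitmx by move=> /VU /uT.
  have sL : msmooth V L by exact: (msmooth_mul oV sT' (msmooth_invmx oV uTV sTV)).
  have sK : msmooth V K by exact: (msmooth_mul oV sTV (msmooth_invmx oV uT' sT')).
  have LK y : V y -> L y *m K y = 1%:M.
    by move=> Vy; rewrite /L /K mulmxA mulmxKV ?uTV // mulmxV ?uT'.
  have thE y : V y -> coframe_mx theta' y = L y *m coframe_mx theta y.
    by move=> Vy; rewrite /L mulmxKV ?uTV.
  have gs y : V y -> (metric G c y)^T = metric G c y.
    by move=> Vy; exact: (Defs.metric_sym G (Vc y Vy)).
  have sg : msmooth V (metric G c).
    by move=> a b; exact: csmooth_sub Vc (metric_smooth _ _ _ _).
  have se := msmooth_invmx oV uTV sTV.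
  have sh : msmooth V (frame_metric (metric G c) theta).
    exact: (msmooth_mul oV (msmooth_mul oV (msmooth_tr oV se) sg) se).
  have wG' := gauge_weyl_connection oV sL sK LK cthV thE gs wGV sh.
  have hs : (frame_metric (metric G c) theta x)^T = frame_metric (metric G c) theta x.
    by rewrite /frame_metric !trmx_mul trmxK gs // mulmxA.
  have hu : frame_metric (metric G c) theta x \in unitmx.
    rewrite /frame_metric !unitmx_mul unitmx_tr /dual_frame unitmx_inv uTV //.
    by rewrite (metric_nondeg G (Vc x Vx)).
  rewrite sym_ricci0E //.
  (* In the null cotetrad every pair [z], z' is reached by a point of the bundle over [x], so the
     reduced equation holds identically in both variables. *)
  have S0 : sym_ric0_mx (metric G c) theta' (gauge Gamma L K) x = 0.
    apply/matrixP => a b; rewrite [RHS]mxE -sym_ricci0E ?hN ?null_metric_tr ?null_metric_unit //.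
    apply: (sym_ricci0_equation nth wG' Vx).2 => z z'.
    have [sG' _ _] := wG'; pose u := twistor_point x z z'.
    have Vu : V (base u) by rewrite base_twistor_point.
    have := (twistor_equation_F' oV cth' sG' Vu).1 (fun v => H _ _ _ _ nth wG' _ v Vu).
    by rewrite base_twistor_point zcoord_twistor_point zcoord'_twistor_point.
  have E := gauge_sym_ric0_mx oV sL sK LK cthV thE wGV Vx hu.
  have KL : K x *m L x = 1%:M by apply: mulmx1C; exact: LK.
  (* The tensor in the given coframe is recovered by the inverse congruence, so it vanishes along
     with its transform. *)
  have <- : (L x)^T *m ((K x)^T *m sym_ric0_mx (metric G c) theta Gamma x *m K x) *m L x
      = sym_ric0_mx (metric G c) theta Gamma x by exact: congruenceK.
  by rewrite -E S0 mulmx0 mul0mx mxE.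
have [oU Uc cth _ _] := nth; have [sG _ _] := wG.
apply: (twistor_equation_F' oU cth sG Uu).2.
apply: (sym_ricci0_equation nth wG Uu).1 => i j; exact: H oU Uc cth wG _ _ _ Uu.
Qed.

End EinsteinWeyl.

Local Open Scope dform_scope.

Theorem theorem6p1 (R : realType) (M : oriented_manifold R 4)
    (G : weyl_geometry M) (eta : volume_form G) :
  (vanishes_on_PP' eta (fun theta Gamma =>
     ext_d (Eform Gamma) \wedge Lambdaform theta \wedge Fform theta
       \wedge Eform Gamma)
   <-> anti_self_dual eta) /\
  (vanishes_on_PP' eta (fun theta Gamma =>
     ext_d (Eform Gamma) \wedge Lambdaform theta \wedge Fform' theta
       \wedge Eform Gamma)
   <-> einstein_weyl G).
Proof.
split; [exact: twistor_equation_F_asd|exact: twistor_equation_F'_einstein_weyl].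
Qed.
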